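(* Let $p$ be an odd prime, $K/F$ a CM quadratic extension of a totally real field, $v\nmid p$ a finite place of $F$ such that $K_v$ is a field, and $\lambda_v$ the component at $v$ of an algebraic Hecke character of $K$. Let $\theta\in K_v^\times$ with $\bar\theta=-\theta$. Suppose that $\lambda_v$ is residually self-dual. Then $$\epsilon(1/2,\lambda_v^*,\psi_{K_v})\equiv\pm\lambda_v^*(2\theta)\pmod{\mathfrak m_p}.$$ Furthermore: (1) If $\mu_p(\lambda_v)=0$, then for $\beta\in F_v^\times$, $A_\beta(\lambda_v^*,\theta)\not\equiv0\pmod{\mathfrak m_p}$ implies $\epsilon(1/2,\lambda_v^*,\psi_{K_v})\equiv\tau_{K_v/F_v}(\beta)\lambda_v^*(2\theta)\pmod{\mathfrak m_p}$. (2) Suppose that $\mu_p(\lambda_v)>0$, and let $\varpi_v$ be a uniformizer of $F_v$. (a) If $\mathrm{ord}_p(\lambda_v^*(\varpi_v)+1)=\inf_{x\in\mathcal O_{K,v}^\times}\mathrm{ord}_p(\lambda_v(x)-1)$, then for each $\delta\in\{\pm1\}$ there exists $\beta_\delta\in F_v^\times$ such that $\mathrm{ord}_pA_{\beta_\delta}(\lambda_v^*,\theta)=\mu_p(\lambda_v)$ and $\epsilon(1/2,\lambda_v^*,\psi_{K_v})\equiv\delta\cdot\tau_{K_v/F_v}(\beta_\delta)\lambda_v^*(2\theta)\pmod{\mathfrak m_p}$. (b) If $\mathrm{ord}_p(\lambda_v^*(\varpi_v)+1)>\inf_{x\in\mathcal O_{K,v}^\times}\mathrm{ord}_p(\lambda_v(x)-1)$,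 then for $\beta\in F_v^\times$, $\mathrm{ord}_pA_\beta(\lambda_v^*,\theta)=\mu_p(\lambda_v)$ implies $\epsilon(1/2,\lambda_v^*,\psi_{K_v})\equiv\tau_{K_v/F_v}(\beta)\lambda_v^*(2\theta)\pmod{\mathfrak m_p}$. (c) If $\mathrm{ord}_p(\lambda_v^*(\varpi_v)+1)<\inf_{x\in\mathcal O_{K,v}^\times}\mathrm{ord}_p(\lambda_v(x)-1)$, then for $\beta\in F_v^\times$, $\mathrm{ord}_pA_\beta(\lambda_v^*,\theta)=\mu_p(\lambda_v)$ implies $\epsilon(1/2,\lambda_v^*,\psi_{K_v})\equiv-\tau_{K_v/F_v}(\beta)\lambda_v^*(2\theta)\pmod{\mathfrak m_p}$.
   Context: Fix embeddings $\overline{\mathbb Q}\to\mathbb C$ and $\overline{\mathbb Q}\to\mathbb C_p$; $\mathfrak m_p$ is the maximal ideal of $\overline{\mathbb Z}_p$, $\mathrm{ord}_p(p)=1$, and $\mathrm{ord}_p(0)=+\infty$. Since $v\nmid p$, $\lambda_v:K_v^\times\to\overline{\mathbb Q}^\times$ takes $p$-adic unit values. $\lambda_v^*=\lambda_v|\cdot|_{K_v^\times}^{-1/2}$; $\tau_{K_v/F_v}$ is the quadratic character of $F_v^\times$ attached to $K_v/F_v$. ''$\lambda_v$ residually self-dual'' means $\lambda_v^*|_{F_v^\times}\equiv\tau_{K_v/F_v}\pmod{\mathfrak m_p}$, i.e. $\lambda_v(x)|x|_{F_v}^{-1}\equiv\tau_{K_v/F_v}(x)$ for $x\in F_v^\times$.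 $\psi_v$ is a nontrivial additive character of $F_v$, $\psi_{K_v}=\psi_v\circ\mathrm{tr}_{K_v/F_v}$, and $\epsilon(1/2,\cdot,\psi_{K_v})$ is Tate's local epsilon factor (self-dual measure). $x\mapsto\bar x$ is the nontrivial automorphism of $K_v/F_v$; $\mathcal O_{K,v}$ is the ring of integers of $K_v$ and $\mathcal O_{F,v}$ that of $F_v$. $\mu_p(\lambda_v):=\inf_{x\in K_v^\times}\mathrm{ord}_p(\lambda_v(x)-1)$. For $\beta\in F_v^\times$, $$A_\beta(\lambda_v^*,\theta):=\int_{F_v}(\lambda_v^* )^{-1}\Big(x+\frac1{4\theta}\Big)\Big|x+\frac1{4\theta}\Big|_{K_v^\times}^{-s-\frac12}\psi_v(-\beta x)\,d^0x\,\Big|_{s=0},$$ where $d^0x$ is the Haar measure on $F_v$ self-dual for $\psi_v$ and the value at $s=0$ is by analytic continuation (equivalently, the limit of integrals over $\varpi_v^{-n}\mathcal O_{F,v}$ at $s=0$, which stabilizes).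
   Formalization: Part (2) additionally assumes λ_v is ramified (nontrivial on O_{K,v}^×): for unramified λ_v with μ_p(λ_v)>0, (a) and (c) are false as printed and (b) is vacuous. The epsilon factor uses the Fourier transform with ψ(-xy), as in Tate's thesis. *)

(* Defs.v *)
From HB Require Import structures.
From mathcomp Require Import all_boot all_order all_algebra all_field.
From mathcomp Require Import finmap boolp classical_sets functions cardinality fsbigop.
From mathcomp Require Import reals constructive_ereal ereal.
Set Implicit Arguments.
Unset Strict Implicit.
Unset Printing Implicit Defensive.
Import Order.TTheory GRing.Theory Num.Theory.
Local Open Scope classical_set_scope.
Local Open Scope ring_scope.

(* MathComp's algebraic closure [algC] of Q plays the role of Qbar.  Its order
   and conjugation amount to a fixed embedding Qbar -> C; in particular
   [sqrtC] of a positive rational number is its positive square root. *)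

(* The eventual value of an eventually constant sequence. *)
Definition stable_value (u : nat -> algC) : algC :=
  xget 0 [set l | exists N, forall n, (N <= n)%N -> u n = l].

(** * Discrete valuations and local fields *)

Section Valuation.
Variables (L : fieldType) (w : L -> int).

(* Normalized discrete valuations; on a number field these are exactly the
   finite places.  The junk value [w 0 = 0] (instead of +oo) makes distinct
   functions distinct places. *)
Definition finite_place : Prop :=
  [/\ w 0 = 0,
      exists x, x != 0 /\ w x = 1,
      forall x y, x != 0 -> y != 0 -> w (x * y) = w x + w y &
      forall x y, x != 0 -> y != 0 -> x + y != 0 ->
        Order.min (w x) (w y) <= w (x + y)].

Definition ball (n : int) : set L := [set x | x = 0 \/ n <= w x].

Definition valuation_complete : Prop :=
  forall u : nat -> L,
    (forall M, exists N, forall i j, (N <= i)%N -> (N <= j)%N ->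
       ball M (u i - u j)) ->
    exists l, forall M, exists N, forall i, (N <= i)%N -> ball M (u i - l).

(* The quotient of [ball n] by [ball m], for n <= m. *)
Definition cosets (n m : int) : set (set L) :=
  [set [set y | ball m (y - x)] | x in ball n].

Definition local_field : Prop :=
  [/\ finite_place, valuation_complete & finite_set (cosets 0 1)].

Definition residue_card : nat := (#|` fset_set (cosets 0 1)|)%fset.

Definition nabs (x : L) : algC :=
  if x == 0 then 0 else (residue_card%:R : algC) ^ (- w x).

(* Locally constant homomorphisms from the multiplicative group to Qbar^*; the
   value at 0 is irrelevant.  For a finite place w of a number field L, density
   of L in L_w makes these the same as the locally constant characters of
   L_w^*. *)
Definition quasicharacter (chi : L -> algC) : Prop :=
  [/\ forall x, x != 0 -> chi x != 0,
      forall x y, x != 0 -> y != 0 -> chi (x * y) = chi x * chi y &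
      exists2 n : int, 0 < n & forall x, ball n (x - 1) -> chi x = 1].

Definition unramified (chi : L -> algC) : Prop :=
  forall x, x != 0 -> w x = 0 -> chi x = 1.

(* Continuous characters of (L, +) have values in roots of unity, and are
   locally constant. *)
Definition nontrivial_additive_character (psi : L -> algC) : Prop :=
  [/\ forall x y, psi (x + y) = psi x * psi y,
      exists n, forall x, ball n x -> psi x = 1 &
      exists x, psi x != 1].

Definition schwartz (f : L -> algC) : Prop :=
  exists N : int,
    (forall x, ~ ball (- N) x -> f x = 0) /\
    (forall x y, ball N y -> f (x + y) = f x).

(* Integral of a Schwartz function for the Haar measure giving mass [c] to
   [ball 0]: a coset of [ball N] has mass c * q^(-N). *)
Definition haar (c : algC) (f : L -> algC) : algC :=
  stable_value (fun N =>
    c * (residue_card%:R ^+ N)^-1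
      * \sum_(C \in cosets (- N%:Z) N%:Z) f (xget 0 C)).

(* The Fourier transform carries the minus sign of Tate's thesis, hence so does
   the epsilon factor below; with psi (x * y) instead, epsilon (1/2, chi, psi)
   would be multiplied by chi (-1), and tau(beta) would have to be replaced by
   tau(-beta) in its comparison with A_beta. *)
Definition fourier (c : algC) (psi f : L -> algC) (y : L) : algC :=
  haar c (fun x => f x * psi (- (x * y))).

(* [c] is the mass of [ball 0] for the measure which is self-dual for psi. *)
Definition self_dual (psi : L -> algC) (c : algC) : Prop :=
  0 < c /\ forall f, schwartz f ->
    forall x, fourier c psi (fourier c psi f) x = f (- x).

(** * Tate's local zeta integrals and epsilon factor *)

(* Integral of f * chi over {w x = n} for the measure dx / |x|. *)
Definition shell_integral (c : algC) (chi f : L -> algC) (n : int) : algC :=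
  (residue_card%:R ^ n)
    * haar c (fun x => if (x != 0) && (w x == n) then f x * chi x else 0).

Definition uniformizer : L := xget 0 [set x | x != 0 /\ w x = 1].

(* With X = q^(-s) one has L(s, chi) = (1 - L_coef chi * X)^-1. *)
Definition L_coef (chi : L -> algC) : algC :=
  if `[< unramified chi >] then chi uniformizer else 0.

(* zeta(f, chi, s) = \sum_n (shell_integral c chi f n) X^n with X = q^(-s);
   zeta(f, chi, s) / L(s, chi) is a Laurent polynomial in X, evaluated here as
   the eventual value of its symmetric partial sums. *)
Definition zeta_over_L (c : algC) (chi f : L -> algC) (X : algC) : algC :=
  stable_value (fun N =>
    \sum_(i < N.*2)
      let n := i%:Z - N%:Z in
      (shell_integral c chi f n - L_coef chi * shell_integral c chi f (n - 1))
        * X ^ n).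

(* [e] is epsilon(1/2, chi, psi): the local functional equation
   zeta(f^, chi^-1, 1 - s) / L(1 - s, chi^-1)
     = epsilon(s, chi, psi) * zeta(f, chi, s) / L(s, chi)  at s = 1/2. *)
Definition is_epsilon_half (c : algC) (psi chi : L -> algC) (e : algC) : Prop :=
  let X := (sqrtC residue_card%:R)^-1 in
  forall f, schwartz f ->
    zeta_over_L c (fun x => (chi x)^-1) (fourier c psi f) X
      = e * zeta_over_L c chi f X.

Definition star (lam : L -> algC) (x : L) : algC := lam x / sqrtC (nabs x).

End Valuation.

(** * Quadratic extensions of local fields *)

Section Quadratic.
Variables (Fv : fieldType) (vF : Fv -> int) (Kv : fieldExtType Fv)
  (vK : Kv -> int) (bar : Kv -> Kv).

Definition quad_trace (x : Kv) : Fv := xget 0 [set t | t%:A = x + bar x].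

Definition psi_ext (psi : Fv -> algC) (x : Kv) : algC := psi (quad_trace x).

(* The quadratic character attached to Kv / Fv: its kernel is the group of
   norms. *)
Definition quad_char (x : Fv) : algC :=
  if `[< exists z : Kv, z != 0 /\ x%:A = z * bar z >] then 1 else -1.

(* The value at s = 0 is the eventual value of the integrals over
   varpi^(-n) O_F.  The argument x + 1/(4 theta) never vanishes. *)
Definition A_coef (c : algC) (psi : Fv -> algC) (chi : Kv -> algC)
    (theta : Kv) (beta : Fv) : algC :=
  stable_value (fun n =>
    haar vF c (fun x =>
      if `[< ball vF (- n%:Z) x >] then
        let z := x%:A + (4%:R * theta)^-1 in
        (chi z)^-1 * (sqrtC (nabs vK z))^-1 * psi (- (beta * x))
      else 0)).

End Quadratic.

(** * Number fields and Hecke characters *)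

Definition totally_real (L : fieldType) : Prop :=
  forall (s : {rmorphism L -> algC}) x, s x \is Num.real.

Definition totally_imaginary (L : fieldType) : Prop :=
  forall s : {rmorphism L -> algC}, exists x, s x \isn't Num.real.

Definition CM_extension (F : fieldExtType rat) (K : fieldExtType F) : Prop :=
  [/\ totally_real F, \dim {:K} = 2%N & totally_imaginary K].

Definition dense_image (L M : fieldType) (w : M -> int) (i : L -> M) : Prop :=
  forall x n, exists a, ball w n (x - i a).

Definition embeddings (L : fieldType) : set (L -> algC) :=
  range (fun s : {rmorphism L -> algC} => s : L -> algC).

(* An algebraic Hecke character of a number field L without real embeddings,
   given by its local components at the finite places, restricted to the
   nonzero elements of L.  Triviality on principal ideles says that their product on a in L^* is the
   inverse of the archimedean component, which algebraicity requires to be of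
   the form \prod_s s(a)^(- m s) over the embeddings s. *)
Definition algebraic_hecke_character (L : fieldType)
    (chi : (L -> int) -> L -> algC) : Prop :=
  [/\ forall w, finite_place w -> quasicharacter w (chi w),
      finite_set [set w | finite_place w /\ ~ unramified w (chi w)] &
      exists m : (L -> algC) -> int, forall a, a != 0 ->
        \big[*%R/1]_(w \in [set w | finite_place w]) chi w a
          = \big[*%R/1]_(s \in @embeddings L) (s a ^ m s)].

(** * The p-adic side *)

Section PAdic.
Variables (R : realType) (p : nat) (Cp : closedFieldType) (ord : Cp -> \bar R).
Local Open Scope ereal_scope.

(* (Cp, ord) is the field C_p with its valuation such that ord p = 1: it is
   algebraically closed and complete, and the numbers algebraic over Q are
   dense in it. *)
Definition is_padic_complex : Prop :=
  [/\ [/\ forall x, -oo < ord x,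
          forall x, ord x = +oo <-> x = 0%R,
          forall x y, ord (x * y)%R = ord x + ord y,
          forall x y, Order.min (ord x) (ord y) <= ord (x + y)%R &
          ord p%:R%R = 1],
      forall u : nat -> Cp,
        (forall M : R, exists N, forall i j, (N <= i)%N -> (N <= j)%N ->
           M%:E <= ord (u i - u j)%R) ->
        exists l, forall M : R, exists N, forall i, (N <= i)%N ->
          M%:E <= ord (u i - l)%R &
      forall x (M : R), exists2 y,
        algebraicOver (ratr : rat -> Cp) y & M%:E <= ord (x - y)%R].

Variable iota : algC -> Cp.

Definition ordp (x : algC) : \bar R := ord (iota x).

(* Congruence modulo the maximal ideal of the integers of Qbar_p. *)
Definition congr_p (x y : algC) : Prop := 0 < ordp (x - y)%R.

Definition mu_p (L : fieldType) (lam : L -> algC) : \bar R :=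
  ereal_inf [set ordp (lam x - 1)%R | x in [set x | x != 0%R]].

Definition mu_p_units (L : fieldType) (w : L -> int) (lam : L -> algC) : \bar R :=
  ereal_inf [set ordp (lam x - 1)%R | x in [set x | x != 0%R /\ w x = 0%R]].

End PAdic.

(* Main.v *)
(** With d = 1 / (4 theta), A_beta is a regularized Fourier coefficient of the
    function x |-> lam (x + d)^-1 on F_v.

    If lam is not residually trivial, Fourier inversion modulo the maximal ideal
    yields beta such that A_beta is a p-adic unit.  For every such beta, the local
    functional equation applied to a test function supported near a translate of
    the line F_v d has A_beta as a factor on both sides, because self-duality reads
    lam z / |z| = lam (bar z)^-1 modulo the maximal ideal; cancelling A_beta gives
    epsilon.

    If lam is 1 modulo the maximal ideal, self-duality forces K_v / F_v to be
    unramified, q to be -1 modulo p, and lam to be tame.  Then epsilon is essentially a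
    tame Gauss sum and is found up to congruence from the valuations of theta and of
    the conductor of psi, while tau beta = (-1)^(v beta).  Writing d = t omega + x0
    with O_K = O_F + O_F omega, A_beta is explicit in terms of r = v (t beta) - m,
    m the conductor of psi: it vanishes for r < -1; for r >= 0 it is, up to a unit,
    a geometric sum of ratio gamma = lam^* (varpi), which is -1 modulo p, with the
    valuation of 1 + gamma for r even and a larger one for r odd (when that valuation
    is smaller than the one of q + 1); for r = -1 its valuations are at least the
    infimum over the units, which is attained by Fourier inversion.  The parity of r is the sign
    relating epsilon to tau beta lam^* (2 theta). *)

Require Import Defs.
From mathcomp Require Import all_fingroup all_solvable.
From mathcomp Require Import all_boot all_order all_algebra all_field.
From mathcomp Require Import finmap boolp classical_sets functions cardinality fsbigop.
From mathcomp Require Import reals constructive_ereal ereal.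
From mathcomp Require Import zify ring lra.
Set Implicit Arguments.
Unset Strict Implicit.
Unset Printing Implicit Defensive.
Import Order.TTheory GRing.Theory Num.Theory.
Local Open Scope classical_set_scope.
Local Open Scope ring_scope.
Local Notation ball := Defs.ball.

(** Two cases are unavoidable. If [lam] is unramified, the Euler factors of both zeta integrals are
    congruent to 1 + 1/q, which is a p-adic unit unless [lam] is congruent to 1; and in that
    excluded case every A_beta is a nonunit, so there is nothing to cancel and epsilon must be
    computed directly. Passing from a residually trivial [lam] to an unramified Kv / Fv requires a
    unit of Fv that is not a norm from a ramified Kv, also at places above 2; it is found by hand on
    the norm form. Comparing 1 with tau |.| at a uniformizer then gives q = -1 modulo the maximal
    ideal. The valuations are separated by a gap at 1. The integer q + 1 is divisible by p, so its
    order is at least 1, whereas a nontrivial root of unity congruent to 1 has, p being odd, a power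
    whose distance to 1 has order less than 1. Hence the infimum over the units lies below the order
    of q + 1, and error terms divisible by q + 1 never interfere with it. *)

Lemma stable_valueP (u : nat -> algC) l :
  (exists N, forall n, (N <= n)%N -> u n = l) -> stable_value u = l.
Proof.
move=> ul; apply: xget_unique => // l' [N' uN'].
case: ul => N uN; rewrite -(uN (maxn N N')) ?leq_maxl //.
by rewrite uN' ?leq_maxr.
Qed.

(** * Balls of a discrete valuation *)

Section Valuations.
Variables (L : fieldType) (w : L -> int).
Hypothesis hw : finite_place w.

Lemma val0 : w 0 = 0. Proof. by case: hw. Qed.

Lemma valM x y : x != 0 -> y != 0 -> w (x * y) = w x + w y.
Proof. by case: hw => _ _ + _; apply. Qed.

Lemma val_min x y : x != 0 -> y != 0 -> x + y != 0 ->
  Order.min (w x) (w y) <= w (x + y).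
Proof. by case: hw => _ _ _; apply. Qed.

Lemma val1 : w 1 = 0.
Proof.
have : w (1 * 1) = w 1 + w 1 by apply: valM; exact: oner_neq0.
rewrite mulr1; lia.
Qed.

Lemma valN x : w (- x) = w x.
Proof.
have n1 : (-1 : L) != 0 by rewrite oppr_eq0 oner_neq0.
have wN1 : w (-1) = 0.
  have : w ((-1) * (-1)) = w (-1) + w (-1) by apply: valM.
  rewrite mulrNN mulr1 val1; lia.
have [->|x0] := eqVneq x 0; first by rewrite oppr0.
by rewrite -(mulN1r x) valM // wN1 add0r.
Qed.

Lemma valV x : w x^-1 = - w x.
Proof.
have [->|x0] := eqVneq x 0; first by rewrite invr0 val0 oppr0.
have := valM x0 (invr_neq0 x0); rewrite divff // val1; lia.
Qed.

Lemma valX x n : w (x ^+ n) = n%:Z * w x.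
Proof.
have [->|x0] := eqVneq x 0.
  by rewrite expr0n; case: n => [|n]; rewrite /= ?val1 ?val0 ?mulr0 ?mul0r.
elim: n => [|n IHn]; first by rewrite expr0 val1 mul0r.
rewrite exprS valM ?expf_neq0 // IHn; lia.
Qed.

Lemma valXz x (n : int) : w (x ^ n) = n * w x.
Proof.
case: n => n; first exact: valX.
by rewrite NegzE -exprnN valV valX; lia.
Qed.

Lemma ball0 n : ball w n 0. Proof. by left. Qed.

Lemma ballE n x : x != 0 -> ball w n x <-> n <= w x.
Proof. by move=> /eqP x0; split => [[]|] //; right. Qed.

Lemma ball_le n m x : n <= m -> ball w m x -> ball w n x.
Proof. by move=> nm [->|mx]; [left|right; lia]. Qed.

Lemma ballN n x : ball w n x -> ball w n (- x).
Proof. by move=> [->|]; rewrite ?oppr0 /ball /= ?valN; [left|right]. Qed.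

Lemma ballD n x y : ball w n x -> ball w n y -> ball w n (x + y).
Proof.
have [->|x0] := eqVneq x 0; first by rewrite add0r.
have [->|y0] := eqVneq y 0; first by rewrite addr0.
have [->|xy0] := eqVneq (x + y) 0; first by left.
rewrite !ballE //; have := val_min x0 y0 xy0; rewrite ge_min; set z := w (x + y).
by case/orP; lia.
Qed.

Lemma ballB n x y : ball w n x -> ball w n y -> ball w n (x - y).
Proof. by move=> nx ny; apply: ballD => //; apply: ballN. Qed.

Lemma ball_subr n x y : ball w n (x - y) <-> ball w n (y - x).
Proof. by split=> /ballN; rewrite opprB. Qed.

Lemma ballM n m x y : ball w n x -> ball w m y -> ball w (n + m) (x * y).
Proof.
have [->|x0] := eqVneq x 0; first by rewrite mul0r; left.
have [->|y0] := eqVneq y 0; first by rewrite mulr0; left.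
by rewrite !ballE ?mulf_neq0 // valM //; lia.
Qed.

Lemma ball_mull n a x : a != 0 -> ball w n (a * x) <-> ball w (n - w a) x.
Proof.
move=> a0; have [->|x0] := eqVneq x 0; first by rewrite mulr0; split; left.
by rewrite !ballE ?mulf_neq0 // valM //; split; lia.
Qed.

Lemma ball_val n x : x != 0 -> n <= w x -> ball w n x.
Proof. by move=> *; apply/ballE. Qed.

Lemma not_ball n x : ~ ball w n x -> x != 0 /\ w x < n.
Proof.
move=> nb; split; first by apply/eqP => x0; apply: nb; left.
by rewrite ltNge; apply/negP => nx; apply: nb; right.
Qed.

Lemma val_eq n x : ball w n x -> ~ ball w (n + 1) x -> x != 0 /\ w x = n.
Proof. by move=> nx /not_ball[x0 xn]; split=> //; move/ballE: nx => /(_ x0); lia. Qed.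

Lemma ballnn x : ball w (w x) x.
Proof. by right. Qed.

Lemma ball_natr n : ball w 0 n%:R.
Proof.
elim: n => [|n IHn]; first by left.
by rewrite mulrS; apply: ballD => //; right; rewrite val1.
Qed.

Lemma ballDr n x y : ball w n y -> ball w n (x + y) <-> ball w n x.
Proof.
move=> ny; split=> [xy|nx]; last exact: ballD.
by rewrite -(addrK y x); apply: ballB.
Qed.

Lemma valDl x y : x != 0 -> ball w (w x + 1) y -> x + y != 0 /\ w (x + y) = w x.
Proof.
move=> x0 yb; have [y0|y0] := eqVneq y 0; first by rewrite y0 addr0.
have lxy : w x < w y by move: yb; rewrite ballE //; lia.
have xy0 : x + y != 0.
  by apply/eqP => /addr0_eq xy; move: lxy; rewrite -xy valN ltxx.
split=> //; have xb : ball w (w x) (x + y).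
  by apply: ballD; [exact: ballnn | apply: ball_le yb; lia].
apply/eqP; rewrite eq_le; move/(ballE _ xy0): xb => ->; rewrite andbT leNgt.
apply/negP => lxxy; have : ball w (w x + 1) x.
  by apply/(ballDr _ yb); apply/ballE => //; rewrite lezD1.
by rewrite ballE //; lia.
Qed.

Lemma ball1_unit x : ball w 1 (x - 1) -> x != 0 /\ w x = 0.
Proof.
move=> h; have [] := @valDl 1 (x - 1) (oner_neq0 L); rewrite val1 // addrC subrK.
by [].
Qed.

Lemma unif_ex : exists x, x != 0 /\ w x = 1.
Proof. by case: hw. Qed.

Lemma uniformizerP : uniformizer w != 0 /\ w (uniformizer w) = 1.
Proof. exact: xgetPex unif_ex. Qed.

Lemma val_pi n : w (uniformizer w ^ n) = n.
Proof. by rewrite valXz (proj2 uniformizerP) mulr1. Qed.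

Lemma pi_neq0 n : uniformizer w ^ n != 0.
Proof. by rewrite expfz_neq0 // (proj1 uniformizerP). Qed.

End Valuations.

(** * Haar measure on Schwartz functions *)

Section Reps.
Variables (V : zmodType).

(* [r] is a system of representatives of the subgroup [A] modulo [B]. *)
Definition reps (A B : set V) (r : seq V) :=
  (forall x, x \in r -> A x) /\
  forall a, A a -> (\sum_(x <- r) (`[< B (a - x)%R >] : nat) = 1)%N.

(** Both sides equal the sum over the pairs of representatives that lie in a common coset of [B]. *)
Lemma reps_sum (U : zmodType) (A B : set V) r r' (f : V -> U) :
  (forall x, B x -> B (- x)) ->
  reps A B r -> reps A B r' ->
  (forall x y, A x -> B y -> f (x + y) = f x) ->
  \sum_(x <- r) f x = \sum_(x <- r') f x.
Proof.
move=> BN [rA r1] [r'A r'1] fB.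
transitivity (\sum_(x <- r) \sum_(y <- r') f y *+ (`[< B (x - y) >] : nat)).
  apply: eq_big_seq => x xr; rewrite -[LHS]mulr1n -(r'1 x (rA _ xr)).
  rewrite -sumrMnr; apply: eq_big_seq => y yr'.
  case: asboolP => //= Bxy; rewrite !mulr1n -{1}(subrK y x) addrC fB //.
  exact: r'A.
rewrite exchange_big /=; apply: eq_big_seq => y yr'.
rewrite sumrMnr -[RHS]mulr1n -(r1 y (r'A _ yr')); congr (_ *+ _).
apply: eq_bigr => x _; congr nat_of_bool; apply: asbool_equiv_eq.
by split=> /BN; rewrite opprB.
Qed.

Lemma reps_shift (A B : set V) r a :
  (forall x y, A x -> A y -> A (x + y)) -> (forall x, A x -> A (- x)) ->
  A a -> reps A B r -> reps A B [seq x + a | x <- r].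
Proof.
move=> AD AN Aa [rA r1]; split=> [_ /mapP[x /rA Ax ->]|b Ab]; first exact: AD.
rewrite big_map -(r1 (b - a)); last by apply: AD => //; apply: AN.
by apply: eq_bigr => x _; rewrite opprD addrA addrAC.
Qed.

Lemma reps_refine (A B C : set V) r s :
  (forall x y, A x -> A y -> A (x + y)) -> B `<=` A ->
  (forall x y, B x -> B y -> B (x + y)) -> (forall x, B x -> B (- x)) ->
  C `<=` B -> reps A B r -> reps B C s ->
  reps A C [seq x + y | x <- r, y <- s].
Proof.
move=> AD BA BD BN CB [rA r1] [sB s1]; split=> [_ /allpairsP[[x y] /= [xr ys ->]]|a Aa].
  by apply: AD; [exact: rA | exact/BA/sB].
rewrite big_allpairs_dep -[RHS](r1 a Aa); apply: eq_big_seq => x xr.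
case: asboolP => [Bax|nB] /=.
  rewrite -[RHS](s1 _ Bax); apply: eq_bigr => y _.
  by rewrite opprD addrA.
apply: big1_seq => y /= ys; case: asboolP => //= Cxy; case: nB.
have -> : a - x = (a - (x + y)) + y by rewrite opprD !addrA subrK.
by apply: BD; [exact: CB | exact: sB].
Qed.

Lemma reps_filter (A A' B : set V) r :
  A' `<=` A -> (forall x y, A' x -> A' y -> A' (x + y)) ->
  (forall x, A' x -> A' (- x)) -> B `<=` A' ->
  reps A B r -> reps A' B [seq x <- r | `[< A' x >]].
Proof.
move=> A'A A'D A'N BA' [rA r1]; split=> [x|a A'a].
  by rewrite mem_filter => /andP[/asboolP].
rewrite big_filter -[RHS](r1 a (A'A _ A'a)) big_mkcond.
apply: eq_bigr => x _; case: asboolP => //= nx; case: asboolP => //= Bax.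
case: nx; rewrite -[x](subKr a); apply: A'D => //; apply: A'N; exact: BA'.
Qed.

End Reps.

Section Cosets.
Variables (L : fieldType) (w : L -> int).
Hypothesis hw : finite_place w.

Let cosetE m x y : [set z | ball w m (z - x)] = [set z | ball w m (z - y)] <->
  ball w m (x - y).
Proof.
split=> [e|xy]; first by move/seteqP: e => [+ _]; apply; rewrite /= subrr; left.
apply/seteqP; split=> z /= h.
  by have := ballD hw h xy; rewrite addrA subrK.
by have := ballB hw h xy; rewrite opprB addrA subrK.
Qed.

(** The points chosen by [xget] in the definition of [haar] form one system of representatives among
    others; by [reps_sum] the choice becomes irrelevant. *)
Lemma reps_cosets n m : n <= m -> finite_set (cosets w n m) ->
  reps (ball w n) (ball w m) [seq xget 0 C | C <- fset_set (cosets w n m)].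
Proof.
move=> nm fin.
have repC C : C \in fset_set (cosets w n m) -> ball w n (xget 0 C) /\
    C = [set z | ball w m (z - xget 0 C)].
  rewrite in_fset_set // inE => -[x nx <-]; set C' := [set z | _].
  have : C' (xget 0 C') by apply: xgetPex; exists x; rewrite /C' /= subrr; left.
  rewrite /C' /= => h; split; last by apply/cosetE/(ball_subr hw).
  by rewrite -(subrK x (xget _ _)); apply: ballD => //; exact: ball_le h.
split=> [_ /mapP[C /repC[nC _] ->] //|a na]; rewrite big_map.
pose Ca := [set z | ball w m (z - a)].
have Cain : Ca \in fset_set (cosets w n m).
  by rewrite in_fset_set // inE; exists a.
transitivity (\sum_(C <- fset_set (cosets w n m)) (C == Ca))%N.
  apply: eq_big_seq => C /repC[nC CE]; congr nat_of_bool.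
  by apply/asboolP/eqP => [h|e]; [rewrite CE; apply/cosetE/(ball_subr hw) |
    apply/(ball_subr hw)/cosetE; rewrite -CE e].
have := count_uniq_mem Ca (fset_uniq (fset_set (cosets w n m))).
rewrite (Cain : (Ca \in enum_fset _)) => e.
transitivity (count_mem Ca (fset_set (cosets w n m))) => //.
rewrite -sum1_count [RHS]big_mkcond.
by apply: eq_bigr => C _ /=; case: eqP.
Qed.

Lemma reps_mem (A B : set L) r a : reps A B r -> A a ->
  exists2 x, x \in r & B (a - x).
Proof.
move=> [_ r1] /r1 s1; apply: contrapT => no; move: s1; rewrite big1_seq //.
by move=> x /= xr; case: asboolP => // Bax; case: no; exists x.
Qed.

Lemma fsbig_cosets n m r (f : L -> algC) : n <= m ->
  reps (ball w n) (ball w m) r ->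
  (forall x y, ball w n x -> ball w m y -> f (x + y) = f x) ->
  \sum_(C \in cosets w n m) f (xget 0 C) = \sum_(x <- r) f x.
Proof.
move=> nm hr fB; have fin : finite_set (cosets w n m).
  apply: (@sub_finite_set _ _ [set` [seq [set z | ball w m (z - x)] | x <- r]]);
    last exact: finite_seq.
  move=> _ [a na <-] /=; have [x xr ax] := reps_mem hr na.
  by apply/mapP; exists x => //; apply/cosetE.
rewrite fsbig_finite // -(big_map (fun C => xget 0 C) xpredT f).
apply: reps_sum (reps_cosets nm fin) hr fB => x; exact: ballN.
Qed.

Lemma reps_scale n m r a : a != 0 -> reps (ball w n) (ball w m) r ->
  reps (ball w (n + w a)) (ball w (m + w a)) [seq a * x | x <- r].
Proof.
move=> a0 [rA r1]; split=> [_ /mapP[x /rA nx ->]|b nb].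
  by apply/ball_mull => //; rewrite addrK.
rewrite big_map -(r1 (a^-1 * b)); last first.
  by apply/ball_mull; rewrite ?invr_neq0 // valV // opprK.
apply: eq_bigr => x _; congr nat_of_bool; apply: asbool_equiv_eq.
rewrite -[b in b - _](mulVKf a0) -mulrBr ball_mull //.
by rewrite addrK.
Qed.

End Cosets.

Section Haar.
Variables (L : fieldType) (w : L -> int).
Hypothesis hL : local_field w.
Let hw : finite_place w. Proof. by case: hL. Qed.
Local Notation q := ((residue_card w)%:R : algC).

(** One digit is added at a time: representatives of the residue field, scaled by a power of the
    uniformizer, refine the previous system. *)
Lemma reps_ball n k : exists2 r, reps (ball w n) (ball w (n + k%:Z)) r &
  size r = (residue_card w ^ k)%N.
Proof.
elim: k => [|k [r hr sr]].
  exists [:: 0] => //; split=> [x|a]; first by rewrite inE => /eqP->; left.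
  by rewrite addr0 big_seq1 subr0 => /asboolP ->.
have /(reps_cosets hw ler01) : finite_set (cosets w 0 1) by case: hL.
move/(reps_scale hw (pi_neq0 hw (n + k))); rewrite val_pi // !add0r.
move/(reps_refine _ _ _ _ _ hr) => hr'.
eexists; [have -> : n + k.+1 = 1 + (n + k) by lia|].
  apply: hr'; [exact: ballD|move=> x; apply: ball_le; lia|exact: ballD|exact: ballN|
    move=> x; apply: ball_le; lia].
by rewrite size_allpairs !size_map sr expnSr.
Qed.

Lemma reps_ex n m : n <= m -> exists r, reps (ball w n) (ball w m) r.
Proof.
move=> nm; have [r hr _] := reps_ball n `|m - n|.
by exists r; have <- : n + `|m - n|%N = m by lia.
Qed.

Lemma residue_card_gt0 : (0 < residue_card w)%N.
Proof.
have [r hr sr] := reps_ball 0 1; rewrite -(expn1 (residue_card w)) -sr.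
by have [x] := reps_mem hr (@ball0 _ w 0); case: (r).
Qed.

Lemma q_gt0 : 0 < q. Proof. by rewrite ltr0n residue_card_gt0. Qed.
Lemma q_neq0 : q != 0. Proof. by rewrite gt_eqF // q_gt0. Qed.
Lemma qz_neq0 n : q ^ n != 0. Proof. by rewrite expfz_neq0 // q_neq0. Qed.

(** Support and invariance radius are kept apart, unlike in [schwartz], because the Fourier
    transform exchanges them. *)
Definition sch n m (f : L -> algC) :=
  (forall x, ~ ball w n x -> f x = 0) /\
  (forall x y, ball w m y -> f (x + y) = f x).

Lemma sch_le n m n' m' f : n' <= n -> m <= m' -> sch n m f -> sch n' m' f.
Proof.
move=> nn mm [f0 fB]; split=> [x nx|x y my]; first by apply: f0 => /(ball_le nn).
by apply: fB; apply: ball_le my.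
Qed.

Lemma sch_schwartz n m f : sch n m f -> schwartz w f.
Proof.
move=> hf; exists (`|n| + `|m|).
by have [] : sch (- (`|n| + `|m|)) (`|n| + `|m|) f by apply: sch_le hf; lia.
Qed.

Lemma schwartz_sch f : schwartz w f -> exists n m : int, n <= m /\ sch n m f.
Proof.
move=> [N hf]; exists (- `|N|), `|N|; split; first by lia.
by apply: (@sch_le (- N) N) => //; lia.
Qed.

(** Refining the cosets of [ball w m] to those of [ball w N] repeats each value q^(N - m) times,
    which the factor q^(-N) in [haar] absorbs; so the sequence is stable as soon as -N <= n and m <=
    N. *)
Lemma haarE c n m r f : n <= m -> reps (ball w n) (ball w m) r -> sch n m f ->
  haar w c f = c * q ^ (- m) * \sum_(x <- r) f x.
Proof.
move=> nm hr hf; apply: stable_valueP; exists (`|n| + `|m|)%N => N hN.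
have [r1 hr1] : exists r, reps (ball w (- N%:Z)) (ball w N) r by apply: reps_ex; lia.
have [r2 hr2 sr2] := reps_ball m `|N%:Z - m|.
have hf' : sch (- N%:Z) N f by apply: sch_le hf; lia.
rewrite (fsbig_cosets hw _ hr1); [|by lia|by move=> x y _; case: hf' => _; apply].
have {}hr2 : reps (ball w m) (ball w N) r2.
  by have <- : m + `|N%:Z - m|%N = N by lia.
have rr : reps (ball w n) (ball w N) [seq x + y | x <- r, y <- r2].
  apply: reps_refine hr hr2; [exact: ballD|move=> x; exact: ball_le|exact: ballD|
    exact: ballN|move=> x; apply: ball_le; lia].
have fr : reps (ball w n) (ball w N) [seq x <- r1 | `[< ball w n x >]].
  apply: reps_filter hr1; [move=> x; apply: ball_le; lia|exact: ballD|exact: ballN|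
    move=> x; apply: ball_le; lia].
have -> : \sum_(x <- r1) f x = \sum_(x <- r1 | `[< ball w n x >]) f x.
  rewrite [RHS]big_mkcond; apply: eq_bigr => x _; case: asboolP => // nx.
  by case: hf => + _; apply.
rewrite -big_filter (reps_sum _ fr rr); [|by move=> x; exact: ballN|
  by move=> x y _; case: hf' => _; apply].
rewrite big_allpairs_dep -!mulrA; congr (c * _).
rewrite (eq_bigr (fun x => f x *+ size r2)); last first.
  move=> x _; rewrite (eq_big_seq (fun=> f x)) ?big_const_seq ?count_predT ?iter_addr_0 //.
  by move=> y yr; case: hf => _; apply; case: hr2 => + _; apply.
rewrite sumrMnl -[X in _ * X = _]mulr_natl mulrA; congr (_ * _).
have -> : - m = - N%:Z + `|N%:Z - m|%N by lia.
rewrite expfzDr ?q_neq0 // sr2 natrX -exprnP; congr (_ * _).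
by rewrite -invr_expz.
Qed.

End Haar.

Section HaarTheory.
Variables (L : fieldType) (w : L -> int).
Hypothesis hL : local_field w.
Let hw : finite_place w. Proof. by case: hL. Qed.
Local Notation q := ((residue_card w)%:R : algC).

Lemma schwartz2 f g : schwartz w f -> schwartz w g ->
  exists n m : int, [/\ n <= m, sch w n m f & sch w n m g].
Proof.
move=> [N hf] [M hg]; exists (- (`|N| + `|M|)), (`|N| + `|M|); split; first by lia.
  by apply: (@sch_le _ _ (- N) N) => //; lia.
by apply: (@sch_le _ _ (- M) M) => //; lia.
Qed.

Lemma schwartz0 : schwartz w (fun=> 0).
Proof. by exists 0. Qed.

Lemma schwartzD f g : schwartz w f -> schwartz w g -> schwartz w (fun x => f x + g x).
Proof.
move=> sf sg; have [n [m [_ [f0 fB] [g0 gB]]]] := schwartz2 sf sg.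
apply: (@sch_schwartz _ _ n m); split=> [x nx|x y my]; first by rewrite f0 ?g0 ?addr0.
by rewrite fB ?gB.
Qed.

Lemma schwartzZ a f : schwartz w f -> schwartz w (fun x => a * f x).
Proof.
move=> [N [f0 fB]]; exists N; split=> [x nx|x y my]; first by rewrite f0 ?mulr0.
by rewrite fB.
Qed.

Lemma schwartz_shift a f : schwartz w f -> schwartz w (fun x => f (x + a)).
Proof.
move=> /schwartz_sch[n [m [_ [f0 fB]]]].
apply: (@sch_schwartz _ _ (Order.min n (w a)) m); split=> [x nx|x y my].
  apply: f0 => nxa; apply: nx; rewrite -(addrK a x); apply: ballB => //.
    by apply: ball_le nxa; rewrite ge_min lexx.
  by apply: ball_le (@ballnn _ w a); rewrite ge_min lexx orbT.
by rewrite addrAC (fB _ _ my).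
Qed.

Lemma schwartz_scale a f : a != 0 -> schwartz w f -> schwartz w (fun x => f (a * x)).
Proof.
move=> a0 /schwartz_sch[n [m [_ [f0 fB]]]].
apply: (@sch_schwartz _ _ (n - w a) (m - w a)); split=> [x nx|x y my].
  by apply: f0 => /(ball_mull hw _ _ a0).
by rewrite mulrDr fB //; apply/ball_mull.
Qed.

Lemma sch_mul n m f g : n <= m -> sch w n m f ->
  (forall x y, ball w n x -> ball w m y -> g (x + y) = g x) ->
  sch w n m (fun x => f x * g x).
Proof.
move=> nm [f0 fB] gB; split=> [x nx|x y my]; first by rewrite f0 ?mul0r.
rewrite fB //; case: (pselect (ball w n x)) => nx; first by rewrite gB.
by rewrite f0 // !mul0r.
Qed.

Lemma haar_ex c f : schwartz w f ->
  exists m r, haar w c f = c * q ^ m * \sum_(x <- r) f x.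
Proof.
move=> /schwartz_sch[n [m [nm hf]]]; have [r hr] := reps_ex hL nm.
by exists (- m), r; rewrite (haarE hL c nm hr hf).
Qed.

Lemma haarD c f g : schwartz w f -> schwartz w g ->
  haar w c (fun x => f x + g x) = haar w c f + haar w c g.
Proof.
move=> sf sg; have [n [m [nm hf hg]]] := schwartz2 sf sg.
have [r hr] := reps_ex hL nm; rewrite !(haarE hL c nm hr) //.
  by rewrite -mulrDr -big_split.
case: hf hg => f0 fB [g0 gB]; split=> [x nx|x y my]; first by rewrite f0 ?g0 ?addr0.
by rewrite (fB _ _ my) (gB _ _ my).
Qed.

Lemma haarZ c a f : schwartz w f -> haar w c (fun x => a * f x) = a * haar w c f.
Proof.
move=> /schwartz_sch[n [m [nm hf]]]; have [r hr] := reps_ex hL nm.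
rewrite !(haarE hL c nm hr) //; first by rewrite -mulr_sumr mulrCA.
case: hf => f0 fB; split=> [x nx|x y my]; first by rewrite f0 ?mulr0.
by rewrite (fB _ _ my).
Qed.

Lemma haar0 c : haar w c (fun=> 0) = 0.
Proof.
have -> : (fun=> 0) = (fun x : L => 0 * 0) :> (L -> algC).
  by apply/funext => x; rewrite mul0r.
by rewrite (haarZ c 0 schwartz0) mul0r.
Qed.

Lemma haar_c c f : schwartz w f -> haar w c f = c * haar w 1 f.
Proof.
move=> /schwartz_sch[n [m [nm hf]]]; have [r hr] := reps_ex hL nm.
by rewrite !(haarE hL _ nm hr) // mul1r mulrA.
Qed.

Lemma haarB c f g : schwartz w f -> schwartz w g ->
  haar w c (fun x => f x - g x) = haar w c f - haar w c g.
Proof.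
move=> sf sg; rewrite -[- haar w c g]mulN1r -haarZ // -haarD //.
  by congr haar; apply/funext => x; rewrite mulN1r.
exact: schwartzZ.
Qed.

Lemma schwartz_sum (I : Type) (s : seq I) (P : pred I) (F : I -> L -> algC) :
  (forall i, schwartz w (F i)) -> schwartz w (fun x => \sum_(i <- s | P i) F i x).
Proof.
move=> hF; elim: s => [|i s IHs].
  have -> : (fun x => \sum_(i <- [::] | P i) F i x) = (fun=> 0).
    by apply/funext => x; rewrite big_nil.
  exact: schwartz0.
have -> : (fun x => \sum_(j <- i :: s | P j) F j x) =
    (fun x => (if P i then 1 else 0) * F i x + \sum_(j <- s | P j) F j x).
  by apply/funext => x; rewrite big_cons; case: (P i); rewrite ?mul1r ?mul0r ?add0r.
by apply: schwartzD => //; apply: schwartzZ.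
Qed.

Lemma haar_sum c (I : Type) (s : seq I) (P : pred I) (F : I -> L -> algC) :
  (forall i, schwartz w (F i)) ->
  haar w c (fun x => \sum_(i <- s | P i) F i x) = \sum_(i <- s | P i) haar w c (F i).
Proof.
move=> hF; elim: s => [|i s IHs].
  rewrite big_nil -[RHS](haar0 c); congr haar.
  by apply/funext => x; rewrite big_nil.
have -> : (fun x => \sum_(j <- i :: s | P j) F j x) =
    (fun x => (if P i then 1 else 0) * F i x + \sum_(j <- s | P j) F j x).
  by apply/funext => x; rewrite big_cons; case: (P i); rewrite ?mul1r ?mul0r ?add0r.
rewrite haarD ?haarZ ?IHs //; [|by apply: schwartzZ|by apply: schwartz_sum].
by rewrite big_cons; case: (P i); rewrite ?mul1r ?mul0r ?add0r.
Qed.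

Lemma haar_shift c a f : schwartz w f -> haar w c (fun x => f (x + a)) = haar w c f.
Proof.
move=> sf; have sfa := schwartz_shift a sf.
have [n [m [nm hf hfa]]] := schwartz2 sf sfa.
pose n' := Order.min n (w a).
have nn' : n' <= n by rewrite ge_min lexx.
have hf' : sch w n' m f by apply: sch_le hf.
have hfa' : sch w n' m (fun x => f (x + a)) by apply: sch_le hfa.
have n'm : n' <= m by apply: le_trans nm.
have [r hr] := reps_ex hL n'm; rewrite !(haarE hL c n'm hr) //.
congr (_ * _); rewrite -(big_map (fun x => x + a) xpredT f).
apply: (@reps_sum _ _ (ball w n') (ball w m)) => //.
- by move=> x; apply: ballN.
- apply: reps_shift hr; [by move=> x y; apply: ballD|by move=> x; apply: ballN|].
  by apply: ball_le (@ballnn _ w a); rewrite ge_min lexx orbT.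
by move=> x y _; case: hf => _; apply.
Qed.

Lemma haar_scale c a f : a != 0 -> schwartz w f ->
  haar w c (fun x => f (a * x)) = q ^ w a * haar w c f.
Proof.
move=> a0 sf; have /schwartz_sch[n [m [nm hf]]] := schwartz_scale a0 sf.
have [r hr] := reps_ex hL nm; rewrite (haarE hL c nm hr) //.
have hf' : sch w (n + w a) (m + w a) f.
  case: hf => f0 fB; split=> [x nx|x y my].
    rewrite -(mulVKf a0 x) f0 // ball_mull ?invr_neq0 // valV //.
    by rewrite opprK.
  rewrite -(mulVKf a0 x) -(mulVKf a0 y) -mulrDr fB // ball_mull ?invr_neq0 // valV //.
  by rewrite opprK.
have nm' : n + w a <= m + w a by rewrite lerD2r.
rewrite (haarE hL c nm' (reps_scale hw a0 hr) hf') big_map mulrA mulrCA.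
congr (_ * _); rewrite -expfzDr ?q_neq0 //; congr (_ * q ^ _); lia.
Qed.

(** Orthogonality of characters in the form used throughout: invariance of the measure gives I = z
    I. [haar_mtwist0] is the version for multiplication by a unit. *)
Lemma haar_twist0 c f y z : schwartz w f -> z != 1 ->
  (forall x, f (x + y) = z * f x) -> haar w c f = 0.
Proof.
move=> sf z1 fy; have := haar_shift c y sf.
have -> : (fun x => f (x + y)) = (fun x => z * f x) by apply/funext.
rewrite haarZ // => /eqP; rewrite -subr_eq0 -[X in _ - X]mul1r -mulrBl mulf_eq0.
by rewrite subr_eq0 (negPf z1) => /eqP.
Qed.

Lemma haar_mtwist0 c f u z : schwartz w f -> u != 0 -> w u = 0 -> z != 1 ->
  (forall x, f (u * x) = z * f x) -> haar w c f = 0.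
Proof.
move=> sf u0 wu z1 fy; have := haar_scale c u0 sf.
have -> : (fun x => f (u * x)) = (fun x => z * f x) by apply/funext.
rewrite haarZ // wu mul1r => /eqP.
by rewrite -subr_eq0 -[X in _ - X]mul1r -mulrBl mulf_eq0 subr_eq0 (negPf z1) => /eqP.
Qed.

Definition ind (A : set L) (x : L) : algC := (`[< A x >])%:R.

Lemma ind1 (A : set L) x : A x -> ind A x = 1.
Proof. by rewrite /ind => /asboolP ->. Qed.

Lemma ind0 (A : set L) x : ~ A x -> ind A x = 0.
Proof. by rewrite /ind => /asboolPn/negPf ->. Qed.

Lemma ind_equiv (A B : set L) x y : (A x <-> B y) -> ind A x = ind B y.
Proof. by move=> h; rewrite /ind (asbool_equiv_eq h). Qed.

Lemma sch_ball n m : n <= m -> sch w n m (ind (ball w n)).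
Proof.
move=> nm; split=> [x|x y my]; first exact: ind0.
by apply: ind_equiv; apply: (ballDr hw); apply: ball_le my.
Qed.

Lemma schwartz_ball n : schwartz w (ind (ball w n)).
Proof. exact: sch_schwartz (sch_ball (lexx n)). Qed.

Lemma haar_ball c n : haar w c (ind (ball w n)) = c * q ^ (- n).
Proof.
have hr : reps (ball w n) (ball w n) [:: 0].
  split=> [x|a]; first by rewrite inE => /eqP->; left.
  by move=> /asboolP h; rewrite big_seq1 subr0 h.
rewrite (haarE hL c (lexx n) hr (sch_ball (lexx n))) big_seq1 ind1 ?mulr1 //.
by left.
Qed.

End HaarTheory.

(** * Additive characters and Fourier transforms *)

Section AdditiveCharacters.
Variables (L : fieldType) (w : L -> int).
Hypothesis hL : local_field w.
Let hw : finite_place w. Proof. by case: hL. Qed.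
Local Notation q := ((residue_card w)%:R : algC).
Variable psi : L -> algC.

Definition conductor (m : int) :=
  (forall x, ball w m x -> psi x = 1) /\ exists2 x, ball w (m - 1) x & psi x != 1.

Hypothesis hpsi : nontrivial_additive_character w psi.

Lemma psiD x y : psi (x + y) = psi x * psi y. Proof. by case: hpsi. Qed.

Lemma psi0 : psi 0 = 1.
Proof. by case: hpsi => _ [n h] _; apply: h; left. Qed.

Lemma conductor_ex : exists m, conductor m.
Proof.
case: hpsi => _ [n hn] [x1 px1].
(* As [psi x1 != 1], no radius up to [w x1] is in the kernel, so a least radius can be sought from
   there on. *)
have ex : exists k : nat, `[< forall x, ball w (w x1 + k%:Z) x -> psi x = 1 >].
  exists `|n - w x1|%N; apply/asboolP => x nx; apply: hn; apply: ball_le nx; lia.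
have [k /asboolP hk kmin] := ex_minnP ex.
exists (w x1 + k%:Z); split=> //; apply: contrapT => no.
have : `[< forall x, ball w (w x1 + k.-1%:Z) x -> psi x = 1 >].
  apply/asboolP => x nx; apply/eqP/negPn/negP => px; apply: no; exists x => //.
  by apply: ball_le nx; lia.
move/kmin; case: k hk {kmin no} => [hk _|k _]; last by rewrite ltnn.
by case/eqP: px1; apply: hk; rewrite addr0; right.
Qed.

Section Conductor.
Variable m : int.
Hypothesis hm : conductor m.

Lemma psi_ball x : ball w m x -> psi x = 1. Proof. by case: hm => h _; exact: h. Qed.

Lemma psi_nontriv n y : ~ ball w (m - n) y ->
  exists2 x, ball w n x & psi (x * y) != 1.
Proof.
move=> ny; case: hm => _ [x0 bx0 px0].
have [y0 _] := not_ball ny.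
exists (x0 / y); last by rewrite divfK.
have lt : w y < m - n by rewrite ltNge; apply/negP => /(ballE w _ y0).
by rewrite mulrC ball_mull ?invr_neq0 // valV //; apply: ball_le bx0; lia.
Qed.

Lemma schwartz_psi f y : schwartz w f -> schwartz w (fun x => f x * psi (x * y)).
Proof.
move=> /schwartz_sch[n [k [nk hf]]].
have [y0|y0] := eqVneq y 0.
  have -> : (fun x => f x * psi (x * y)) = f; last exact: sch_schwartz hf.
  by apply/funext => x; rewrite y0 mulr0 psi0 mulr1.
pose k' := `|k| + `|m - w y| + `|n|.
apply: (@sch_schwartz _ _ n k'); apply: sch_mul => //; first by rewrite /k'; lia.
  by apply: sch_le hf => //; rewrite /k'; lia.
move=> x z _ kz; rewrite mulrDl psiD (psi_ball (x := z * y)) ?mulr1 //.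
by rewrite mulrC ball_mull //; apply: ball_le kz; rewrite /k'; lia.
Qed.

Lemma schwartz_psiN f y : schwartz w f -> schwartz w (fun x => f x * psi (- (x * y))).
Proof.
move=> sf; have -> : (fun x => f x * psi (- (x * y))) = (fun x => f x * psi (x * - y)).
  by apply/funext => x; rewrite mulrN.
exact: schwartz_psi.
Qed.

Lemma fourier_ball c n y :
  fourier w c psi (ind (ball w n)) y = c * q ^ (- n) * ind (ball w (m - n)) y.
Proof.
rewrite /fourier; case: (pselect (ball w (m - n) y)) => by_; last first.
  rewrite (ind0 by_) mulr0; have [x nx px] := psi_nontriv by_.
  apply: (@haar_twist0 _ _ hL _ _ (- x) (psi (x * y))) => //.
    by apply: schwartz_psiN; exact: schwartz_ball.
  move=> z; rewrite mulrDl mulNr opprB psiD [RHS]mulrCA; congr (_ * _).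
  by apply: ind_equiv; apply: (ballDr hw); apply: ballN.
rewrite (ind1 by_) mulr1 -(haar_ball hL); congr haar; apply/funext => x.
case: (pselect (ball w n x)) => nx; last by rewrite (ind0 nx) mul0r.
rewrite psi_ball ?mulr1 //; apply: ballN => //.
by have := ballM hw nx by_; rewrite addrC subrK.
Qed.

(** Invariance under [ball w k] kills every frequency on which [psi] is nontrivial there, and [psi]
    cannot see a change of frequency in [ball w (m - n)] on the support. *)
Lemma sch_fourier c (n k : int) f : n <= k -> sch w n k f ->
  sch w (m - k) (m - n) (fourier w c psi f).
Proof.
move=> nk hf; have sf : schwartz w f by apply: sch_schwartz hf.
case: hf => f0 fB; split=> [y ny|y z nz].
  have [x nx px] := psi_nontriv ny.
  apply: (@haar_twist0 _ _ hL _ _ (- x) (psi (x * y))) => //.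
    exact: schwartz_psiN.
  move=> t; rewrite fB; last exact: ballN.
  by rewrite mulrDl mulNr opprB psiD mulrCA.
rewrite /fourier; congr haar; apply/funext => x.
case: (pselect (ball w n x)) => nx; last by rewrite f0 // !mul0r.
rewrite mulrDr opprD psiD (psi_ball (x := - (x * z))) ?mulr1 //; apply: ballN => //.
by have := ballM hw nx nz; rewrite addrC subrK.
Qed.

Lemma schwartz_fourier c f : schwartz w f -> schwartz w (fourier w c psi f).
Proof.
by move=> /schwartz_sch[n [k [nk hf]]]; apply: sch_schwartz (sch_fourier c nk hf).
Qed.

(** Fourier inversion at 0 for the indicator of the ring of integers. *)
Lemma self_dual_sqr c : self_dual w psi c -> c ^+ 2 = q ^ m.
Proof.
move=> [_ /(_ _ (schwartz_ball hL 0) 0)]; rewrite oppr0 ind1; last by left.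
have -> : fourier w c psi (ind (ball w 0)) =
    (fun y => c * q ^ (- 0) * ind (ball w (m - 0)) y).
  by apply/funext => y; rewrite fourier_ball.
rewrite oppr0 expr0z mulr1 subr0 /fourier.
have -> : (fun x => c * ind (ball w m) x * psi (- (x * 0))) =
    (fun x => c * ind (ball w m) x).
  by apply/funext => x; rewrite mulr0 oppr0 psi0 mulr1.
rewrite haarZ // ?haar_ball //; last exact: schwartz_ball.
rewrite mulrA -expr2 => e.
transitivity (c ^+ 2 * q ^ (- m) * q ^ m); last by rewrite e mul1r.
by rewrite -mulrA -expfzDr ?q_neq0 // addNr expr0z mulr1.
Qed.

End Conductor.
End AdditiveCharacters.

(** * Zeta integrals *)

Section Zeta.
Variables (L : fieldType) (w : L -> int).
Hypothesis hL : local_field w.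
Let hw : finite_place w. Proof. by case: hL. Qed.
Local Notation q := ((residue_card w)%:R : algC).

(** Local constancy with relative precision [k]: quasicharacters and absolute values have it
    uniformly on all nonzero elements. *)
Definition mulinv (k : int) (g : L -> algC) :=
  forall x u, x != 0 -> ball w k (u - 1) -> g (x * u) = g x.

Lemma quasi_mulinv chi : quasicharacter w chi -> exists2 k, 0 < k & mulinv k chi.
Proof.
move=> [chi0 chiM [k k0 hk]]; exists k => // x u x0 ku.
have [u0 _] : u != 0 /\ w u = 0 by apply: ball1_unit => //; apply: ball_le ku; lia.
by rewrite chiM // (hk _ ku) mulr1.
Qed.

Lemma mulinv_le k k' g : k <= k' -> mulinv k g -> mulinv k' g.
Proof. by move=> kk hg x u x0 ku; apply: hg => //; apply: ball_le ku. Qed.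

Lemma mulinvM k g g' : mulinv k g -> mulinv k g' -> mulinv k (fun x => g x * g' x).
Proof. by move=> hg hg' x u x0 ku; rewrite hg ?hg'. Qed.

Lemma mulinv_comp k g (F : algC -> algC) : mulinv k g -> mulinv k (fun x => F (g x)).
Proof. by move=> hg x u x0 ku; rewrite hg. Qed.

Lemma mulinv_val k (F : int -> algC) : 0 < k -> mulinv k (fun x => F (w x)).
Proof.
move=> k0 x u x0 ku.
have [u0 wu] : u != 0 /\ w u = 0 by apply: ball1_unit => //; apply: ball_le ku; lia.
by rewrite valM // wu addr0.
Qed.

Lemma mulinvE k g x y : mulinv k g -> x != 0 -> ball w (w x + k) y -> g (x + y) = g x.
Proof.
move=> hg x0 ky; have -> : x + y = x * (1 + y / x).
  by rewrite mulrDr mulr1 mulrCA divff // mulr1.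
apply: hg => //; rewrite addrAC subrr add0r mulrC ball_mull ?invr_neq0 //.
by rewrite valV // opprK addrC.
Qed.

(** Where [f] does not vanish, [w x < b], so the relative precision [k] of [g] becomes the absolute
    precision b + k. *)
Lemma schwartz_annulus (b k : int) f g : 0 < k -> schwartz w f ->
  (forall x, ball w b x -> f x = 0) -> mulinv k g ->
  schwartz w (fun x => f x * g x).
Proof.
move=> k0 /schwartz_sch[n [m [nm hf]]] fb hg.
pose m' := `|n| + `|m| + `|b| + k.
apply: (@sch_schwartz _ _ n m').
have [f0 fB] : sch w n m' f by apply: sch_le hf => //; rewrite /m'; lia.
split=> [x nx|x y my]; first by rewrite f0 ?mul0r.
rewrite fB //; case: (pselect (ball w b x)) => bx; first by rewrite fb // !mul0r.
have [x0 _] := not_ball bx.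
rewrite (mulinvE hg) //; apply: ball_le my.
have : w x < b by rewrite ltNge; apply/negP => /(ballE w _ x0).
rewrite /m'; lia.
Qed.

Lemma big_int_support (G : int -> algC) (a : int) (k : nat) :
  (forall n : int, ~~ (a <= n < a + k%:Z) -> G n = 0) ->
  forall N, (`|a| + k <= N)%N ->
  \sum_(i < N.*2) G (i%:Z - N%:Z) = \sum_(i < k) G (a + i%:Z).
Proof.
move=> G0 N hN; pose o := absz (a + N%:Z).
have oE : o%:Z = a + N by rewrite /o; lia.
rewrite -(big_mkord xpredT (fun i : nat => G (i%:Z - N%:Z))).
rewrite (@big_cat_nat _ _ _ o) //=; last by lia.
rewrite (@big_cat_nat _ _ _ (o + k) o) //=; [|by lia|by lia].
rewrite big_nat big1 ?add0r; last by move=> i /andP[_ io]; apply: G0; lia.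
rewrite [X in _ + X]big_nat [X in _ + X]big1 ?addr0; last first.
  by move=> i /andP[io iN]; apply: G0; lia.
rewrite -{1}[o]add0n [(o + k)%N]addnC big_addn addnK big_mkord.
apply: eq_bigr => i _; congr G; lia.
Qed.

Variables (c X : algC).
Hypothesis X0 : X != 0.

Definition zeta_term (chi f : L -> algC) n :=
  (shell_integral w c chi f n - L_coef w chi * shell_integral w c chi f (n - 1)) * X ^ n.

Lemma zeta_finite chi f (a : int) (k : nat) :
  (forall n : int, ~~ (a <= n < a + k%:Z) -> zeta_term chi f n = 0) ->
  zeta_over_L w c chi f X = \sum_(i < k) zeta_term chi f (a + i%:Z).
Proof.
by move=> h; apply: stable_valueP; exists (`|a| + k)%N; exact: big_int_support.
Qed.

(* Away from 0 nothing needs regularizing: the integral of [f chi |x|^(s-1)]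
   converges, and [|x|^(s-1) = (q X)^(w x)]. *)
Lemma zeta_annulus chi f (b k : int) : 0 < k -> mulinv k chi -> schwartz w f ->
  (forall x, ball w b x -> f x = 0) ->
  zeta_over_L w c chi f X =
    (1 - L_coef w chi * X) * haar w c (fun x => f x * (chi x * (q * X) ^ w x)).
Proof.
move=> k0 hchi sf fb; have [n [m [nm [f0 _]]]] := schwartz_sch sf.
pose a := Order.min n b - 1; pose l := absz (b - a).
have sh0 (j : int) : ~~ (a + 1 <= j < a + 1 + l%:Z) -> shell_integral w c chi f j = 0.
  move=> hj; transitivity (q ^ j * haar w c (fun=> 0)); last by rewrite haar0 ?mulr0.
  congr (_ * haar _ _ _); apply/funext => x; case: ifP => // /andP[x0 /eqP wx].
  have [bx|nbx] := leP b j; first by rewrite fb ?mul0r //; right; rewrite wx.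
  rewrite f0 ?mul0r // => /(ballE w _ x0); rewrite wx => nj; case/negP: hj.
  have : a + 1 <= n by rewrite /a subrK ge_min lexx.
  have : a + 1 <= b by rewrite /a subrK ge_min lexx orbT.
  by rewrite /l; lia.
rewrite (@zeta_finite _ _ a l.+3); last first.
  by move=> j hj; rewrite /zeta_term !sh0 ?mulr0 ?subr0 ?mul0r //; lia.
pose S j := shell_integral w c chi f j * X ^ j.
have -> : \sum_(i < l.+3) zeta_term chi f (a + i) =
    \sum_(i < l.+3) S (a + i) - L_coef w chi * X * \sum_(i < l.+3) S (a + i - 1).
  rewrite mulr_sumr -sumrB; apply: eq_bigr => i _.
  have Xs : X ^ (a + i) = X * X ^ (a + i - 1).
    transitivity (X ^ (1 + (a + i - 1))); first by congr (exprz _ _); lia.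
    by rewrite expfzDr // expr1z.
  rewrite /zeta_term /S mulrBl; congr (_ - _).
  by rewrite Xs; move: (shell_integral _ _ _ _ _) (X ^ _) => s y; ring.
(* The window has an empty shell at each end, so a shift by one changes nothing and the Euler factor
   comes out of the sum. *)
have -> : \sum_(i < l.+3) S (a + i - 1) = \sum_(i < l.+3) S (a + i).
  rewrite big_ord_recl [RHS]big_ord_recr /= /S !sh0; try by lia.
  rewrite !mul0r addr0 add0r.
  by apply: eq_bigr => i _; congr (_ * _); [congr shell_integral|congr (exprz _ _)];
    rewrite /bump /=; lia.
rewrite -[X in X - _]mul1r -mulrBl; congr (_ * _).
pose g j x := if (x != 0) && (w x == j) then chi x * (q * X) ^ w x else 0.
have schw (h : L -> algC) j : mulinv k h ->
    schwartz w (fun x => f x * (if (x != 0) && (w x == j) then h x else 0)).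
  move=> hh; apply: (schwartz_annulus k0 sf fb) => x u x0 ku.
  have [u0 wu] : u != 0 /\ w u = 0 by apply: ball1_unit => //; apply: ball_le ku; lia.
  by rewrite mulf_neq0 // valM // wu addr0 hh // x0.
have SE j : S j = haar w c (fun x => f x * g j x).
  have e : (fun x => if (x != 0) && (w x == j) then f x * chi x else 0) =
      (fun x => f x * (if (x != 0) && (w x == j) then chi x else 0)).
    by apply/funext => x; case: ifP; rewrite ?mulr0.
  rewrite /S /shell_integral e mulrAC -expfzMl -haarZ //; last exact: schw.
  congr haar; apply/funext => x; rewrite /g.
  by case: ifP => [/andP[_ /eqP->]|_]; rewrite ?mulr0 // mulrC mulrA.
under eq_bigr => i _ do rewrite SE.
rewrite -haar_sum //; last first.
  move=> i; apply: schw; apply: mulinvM => //.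
  by apply: mulinv_le (@mulinv_val 1 (fun n => (q * X) ^ n) ltr01); lia.
congr haar; apply/funext => x; rewrite -mulr_sumr.
have [x0|x0] := eqVneq x 0; first by rewrite fb ?mul0r //; left.
case: (pselect (ball w n x)) => nx; last by rewrite f0 // !mul0r.
case: (pselect (ball w b x)) => bx; first by rewrite fb // !mul0r.
congr (_ * _).
have [nx' bx'] : n <= w x /\ w x < b.
  split; first by apply/(ballE w _ x0).
  by rewrite ltNge; apply/negP => /(ballE w _ x0).
have la : a + 1 <= w x by rewrite /a subrK ge_min nx'.
have lx : (`|w x - a| < l.+3)%N by rewrite /l; lia.
rewrite (bigD1 (Ordinal lx)) //= big1 ?addr0.
  by rewrite /g x0 /=; case: eqP => //; lia.
move=> i /eqP ni; rewrite /g; case: ifP => // /andP[_ /eqP wi]; case: ni.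
by apply/val_inj => /=; lia.
Qed.

End Zeta.

(** * The p-adic order *)

Section PadicOrder.
Variables (R : realType) (p : nat) (p_prime : prime p) (p_odd : odd p).
Variables (Cp : closedFieldType) (ord : Cp -> \bar R).
Hypothesis hCp : is_padic_complex p ord.
Variable iota_p : {rmorphism algC -> Cp}.
Local Notation ov := (ordp ord iota_p).
Local Notation cong := (congr_p ord iota_p).

Lemma ov_ninfty x : (-oo < ov x)%E.
Proof. by case: hCp => -[h _ _ _ _] _ _; exact: h. Qed.

Lemma ov_pinfty x : ov x = +oo%E <-> x = 0.
Proof.
case: hCp => -[_ h _ _ _] _ _; rewrite /ordp h; split=> [/eqP|->].
  by rewrite fmorph_eq0 => /eqP.
by rewrite rmorph0.
Qed.

Lemma ovM x y : ov (x * y)%R = (ov x + ov y)%E.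
Proof. by case: hCp => -[_ _ h _ _] _ _; rewrite /ordp rmorphM h. Qed.

Lemma ov_p : ov p%:R = 1%E.
Proof. by case: hCp => -[_ _ _ _ h] _ _; rewrite /ordp rmorph_nat h. Qed.

Lemma ov_fin x : x != 0 -> ov x \is a fin_num.
Proof.
move=> x0; rewrite fin_numE -ltNye ov_ninfty /=.
by apply/eqP => /ov_pinfty/eqP; rewrite (negPf x0).
Qed.

Lemma ov_geD M x y : (M <= ov x)%E -> (M <= ov y)%E -> (M <= ov (x + y)%R)%E.
Proof.
case: hCp => -[_ _ _ h _] _ _ Mx My; rewrite /ordp rmorphD.
by apply: le_trans (h _ _); rewrite le_min Mx My.
Qed.

Lemma ov_gtD M x y : (M < ov x)%E -> (M < ov y)%E -> (M < ov (x + y)%R)%E.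
Proof.
case: hCp => -[_ _ _ h _] _ _ Mx My; rewrite /ordp rmorphD.
by apply: lt_le_trans (h _ _); rewrite lt_min Mx My.
Qed.

Lemma ov0 : ov 0 = +oo%E. Proof. exact/ov_pinfty. Qed.

Lemma ov1 : ov 1 = 0%E.
Proof.
have := ov_fin (oner_neq0 algC); have := ovM 1 1; rewrite mulr1.
case: (ov 1) => // r; rewrite -EFinD => -[/eqP]; rewrite -subr_eq0 opprD addNKr.
by rewrite oppr_eq0 => /eqP ->.
Qed.

Lemma ov_sqr1 x : x ^+ 2 = 1 -> ov x = 0%E.
Proof.
move=> x2; have x0 : x != 0.
  by apply/eqP => x0; move/eqP: x2; rewrite x0 expr0n /= eq_sym oner_eq0.
have := ov_fin x0; have := ovM x x; rewrite -expr2 x2 ov1.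
by case: (ov x) => // r; rewrite -EFinD => -[h] _; congr EFin; lra.
Qed.

Lemma ovN x : ov (- x)%R = ov x.
Proof. by rewrite -mulN1r ovM ov_sqr1 ?add0e // sqrrN expr1n. Qed.

Lemma ovB_sym x y : ov (x - y)%R = ov (y - x)%R.
Proof. by rewrite -ovN opprB. Qed.

Lemma ovV x : x != 0 -> ov (x^-1)%R = (- ov x)%E.
Proof.
move=> x0; have := ovM x x^-1; rewrite divff // ov1.
have := ov_fin x0; have := ov_fin (invr_neq0 x0).
case: (ov x) => // r; case: (ov (x^-1)%R) => // s _ _; rewrite -EFinD => -[h].
by rewrite -EFinN; congr EFin; lra.
Qed.

Lemma ov_sum M (I : Type) (s : seq I) (P : pred I) (F : I -> algC) :
  (forall i, P i -> (M <= ov (F i)%R)%E) -> (M <= ov (\sum_(i <- s | P i) F i)%R)%E.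
Proof.
move=> h; elim/big_rec: _ => [|i x Pi]; first by rewrite ov0 leey.
by move=> Mx; apply: ov_geD (h _ Pi) Mx.
Qed.

Lemma ov_sum_gt M (I : Type) (s : seq I) (P : pred I) (F : I -> algC) :
  (M < +oo)%E ->
  (forall i, P i -> (M < ov (F i)%R)%E) -> (M < ov (\sum_(i <- s | P i) F i)%R)%E.
Proof.
move=> Moo h; elim/big_rec: _ => [|i x Pi]; first by rewrite ov0.
by move=> Mx; apply: ov_gtD (h _ Pi) Mx.
Qed.

Lemma ov_nat n : (0 <= ov n%:R)%E.
Proof.
elim: n => [|n IHn]; first by rewrite ov0 leey.
by rewrite mulrS; apply: ov_geD => //; rewrite ov1.
Qed.

Lemma ov_eqDl x y : (ov x < ov y)%E -> ov (x + y)%R = ov x.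
Proof.
move=> xy; apply/eqP; rewrite eq_le ov_geD // ?(ltW xy) // andbT leNgt.
apply/negP => h; have : (ov x < ov (x + y - y)%R)%E by apply: ov_gtD; rewrite ?ovN.
by rewrite addrK ltxx.
Qed.

Lemma ov_geM x y M : (0 <= ov x)%E -> (M <= ov y)%E -> (M <= ov (x * y)%R)%E.
Proof. by move=> x0 My; rewrite ovM; apply: le_trans My _; rewrite leeDr. Qed.

Lemma ov_gtM x y M : (0 <= ov x)%E -> (M < ov y)%E -> (M < ov (x * y)%R)%E.
Proof. by move=> x0 My; rewrite ovM; apply: lt_le_trans My _; rewrite leeDr. Qed.

Lemma ov_unitM x y : ov x = 0%E -> ov (x * y)%R = ov y.
Proof. by move=> x0; rewrite ovM x0 add0e. Qed.

Lemma ov_unit_neq0 x : ov x = 0%E -> x != 0.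
Proof. by move=> x0; apply/eqP => /ov_pinfty; rewrite x0. Qed.

Lemma ov_unitV x : ov x = 0%E -> ov (x^-1)%R = 0%E.
Proof. by move=> x0; rewrite ovV ?ov_unit_neq0 // x0 oppe0. Qed.

Lemma ov_unitX x n : ov x = 0%E -> ov (x ^+ n)%R = 0%E.
Proof.
by move=> x0; elim: n => [|n IHn]; rewrite ?expr0 ?ov1 // exprS ov_unitM.
Qed.

Lemma ov_unitXz x (n : int) : ov x = 0%E -> ov (x ^ n)%R = 0%E.
Proof.
case: n => n x0; first exact: ov_unitX.
by rewrite NegzE -exprnN ov_unitV // ov_unitX.
Qed.

Lemma ov_root_unit x n : (0 < n)%N -> ov (x ^+ n)%R = 0%E -> ov x = 0%E.
Proof.
case: n => // n _ xn; have x0 : x != 0.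
  by move: (ov_unit_neq0 xn); rewrite expf_eq0.
have ge0 y : (0 <= ov y)%E -> (0 <= ov (y ^+ n)%R)%E.
  move=> y0; elim: (n) => [|k IHk]; first by rewrite expr0 ov1.
  by rewrite exprS; apply: ov_geM.
apply/eqP; rewrite eq_le; apply/andP; split; rewrite leNgt; apply/negP => h.
  have : (0 < ov (x ^+ n * x)%R)%E by apply: ov_gtM => //; apply/ge0/ltW.
  by rewrite -exprSr xn ltxx.
have h' : (0 < ov (x^-1)%R)%E by rewrite ovV // oppe_gt0.
have : (0 < ov (x^-1 ^+ n * x^-1)%R)%E by apply: ov_gtM => //; apply/ge0/ltW.
by rewrite -exprSr exprVn ov_unitV // ltxx.
Qed.

Lemma cong_refl x : cong x x.
Proof. by rewrite /congr_p subrr ov0. Qed.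

Lemma cong_sym x y : cong x y -> cong y x.
Proof. by rewrite /congr_p ovB_sym. Qed.

Lemma cong_trans y x z : cong x y -> cong y z -> cong x z.
Proof.
by rewrite /congr_p => xy yz; rewrite -(subrK y x) -addrA; apply: ov_gtD.
Qed.

Lemma congD x y x' y' : cong x y -> cong x' y' -> cong (x + x') (y + y').
Proof. by rewrite /congr_p => xy xy'; rewrite opprD addrACA; apply: ov_gtD. Qed.

Lemma congN x y : cong x y -> cong (- x) (- y).
Proof. by rewrite /congr_p -opprD ovN. Qed.

Lemma cong0 x : cong x 0 <-> (0 < ov x)%E.
Proof. by rewrite /congr_p subr0. Qed.

Lemma cong_int x y : cong x y -> (0 <= ov y)%E -> (0 <= ov x)%E.
Proof.
move=> xy y0; rewrite -(subrK y x); apply: ov_geD => //; exact: ltW.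
Qed.

Lemma cong_unit x y : cong x y -> ov y = 0%E -> ov x = 0%E.
Proof.
by move=> xy y0; rewrite -(subrK y x) addrC ov_eqDl // y0.
Qed.

Lemma congM x y x' y' : cong x y -> cong x' y' ->
  (0 <= ov x)%E -> (0 <= ov y')%E -> cong (x * x') (y * y').
Proof.
move=> xy xy' x0 y0; rewrite /congr_p.
have -> : x * x' - y * y' = x * (x' - y') + y' * (x - y) by ring.
by apply: ov_gtD; apply: ov_gtM.
Qed.

Lemma congMl a x y : (0 <= ov a)%E -> cong x y -> cong (a * x) (a * y).
Proof. by move=> a0 xy; rewrite /congr_p -mulrBr; apply: ov_gtM. Qed.

Lemma congMl_unit a x y : ov a = 0%E -> cong (a * x) (a * y) <-> cong x y.
Proof. by move=> a0; rewrite /congr_p -mulrBr ov_unitM. Qed.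

Lemma congV x y : ov y = 0%E -> cong x y -> cong x^-1 y^-1.
Proof.
move=> y0 xy; have x0 := cong_unit xy y0.
rewrite -(congMl_unit _ _ x0) divff ?ov_unit_neq0 //.
rewrite -(congMl_unit _ _ y0) mulr1 mulrCA divff ?ov_unit_neq0 // mulr1.
exact: cong_sym.
Qed.

Lemma congX x y n : (0 <= ov y)%E -> cong x y -> cong (x ^+ n) (y ^+ n).
Proof.
move=> y0 xy; have x0 := cong_int xy y0.
elim: n => [|n IHn]; first by rewrite !expr0; exact: cong_refl.
rewrite !exprS; apply: congM => //; elim: (n) => [|k IHk]; first by rewrite expr0 ov1.
by rewrite exprS; apply: ov_geM.
Qed.

Lemma ov_nat_coprime n : coprime p n -> ov n%:R = 0%E.
Proof.
move=> cop; apply/eqP; rewrite eq_le ov_nat andbT leNgt; apply/negP => h.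
have [u v e _] := egcdnP n (prime_gt0 p_prime).
have : (0 < ov (u%:R * p%:R - v%:R * n%:R)%R)%E.
  by apply: ov_gtD; rewrite ?ovN; apply: ov_gtM; rewrite ?ov_nat ?ov_p.
rewrite -!natrM e natrD addrAC subrr add0r.
by move: cop; rewrite /coprime => /eqP ->; rewrite ov1 ltxx.
Qed.

Lemma ov_nat_dvd n : (0 < ov n%:R)%E -> (p %| n)%N.
Proof.
move=> h; apply: contraT => nd; have := ov_nat_coprime (n := n).
by rewrite prime_coprime // nd => /(_ isT) e; rewrite e ltxx in h.
Qed.

Lemma ov_dvd_ge1 n : (p %| n)%N -> (1 <= ov n%:R)%E.
Proof.
by move=> /dvdnP[k ->]; rewrite natrM; apply: ov_geM; rewrite ?ov_nat // ov_p.
Qed.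

Lemma ov2 : ov 2%:R = 0%E.
Proof. by apply: ov_nat_coprime; rewrite coprimen2. Qed.

(** As p is odd, 2 is a unit and residues distinguish signs. *)
Lemma cong_sign s t : (s = 1 \/ s = -1) -> (t = 1 \/ t = -1) -> cong s t -> s = t.
Proof.
have n2 : ~ cong 1 (-1) by rewrite /congr_p opprK -[1 + 1]/(2%:R) ov2 ltxx.
by case=> -> [] -> // /cong_sym.
Qed.

(** If x were not 1, the sum of the x^i for i < N would be 0, but it is congruent to the unit N. *)
Lemma root_of_unity_cong1 x N : x ^+ N = 1 -> ov N%:R = 0%E -> cong x 1 -> x = 1.
Proof.
move=> xN N0 x1; apply/eqP; have := subrX1 x N; rewrite xN subrr => /esym/eqP.
rewrite mulf_eq0 subr_eq0 => /orP[] // /eqP s0; suff : cong 0 N%:R.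
  by rewrite /congr_p sub0r ovN N0 ltxx.
rewrite -s0; have -> : N%:R = \sum_(i < N) (1 : algC) by rewrite sumr_const card_ord.
elim/big_ind2: _ => [|a b c d|i _]; [exact: cong_refl|exact: congD|].
by rewrite -(expr1n _ i); apply: congX; rewrite ?ov1.
Qed.

(** Such an x has p-power order, so some power y has order exactly p. If t = y - 1 had order at
    least 1, the vanishing sum of the y^j for j < p would be p plus terms of order at least 2,
    because p divides the binomial 'C(p, 2) for odd p. *)
Lemma root_of_unity_ord x N : (0 < N)%N -> x ^+ N = 1 -> x <> 1 -> cong x 1 ->
  exists k : nat, (ov (x ^+ k - 1)%R < 1)%E.
Proof.
move=> N0 xN x1 xc; have [n' cop NE] := pfactor_coprime p_prime N0.
have pow_p1 : x ^+ (p ^ logn p N) = 1.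
  apply: (root_of_unity_cong1 (N := n')); last 1 first.
  - by rewrite -(expr1n _ (p ^ logn p N)); apply: congX; rewrite ?ov1.
  - by rewrite -exprM mulnC -NE.
  by apply: ov_nat_coprime.
have [|i /eqP xi imin] := @ex_minnP (fun i => x ^+ (p ^ i) == 1).
  by exists (logn p N); apply/eqP.
case: i xi imin => [|i] xi imin; first by rewrite expn0 expr1 in xi.
exists (p ^ i)%N; set y := x ^+ (p ^ i).
have y1 : y != 1 by apply/negP => /imin; rewrite ltnn.
have yp : y ^+ p = 1 by rewrite /y -exprM -expnSr.
pose t := y - 1; have yE : y = 1 + t by rewrite /t addrC subrK.
rewrite ltNge -/t; apply/negP => t1.
have le01 : (0 <= 1 :> \bar R)%E by rewrite lee_fin.
have tt : (1 + 1 <= ov (t * t)%R)%E by rewrite ovM; apply: leeD.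
(* First-order expansion of (1 + t)^j; the remainder is divisible by t^2. *)
have yj j : (1 + 1 <= ov (y ^+ j - 1 - j%:R * t)%R)%E.
  elim: j => [|j IHj]; first by rewrite expr0 mul0r subr0 subrr ov0 leey.
  have -> : y ^+ j.+1 - 1 - j.+1%:R * t =
      y * (y ^+ j - 1 - j%:R * t) + j%:R * (t * t).
    by rewrite exprS -natr1 yE; ring.
  apply: ov_geD; apply: ov_geM => //; last exact: ov_nat.
  by rewrite yE; apply: ov_geD; rewrite ?ov1 //; apply: le_trans t1.
have s0 : \sum_(j < p) y ^+ j = 0.
  apply/eqP; have := subrX1 y p; rewrite yp subrr => /esym/eqP.
  by rewrite mulf_eq0 subr_eq0 (negPf y1).
have sE : \sum_(j < p) y ^+ j =
    p%:R + ('C(p, 2)%:R * t + \sum_(j < p) (y ^+ j - 1 - j%:R * t)).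
  rewrite -bin2_sum big_mkord natr_sum mulr_suml -big_split /=.
  have -> : p%:R = \sum_(j < p) (1 : algC) by rewrite sumr_const card_ord.
  by rewrite -big_split /=; apply: eq_bigr => j _; ring.
have : ov (\sum_(j < p) y ^+ j) = 1%E.
  have lt12 : (1 < 1 + 1 :> \bar R)%E by rewrite -EFinD lte_fin; lra.
  rewrite sE ov_eqDl ov_p //; apply: lt_le_trans lt12 _; apply: ov_geD.
    rewrite ovM; apply: leeD => //; apply: ov_dvd_ge1; apply: prime_dvd_bin => //.
    by have := odd_prime_gt2 p_odd p_prime.
  by apply: ov_sum => j _; exact: yj.
by rewrite s0 ov0.
Qed.

End PadicOrder.

Lemma int_max (P : int -> Prop) (C a : int) :
  P a -> (forall k, P k -> k <= C) -> exists2 k, P k & forall j, P j -> j <= k.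
Proof.
move=> Pa hC.
have ex : exists i : nat, `[< P (C - i%:Z) >].
  by exists (absz (C - a)); apply/asboolP; have := hC _ Pa => aC;
    have -> : C - (absz (C - a))%:Z = a by lia.
have [i /asboolP Pi imin] := ex_minnP ex.
exists (C - i%:Z) => // j Pj; rewrite leNgt; apply/negP => lt.
have jC := hC _ Pj; have /imin : `[< P (C - (absz (C - j))%:Z) >].
  by apply/asboolP; have -> : C - (absz (C - j))%:Z = j by lia.
lia.
Qed.

(** * Quadratic extensions *)

Section ScalarEmbedding.
Variables (Fv : fieldType) (Kv : fieldExtType Fv).

Lemma algD (x y : Fv) : (x + y)%:A = x%:A + y%:A :> Kv.
Proof. by rewrite scalerDl. Qed.
Lemma algN (x : Fv) : (- x)%:A = - x%:A :> Kv.
Proof. by rewrite scaleNr. Qed.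
Lemma algM (x y : Fv) : (x * y)%:A = x%:A * y%:A :> Kv.
Proof. by rewrite mulr_algl scalerA. Qed.
Lemma algV (x : Fv) : (x^-1)%:A = (x%:A)^-1 :> Kv.
Proof. by rewrite -!in_algE fmorphV. Qed.
Lemma algX (x : Fv) n : (x ^+ n)%:A = x%:A ^+ n :> Kv.
Proof. by rewrite -!in_algE rmorphXn. Qed.
Lemma alg_nat n : (n%:R : Fv)%:A = n%:R :> Kv.
Proof. by rewrite -in_algE rmorph_nat. Qed.
Lemma alg_eq0 (x : Fv) : (x%:A == 0 :> Kv) = (x == 0).
Proof. by rewrite scaler_eq0 oner_eq0 orbF. Qed.
Lemma alg_inj : injective (fun x : Fv => x%:A : Kv).
Proof. by move=> x y; rewrite -!in_algE => /fmorph_inj. Qed.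

End ScalarEmbedding.

Lemma eqN0 (L : fieldType) (x : L) : 2%:R != 0 :> L -> x = - x -> x = 0.
Proof.
move=> t0 /eqP; rewrite -addr_eq0 -mulr2n -mulr_natl mulf_eq0 (negPf t0) /=.
by move/eqP.
Qed.

Section RepsPigeonhole.
Variables (V : zmodType) (A B : set V) (r : seq V).
Hypotheses (B0 : B 0) (hr : reps A B r).

Lemma reps_rem x y : x \in r -> y \in rem x r -> ~ B (x - y).
Proof.
case: hr => rA r1 xr yr Bxy; have := r1 x (rA _ xr).
rewrite (big_rem x) //= (big_rem y) //= subrr.
by case: asboolP => // _; case: asboolP.
Qed.

Lemma reps_inj x y : x \in r -> y \in r -> B (x - y) -> x = y.
Proof.
move=> xr yr Bxy; apply/eqP/negPn/negP => nxy; apply: (reps_rem xr _ Bxy).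
by move: yr; rewrite (perm_mem (perm_to_rem xr)) inE eq_sym (negPf nxy).
Qed.

Lemma reps_uniq : uniq r.
Proof.
apply: count_mem_uniq => x; case: (boolP (x \in r)) => [xr|]; last by move/count_memPn.
have := permP (perm_to_rem xr) (pred1 x) => /= ->; rewrite eqxx.
rewrite (count_memPn _) //; apply/negP => /(reps_rem xr); rewrite subrr; exact.
Qed.

Lemma reps_pigeonhole (BB : forall x y, B x -> B y -> B (x - y)) (u : nat -> V) :
  (forall k, A (u k)) -> exists i j, (i < j)%N /\ B (u j - u i).
Proof.
move=> Au; have /choice[f hf] : forall k : nat, exists x, x \in r /\ B (u k - x).
  move=> k; case: hr => _ /(_ _ (Au k)) s1; apply: contrapT => no; move: s1.
  rewrite big1_seq // => x /= xr; case: asboolP => // Bux; case: no; exists x.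
  by split.
pose s := [seq f k | k <- iota 0 (size r).+1].
have : ~~ uniq s.
  apply/negP => us; have := uniq_leq_size us (s2 := r).
  rewrite size_map size_iota ltnn => h.
  by have : false by apply: h => _ /mapP[k _ ->]; case: (hf k).
move/(uniqPn 0) => [i [j [ij]]]; rewrite size_map size_iota => js.
rewrite !(nth_map 0%N) ?size_iota ?(ltn_trans ij) // !nth_iota ?(ltn_trans ij) // !add0n.
move=> fij; exists i, j; split=> //.
have -> : u j - u i = (u j - f j) - (u i - f i) by rewrite -fij opprB addrA subrK.
by apply: BB; [case: (hf j)|case: (hf i)].
Qed.

End RepsPigeonhole.

(** * Finiteness of the residue field *)

Section Residues.
Variables (L : fieldType) (w : L -> int).
Hypothesis hL : local_field w.
Let hw : finite_place w. Proof. by case: hL. Qed.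

(** Pigeonhole on the powers of u. It makes the values of a quasicharacter on units roots of
    unity. *)
Lemma unit_pow_near1 n u : u != 0 -> w u = 0 -> 0 <= n ->
  exists2 k, (0 < k)%N & ball w n (u ^+ k - 1).
Proof.
move=> u0 wu n0; have [r hr] := reps_ex hL n0.
have uk k : ball w 0 (u ^+ k) by right; rewrite valX // wu mulr0.
have [i [j [ij b]]] := reps_pigeonhole hr (@ballB _ _ hw n) uk.
exists (j - i)%N; first by rewrite subn_gt0.
move: b; have -> : u ^+ j - u ^+ i = u ^+ i * (u ^+ (j - i) - 1).
  by rewrite mulrBr mulr1 -exprD subnKC // ltnW.
by rewrite ball_mull ?expf_neq0 // valX // wu mulr0 subr0.
Qed.

Lemma multiple_near0 n x : exists2 N, (0 < N)%N & ball w n (x *+ N).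
Proof.
have [r hr] : exists r, reps (ball w (Order.min n (w x))) (ball w n) r.
  by apply: reps_ex => //; rewrite ge_min lexx.
have xk k : ball w (Order.min n (w x)) (x *+ k).
  elim: k => [|k IHk]; first by left.
  rewrite mulrS; apply: ballD => //; apply: ball_le (ballnn w x).
  by rewrite ge_min lexx orbT.
have [i [j [ij b]]] := reps_pigeonhole hr (@ballB _ _ hw n) xk.
by exists (j - i)%N; rewrite ?subn_gt0 // mulrnBr // ltnW.
Qed.

(* [y |-> a y + b y^2] identifies [0] and [- a / b], so it is not onto the
   residue field. *)
Lemma quadratic_not_onto a b : a != 0 -> w a = 0 -> b != 0 -> w b = 0 ->
  exists2 c, ball w 0 c & forall y, ball w 0 y ->
    ~ ball w 1 (c - (a * y + b * y ^+ 2)).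
Proof.
move=> a0 wa b0 wb; apply: contrapT => no.
have {no} onto c : ball w 0 c ->
    exists2 y, ball w 0 y & ball w 1 (c - (a * y + b * y ^+ 2)).
  move=> c0; apply: contrapT => nc; apply: no; exists c => // y y0 h.
  by apply: nc; exists y.
pose g y := a * y + b * y ^+ 2.
have ba : ball w 0 a by right; rewrite wa.
have bb : ball w 0 b by right; rewrite wb.
have gO y : ball w 0 y -> ball w 0 (g y).
  move=> hy; apply: ballD => //; first by have := ballM hw ba hy; rewrite addr0.
  by have := ballM hw bb (ballM hw hy hy); rewrite !addr0 expr2.
have gB y z : ball w 0 y -> ball w 0 z -> ball w 1 (y - z) -> ball w 1 (g y - g z).
  move=> hy hz hyz; have -> : g y - g z = (a + b * (y + z)) * (y - z) by rewrite /g; ring.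
  have h : ball w 0 (a + b * (y + z)).
    by apply: ballD => //; have := ballM hw bb (ballD hw hy hz); rewrite addr0.
  by have := ballM hw h hyz; rewrite add0r.
have [r hr] := reps_ex hL (ler01 : 0 <= 1 :> int).
have [rA _] := hr.
have /choice[f hf] : forall y, exists x, ball w 0 y -> x \in r /\ ball w 1 (y - x).
  move=> y; case: (pselect (ball w 0 y)) => hy; last by exists 0.
  by have [x] := reps_mem hr hy; exists x.
have fE y x : ball w 0 y -> x \in r -> ball w 1 (y - x) -> f y = x.
  move=> hy xr yx; have [fr yf] := hf y hy.
  apply: (reps_inj (@ball0 _ w 1) hr) => //.
  have -> : f y - x = (y - x) - (y - f y) by ring.
  exact: ballB.
pose y0 := f 0; pose y1 := f (- a / b).
have b00 : ball w 0 0 by left.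
have bab : ball w 0 (- a / b).
  by right; rewrite valM ?oppr_eq0 ?invr_eq0 // valN // valV // wa wb subr0.
have [y0r y0E] := hf _ b00; have [y1r y1E] := hf _ bab.
have y01 : y0 != y1.
  apply/eqP => e; have : ball w 1 (a / b).
    have -> : a / b = (0 - y0) - (- a / b - y1) by rewrite e; ring.
    exact: ballB.
  rewrite ballE ?mulf_neq0 ?invr_eq0 // valM ?invr_eq0 // valV // wa wb; lia.
have gy01 : f (g y1) = f (g y0).
  apply: fE; [by apply/gO/rA|by case: (hf (g y0) (gO _ (rA _ y0r)))|].
  have [_ h0] := hf _ (gO _ (rA _ y0r)).
  have -> : g y1 - f (g y0) = (g y1 - g (- a / b)) + (g 0 - g y0) + (g y0 - f (g y0)).
    rewrite /g; field => //.
  apply: ballD => //; apply: ballD => //; apply: gB => //.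
  - exact: rA.
  - by apply/ball_subr.
  exact: rA.
have sub : {subset r <= [seq f (g y) | y <- rem y1 r]}.
  move=> c cr; have [y hy cy] := onto c (rA _ cr).
  have [fyr yfy] := hf y hy.
  have E : f (g (f y)) = c.
    apply: fE => //; first exact/gO/rA.
    have -> : g (f y) - c = - (c - g y) + (g (f y) - g y) by rewrite /g; ring.
    by apply: ballD => //; [exact: ballN|apply: gB => //; [exact: rA|apply/ball_subr]].
  have [fy1|fy1] := eqVneq (f y) y1.
    apply/mapP; exists y0; last by rewrite -gy01 -fy1.
    by move: y0r; rewrite (perm_mem (perm_to_rem y1r)) inE (negPf y01).
  apply/mapP; exists (f y) => //.
  by move: fyr; rewrite (perm_mem (perm_to_rem y1r)) inE (negPf fy1).
have := uniq_leq_size (reps_uniq (@ball0 _ w 1) hr) sub.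
have r_gt0 : (0 < size r)%N by move: y1r; case: (r).
by rewrite size_map size_rem // leqNgt ltn_predL r_gt0.
Qed.

End Residues.

(* Pruning the context keeps [lia] fast. *)
Ltac ilia :=
  repeat match goal with
  | H : ?T |- _ =>
      lazymatch T with
      | is_true (@Order.le _ _ _ _) => fail
      | is_true (@Order.lt _ _ _ _) => fail
      | @eq int _ _ => fail
      | _ => clear H
      end
  end; lia.

Lemma nabs_gt0 (L : fieldType) (w : L -> int) : local_field w ->
  forall x, x != 0 -> 0 < nabs w x.
Proof.
move=> hL x x0'; rewrite /nabs (negPf x0') exprz_gt0 //; exact: q_gt0.
Qed.

(** [e] is the ramification index. Any nonzero [d] negated by [bar] is allowed, so that the geometry
    of Kv / Fv is developed without theta. *)
Record quad_setup (Fv : fieldType) (vF : Fv -> int) (Kv : fieldExtType Fv)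
  (vK : Kv -> int) (bar : {rmorphism Kv -> Kv}) (e : int) (d : Kv) : Prop := {
  quad_hFv : local_field vF;
  quad_hKv : local_field vK;
  quad_Kv_quadratic : \dim {:Kv} = 2%N;
  quad_e_gt0 : 0 < e;
  quad_vKe : forall x : Fv, vK x%:A = e * vF x;
  quad_bar_fix : forall x : Fv, bar x%:A = x%:A;
  quad_two_neq0 : 2%:R != 0 :> Fv;
  quad_d_neq0 : d != 0;
  quad_bar_d : bar d = - d }.

(* [omega] is a translate of [d] by a nearest point of [Fv], rescaled so that
   [(1, omega)] is an orthogonal basis of [Kv] over [Fv]. *)
Record orth_setup (Fv : fieldType) (vF : Fv -> int) (Kv : fieldExtType Fv)
  (vK : Kv -> int) (e : int) (d omega : Kv) (t x0 : Fv) : Prop := {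
  orth_t_neq0 : t != 0;
  orth_omega_neq0 : omega != 0;
  orth_dE : d = t%:A * omega + x0%:A;
  orth_v_omega : vK omega = e - 1;
  orth_e12 : e = 1 \/ e = 2;
  orth_orth : forall n (x y : Fv), ball vK n (x%:A + y%:A * omega) <->
     ball vK n x%:A /\ ball vK n (y%:A * omega) }.

Section QuadraticExtension.
Variables (Fv : fieldType) (vF : Fv -> int) (Kv : fieldExtType Fv)
  (vK : Kv -> int) (bar : {rmorphism Kv -> Kv}) (e : int) (d : Kv).
Hypothesis H : quad_setup vF vK bar e d.
Let hFv : local_field vF. Proof. by case: H. Qed.
Let hKv : local_field vK. Proof. by case: H. Qed.
Let Kv_quadratic : \dim {:Kv} = 2%N. Proof. by case: H. Qed.
Let e_gt0 : 0 < e. Proof. by case: H. Qed.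
Let vKe : forall x : Fv, vK x%:A = e * vF x. Proof. by case: H. Qed.
Let bar_fix : forall x : Fv, bar x%:A = x%:A. Proof. by case: H. Qed.
Let two_neq0 : 2%:R != 0 :> Fv. Proof. by case: H. Qed.
Let d_neq0 : d != 0. Proof. by case: H. Qed.
Let bar_d : bar d = - d. Proof. by case: H. Qed.
Let hF : finite_place vF. Proof. by case: hFv. Qed.
Let hK : finite_place vK. Proof. by case: hKv. Qed.
Local Notation q := ((residue_card vF)%:R : algC).
Local Notation qK := ((residue_card vK)%:R : algC).

Lemma two_neq0K : 2%:R != 0 :> Kv.
Proof. by rewrite -alg_nat alg_eq0. Qed.

Lemma ball_alg n (x : Fv) : ball vK (e * n) x%:A <-> ball vF n x.
Proof.
have [->|x0] := eqVneq x 0; first by rewrite scale0r; split; left.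
rewrite !ballE ?alg_eq0 // vKe; split; nia.
Qed.

Lemma d_notin (x : Fv) : x%:A + d != 0.
Proof.
apply/eqP => xd; have dx : d = (- x)%:A by apply/eqP; rewrite algN -addr_eq0 addrC xd.
move/eqP: d_neq0; apply; apply: (eqN0 two_neq0K).
by rewrite -bar_d dx bar_fix.
Qed.

Lemma coords z : exists x y : Fv, z = x%:A + y%:A * d.
Proof.
pose X : 2.-tuple Kv := [tuple 1; d].
have fX : free X.
  rewrite free_cons seq1_free d_neq0 andbT span_seq1; apply/negP => /vlineP[k kd].
  have k0 : k != 0.
    by apply/eqP => k0; move/eqP: kd; rewrite k0 scale0r oner_eq0.
  have := d_notin (- k^-1); rewrite algN addrC subr_eq0 => /eqP; apply.
  by rewrite kd scalerA mulVf // scale1r.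
have bX : basis_of fullv X by rewrite basisEfree fX subvf Kv_quadratic.
exists (coord X ord0 z), (coord X ord_max z).
rewrite {1}(coord_basis bX (memvf z)) !big_ord_recl big_ord0 addr0 mulr_algl.
by congr (_ *: _ + coord X _ z *: _); apply: val_inj.
Qed.

Lemma bar_coords (x y : Fv) : bar (x%:A + y%:A * d) = x%:A - y%:A * d.
Proof. by rewrite rmorphD rmorphM !bar_fix bar_d mulrN. Qed.

Lemma barK : involutive bar.
Proof.
by move=> z; have [x [y ->]] := coords z; rewrite bar_coords rmorphB rmorphM !bar_fix
  bar_d mulrN opprK.
Qed.

Lemma bar_fixed z : bar z = z -> exists x : Fv, z = x%:A.
Proof.
have [x [y ->]] := coords z; rewrite bar_coords => /addrI/esym/(eqN0 two_neq0K) ->.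
by exists x; rewrite addr0.
Qed.

Lemma bar_eq0 z : (bar z == 0) = (z == 0).
Proof. exact: fmorph_eq0. Qed.

Lemma d_sqr : exists2 D : Fv, D != 0 & d * d = D%:A.
Proof.
have [|D hD] := @bar_fixed (d * d); first by rewrite rmorphM bar_d mulrNN.
exists D => //; apply/eqP => D0; move/eqP: hD.
by rewrite D0 scale0r mulf_eq0 orbb (negPf d_neq0).
Qed.

Lemma quad_traceE (x y : Fv) : quad_trace bar (x%:A + y%:A * d) = 2%:R * x.
Proof.
rewrite /quad_trace bar_coords; apply: xget_unique => [|t].
  by rewrite /= algM alg_nat; ring.
move=> ht; apply: (@alg_inj _ Kv); rewrite /= ht algM alg_nat; ring.
Qed.

Lemma psi_extE psi (x y : Fv) : psi_ext bar psi (x%:A + y%:A * d) = psi (2%:R * x).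
Proof. by rewrite /psi_ext quad_traceE. Qed.

(** Fv is complete, hence closed in Kv: points of Fv approaching -d would converge in Fv, and [d] is
    not in Fv. *)
Lemma dist_bounded : exists C, forall x : Fv, vK (x%:A + d) <= C.
Proof.
apply: contrapT => no.
have /choice[u hu] : forall n : nat, exists x : Fv, ball vK n (x%:A + d).
  move=> n; apply: contrapT => nx; apply: no; exists n%:Z => x.
  rewrite leNgt; apply/negP => lt; apply: nx; exists x; right; exact: ltW.
have cau (n i j : nat) : (n <= i)%N -> (n <= j)%N -> ball vK n (u i - u j)%:A.
  move=> ni nj; have -> : (u i - u j)%:A = (u i)%:A + d - ((u j)%:A + d) :> Kv.
    by rewrite algD algN; ring.
  by apply: ballB => //; [apply: ball_le (hu i)|apply: ball_le (hu j)]; lia.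
have [_ comp _] := hFv; have [|l hl] := comp u.
  move=> M; exists (absz (e * M)) => i j ni nj; apply/ball_alg.
  by apply: ball_le (cau _ _ _ ni nj); lia.
have := d_notin l; set z := _ + d => z0.
have [M zM M0] : exists2 M, vK z < M & 0 <= M by exists ((absz (vK z))%:Z + 1); lia.
have [N hN] := hl M; pose i := (N + absz M)%N.
have : ball vK M z.
  have -> : z = (u i)%:A + d - (u i - l)%:A by rewrite /z algD algN; ring.
  apply: ballB => //; first by apply: ball_le (hu i); rewrite /i; lia.
  have /ball_alg : ball vF M (u i - l) by apply: hN; rewrite /i; lia.
  by apply: ball_le; nia.
by rewrite ballE //; lia.
Qed.

(* [omega] is obtained by scaling a point of [Fv + d] of maximal valuation. *)
Lemma orth_setup_ex : exists (omega : Kv) (t x0 : Fv), orth_setup vF vK e d omega t x0.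
Proof.
have [C hC] := dist_bounded.
have [k [x1 x1k] kmax] := @int_max (fun k => exists x : Fv, vK (x%:A + d) = k) C _
  (ex_intro _ 0 erefl) (fun k h => let: ex_intro x hx := h in
    eq_ind _ (fun k => is_true (k <= C)) (hC x) _ hx).
set d' := x1%:A + d in x1k; have d'0 : d' != 0 by exact: d_notin.
have maxd' (x : Fv) : vK (x%:A + d') <= k.
  by apply: kmax; exists (x + x1); rewrite algD addrA.
have xd'0 (x : Fv) : x%:A + d' != 0 by rewrite addrA -algD d_notin.
(* Maximality of k excludes cancellation: x / y + d' never has a larger valuation than d'. *)
have orth n (x y : Fv) : ball vK n (x%:A + y%:A * d') <->
    ball vK n x%:A /\ ball vK n (y%:A * d').
  split=> [h|[]]; last exact: ballD.
  have by_ : ball vK n (y%:A * d').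
    have [->|y0] := eqVneq y 0; first by rewrite scale0r mul0r; left.
    apply/ballE; rewrite ?mulf_neq0 ?alg_eq0 //.
    move: h; have -> : x%:A + y%:A * d' = y%:A * ((x / y)%:A + d').
      by rewrite [RHS]mulrDr -algM mulrCA divff // mulr1.
    rewrite ballE ?mulf_neq0 ?alg_eq0 // !valM ?alg_eq0 //.
    by have := maxd' (x / y); rewrite x1k; lia.
  by split=> //; apply/(ballDr hK _ by_).
have scaled (s : Fv) : s != 0 -> vK (s%:A * d') = e - 1 -> (e = 1 \/ e = 2) ->
    exists (omega : Kv) (t x0 : Fv), orth_setup vF vK e d omega t x0.
  move=> s0 vs he; exists (s%:A * d'), s^-1, (- x1); split=> //.
  - by rewrite invr_neq0.
  - by rewrite mulf_neq0 ?alg_eq0.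
  - by rewrite mulrA -algM mulVf // scale1r mul1r algN /d' addrAC subrr add0r.
  by move=> n x y; rewrite mulrA -algM; exact: orth.
(* Without cancellation all valuations lie in two classes modulo e. As [vK] takes the values 1 and
   2, e is 1 or 2; if e = 2, the relation 1 = e a + k gives the scaling of d' to valuation e - 1. *)
have val_orth z : z != 0 -> (exists a, vK z = e * a) \/ (exists a, vK z = e * a + k).
  have [x [y zE]] := coords z.
  have {zE} zE : z = (x - y * x1)%:A + y%:A * d'.
    by rewrite zE /d' algD algN algM; ring.
  move: (x - y * x1) zE => {}x zE z0.
  have /orth[bx by_] : ball vK (vK z) (x%:A + y%:A * d') by rewrite -zE; right.
  have nz : ~ ball vK (vK z + 1) (x%:A + y%:A * d').
    by rewrite -zE ballE //; lia.
  have [x0|x0] := eqVneq x 0; have [y0|y0] := eqVneq y 0.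
  - by case: nz; rewrite x0 y0 !scale0r mul0r addr0; left.
  - right; exists (vF y); rewrite zE x0 scale0r add0r valM ?alg_eq0 //.
    by rewrite vKe x1k.
  - by left; exists (vF x); rewrite zE y0 scale0r mul0r addr0 vKe.
  move: bx by_ nz; rewrite !orth !ballE ?mulf_neq0 ?alg_eq0 // valM ?alg_eq0 // !vKe x1k.
  have [xz|xz] := eqVneq (vK z) (e * vF x); first by left; exists (vF x).
  have [yz|yz] := eqVneq (vK z) (e * vF y + k); first by right; exists (vF y).
  by move=> h1 h2 []; lia.
have Fpow (n : int) : exists2 s : Fv, s != 0 & vF s = n.
  by exists (uniformizer vF ^ n); [exact: pi_neq0|exact: val_pi].
have Kpow (n : int) : exists2 s : Kv, s != 0 & vK s = n.
  by exists (uniformizer vK ^ n); [exact: pi_neq0|exact: val_pi].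
have [e1|e1] := eqVneq e 1.
  have [s s0 vs] := Fpow (- k); apply: (scaled s) => //; last by left.
  by rewrite valM ?alg_eq0 // vKe vs x1k e1; lia.
have [z z0 vz] := Kpow 1; have [] := val_orth z z0; rewrite vz => -[a ha].
  by exfalso; have := e_gt0; have [a0|a0] := leP a 0; nia.
have [z2 z20 vz2] := Kpow 2.
have e2 : e = 2.
  have e1' : 1 < e by move: e_gt0 e1; lia.
  have eb b : 2 = e * b \/ 1 = e * b -> e = 2.
    by have [b0|b0] := leP b 0; [nia|have [b1|b1] := leP b 1; nia].
  have [] := val_orth z2 z20; rewrite vz2 => -[b hb]; first by apply: (eb b); left.
  by apply: (eb (b - a)); right; rewrite mulrBr; lia.
have [s s0 vs] := Fpow a; apply: (scaled s) => //; last by right.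
by rewrite valM ?alg_eq0 // vKe vs x1k e2; lia.
Qed.

Section OrthogonalBasis.
Variables (omega : Kv) (t x0 : Fv).
Hypothesis O : orth_setup vF vK e d omega t x0.
Let t_neq0 : t != 0. Proof. by case: O. Qed.
Let omega_neq0 : omega != 0. Proof. by case: O. Qed.
Let dE : d = t%:A * omega + x0%:A. Proof. by case: O. Qed.
Let v_omega : vK omega = e - 1. Proof. by case: O. Qed.
Let orth : forall n (x y : Fv), ball vK n (x%:A + y%:A * omega) <->
     ball vK n x%:A /\ ball vK n (y%:A * omega). Proof. by case: O. Qed.

(** Because [vK omega] = e - 1 < e, at radii divisible by e both coordinates obey the same
    condition. *)
Lemma ball_orth n (x y : Fv) :
  ball vK (e * n) (x%:A + y%:A * omega) <-> ball vF n x /\ ball vF n y.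
Proof.
rewrite orth ball_alg.
have -> // : ball vK (e * n) (y%:A * omega) <-> ball vF n y.
have [->|y0] := eqVneq y 0; first by rewrite scale0r mul0r; split; left.
rewrite !ballE ?mulf_neq0 ?alg_eq0 // valM ?alg_eq0 // vKe v_omega.
by split=> h; have [|] := leP n (vF y) => //; nia.
Qed.

Lemma coords_omega z : exists x y : Fv, z = x%:A + y%:A * omega.
Proof.
have [x [y ->]] := coords z.
by exists (x + y * x0), (y * t); rewrite dE algD !algM; ring.
Qed.

(** On the basis (1, omega) one sees that [bar] lowers [vK] by a bounded amount at most. Applied to
    high powers of z the bound becomes 0, and [bar] is an involution. *)
Lemma val_bar z : vK (bar z) = vK z.
Proof.
have [C C0 hC] : exists2 C, 0 <= C & forall z, z != 0 -> vK z - C <= vK (bar z).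
  have [C C0 CE] : exists2 C, 0 <= C & vK omega - C <= vK (bar omega).
    by move: (vK omega) (vK (bar omega)) => a b; exists `|a - b|; lia.
  exists C => // {}z z0.
  have bz0 : bar z != 0 by rewrite bar_eq0.
  apply/(ballE vK _ bz0); have [x [y zE]] := coords_omega z.
  have := ballnn vK z; rewrite {2}zE orth => -[bx by_].
  have -> : bar z = x%:A + y%:A * bar omega by rewrite zE rmorphD rmorphM !bar_fix.
  apply: ballD => //.
    by apply: ball_le bx; lia.
  move: by_; have [->|y0] := eqVneq y 0; first by rewrite scale0r !mul0r; left.
  rewrite !ballE ?mulf_neq0 ?alg_eq0 ?bar_eq0 // !valM ?alg_eq0 ?bar_eq0 //.
  by lia.
have le z' : z' != 0 -> vK z' <= vK (bar z').
  move=> z0; rewrite leNgt; apply/negP => lt.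
  have := hC _ (expf_neq0 (absz C).+1 z0); rewrite rmorphXn !valX //; nia.
have [->|z0] := eqVneq z 0; first by rewrite rmorph0.
apply/eqP; rewrite eq_le le // andbT -{2}(barK z).
by apply: le; rewrite bar_eq0.
Qed.

Lemma reps_quad (n m : int) (r : seq Fv) : reps (ball vF n) (ball vF m) r ->
  reps (ball vK (e * n)) (ball vK (e * m))
    [seq x%:A + y%:A * omega | y <- r, x <- r].
Proof.
move=> [rA r1]; split=> [_ /allpairsP[[y x] /= [/rA ny /rA nx ->]]|z].
  by apply/ball_orth.
have [a [b ->]] := coords_omega z; move/ball_orth => [na nb].
rewrite big_allpairs_dep -[RHS](r1 b nb); apply: eq_bigr => y _.
rewrite -[RHS]muln1 -[X in (_ = _ * X)%N](r1 a na) big_distrr; apply: eq_bigr => x _.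
rewrite /= mulnb -asbool_and; congr nat_of_bool; apply: asbool_equiv_eq.
have -> : a%:A + b%:A * omega - (x%:A + y%:A * omega) =
  (a - x)%:A + (b - y)%:A * omega by rewrite !algD !algN; ring.
by rewrite ball_orth; tauto.
Qed.

(** The integers of Kv modulo a uniformizer of Fv are counted by digits in Kv and by coordinates
    over Fv. *)
Lemma residue_card_quad : (residue_card vK ^ absz e = residue_card vF ^ 2)%N.
Proof.
have [r hr sr] := reps_ball hFv 0 1; have [s hs ss] := reps_ball hKv 0 (absz e).
have := reps_quad hr; rewrite mulr0 => hr'.
have hs' : reps (ball vK 0) (ball vK (e * (0 + 1%:Z))) s.
  by have -> : e * (0 + 1%:Z) = 0 + absz e by lia.
have := reps_sum (f := fun=> 1 : int) _ hs' hr' (fun _ _ _ _ => erefl).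
rewrite !big_const_seq !count_predT !iter_addr_0 size_allpairs ss sr expn1 -mulnn.
by move=> h; have /eqP := h (fun x => @ballN _ _ hK _ x); rewrite eqr_nat => /eqP.
Qed.

Lemma qK_e : qK ^ e = q ^+ 2.
Proof. by rewrite -natrX -residue_card_quad natrX exprnP; congr (exprz _ _); lia. Qed.

Lemma qK_pow n : qK ^ (e * n) = (q ^ n) ^+ 2.
Proof.
transitivity ((qK ^ e) ^ n); first by rewrite exprz_exp.
by rewrite qK_e [q ^+ 2]exprnP exprzAC.
Qed.

Lemma nabs_alg (x : Fv) : nabs vK x%:A = nabs vF x ^+ 2.
Proof.
rewrite /nabs alg_eq0; case: eqP => _; first by rewrite expr0n.
by rewrite vKe -mulrN qK_pow.
Qed.

Lemma sqrt_nabs_alg (x : Fv) : sqrtC (nabs vK x%:A) = nabs vF x.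
Proof.
rewrite nabs_alg sqrCK // /nabs; case: eqP => // _.
by rewrite exprz_ge0.
Qed.

Lemma schwartz_sch_quad f : schwartz vK f ->
  exists n m : int, n <= m /\ sch vK (e * n) (e * m) f.
Proof.
move=> /schwartz_sch[n [m [nm hf]]]; exists (- (`|n| + `|m|)), (`|n| + `|m|).
by split; [lia | apply: sch_le hf; nia].
Qed.

Lemma sch_slice (n m : int) f (y : Fv) : sch vK (e * n) (e * m) f ->
  sch vF n m (fun x => f (x%:A + y%:A * omega)).
Proof.
move=> [f0 fB]; split=> [x nx|x z mz]; first by apply: f0 => /ball_orth[].
by rewrite algD addrAC fB //; apply/ball_alg.
Qed.

Lemma sch_slices c (n m : int) f : sch vK (e * n) (e * m) f ->
  sch vF n m (fun y => haar vF c (fun x => f (x%:A + y%:A * omega))).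
Proof.
move=> [f0 fB]; split=> [y ny|y z mz].
  rewrite -[RHS](haar0 hFv c); congr haar; apply/funext => x.
  by apply: f0 => /ball_orth[].
congr haar; apply/funext => x; rewrite algD mulrDl addrA fB //.
have -> : z%:A * omega = (0 : Fv)%:A + z%:A * omega by rewrite scale0r add0r.
by apply/ball_orth; split=> //; left.
Qed.

Lemma fubini_omega c f : schwartz vK f ->
  haar vK c f =
    c * haar vF 1 (fun y => haar vF 1 (fun x => f (x%:A + y%:A * omega))).
Proof.
move=> /schwartz_sch_quad[n [m [nm hf]]]; have [r hr] := reps_ex hFv nm.
have nmK : e * n <= e * m by nia.
rewrite (haarE hKv c nmK (reps_quad hr) hf) (haarE hFv _ nm hr (sch_slices 1 hf)).
under [in RHS]eq_bigr => y _ do rewrite (haarE hFv _ nm hr (sch_slice y hf)).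
rewrite big_allpairs_dep -mulr_sumr !mul1r !mulrA; congr (_ * _).
by rewrite -!mulrA; congr (_ * _); rewrite -mulrN qK_pow expr2.
Qed.

(** Passing from the basis (1, omega) to (1, d) has Jacobian t; the part y x0 is a translation in
    x. *)
Lemma fubini c a : a != 0 -> forall f, schwartz vK f ->
  haar vK c f = c * q ^ (- vF t) / a ^+ 2 *
    haar vF a (fun y => haar vF a (fun x => f (x%:A + y%:A * d))).
Proof.
move=> a0 f sf; have [n [m [nm hf]]] := schwartz_sch_quad sf.
have sG y : schwartz vF (fun x => f (x%:A + y%:A * omega)).
  exact: sch_schwartz (sch_slice y hf).
pose G y := haar vF 1 (fun x => f (x%:A + y%:A * omega)).
have sG1 : schwartz vF G by exact: sch_schwartz (sch_slices 1 hf).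
have -> : (fun y => haar vF a (fun x => f (x%:A + y%:A * d))) =
    (fun y => a * G (t * y)).
  apply/funext => y; rewrite /G -haar_c // -[RHS](haar_shift hFv a (y * x0)) //.
  congr haar; apply/funext => x; congr f.
  by rewrite dE algD !algM; ring.
rewrite haarZ //; last exact: schwartz_scale.
rewrite (haar_c hFv) ?haar_scale //; last exact: schwartz_scale.
rewrite fubini_omega // -/(G _); have qt := qz_neq0 hFv (vF t).
by rewrite -invr_expz; field; rewrite a0 qt.
Qed.

(** * Nonnorm units in a ramified extension *)

Section RamifiedNorms.
Hypothesis e2 : e = 2.

(** To be read with x' = x - 1 and X = x^2 - 1: if x' has smaller valuation than 2, both factors
    have the same valuation. *)
Let even_val X x' : X = x' * (x' + 2%:R) -> X != 0 ->
  ball vF (2 * vF 2%:R) X \/ exists i, vF X = 2 * i.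
Proof.
move=> XE X0; case: (pselect (ball vF (vF 2%:R) x')) => hx.
  left; have h := ballM hF hx (ballD hF hx (ballnn vF 2%:R)).
  by rewrite XE; apply: ball_le h; ilia.
have x'0 : x' != 0 by apply/eqP => x'0; apply: hx; rewrite x'0; left.
right; exists (vF x'); rewrite XE.
have [|h1 h2] := valDl hF (x := x') (y := 2%:R) x'0.
  apply/ballE => //; rewrite lezD1 ltNge; apply/negP => h.
  by apply: hx; apply/ballE.
by rewrite valM // h2; ilia.
Qed.

(* The norm form is x^2 + s x y + n y^2 with v(n) = 1.  The values x^2 - 1 have
   even valuation below 2 v(2), and n y^2 has odd valuation, so in the critical
   degree the norms of units near 1 only fill the image of an additive
   polynomial with a nontrivial zero. *)
Lemma ramified_nonnorm : exists a : Fv,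
  [/\ a != 0, vF a = 0 & ~ exists z : Kv, z != 0 /\ a%:A = z * bar z].
Proof.
have [s sE] : exists s : Fv, omega + bar omega = s%:A.
  by apply: bar_fixed; rewrite rmorphD barK addrC.
have [n nE] : exists n : Fv, omega * bar omega = n%:A.
  by apply: bar_fixed; rewrite rmorphM barK mulrC.
have n0 : n != 0 by rewrite -(alg_eq0 Kv) -nE mulf_neq0 ?bar_eq0.
have vn : vF n = 1.
  have := vKe n; rewrite -nE valM ?bar_eq0 // val_bar v_omega e2; ilia.
have s1 : ball vF 1 s.
  have : ball vK 1 (s%:A : Kv).
    rewrite -sE; apply: ballD => //; right; rewrite ?val_bar v_omega e2; ilia.
  have [->|s0] := eqVneq s 0; first by left.
  by rewrite !ballE ?alg_eq0 // vKe e2; ilia.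
suff [a [a0 va ha]] : exists a : Fv, [/\ a != 0, vF a = 0 &
    forall x y, ball vF 0 x -> ball vF 0 y -> a <> x ^+ 2 + s * x * y + n * y ^+ 2].
  exists a; split=> // -[z [z0 az]].
  have vz : vK z = 0.
    have := vKe a; rewrite az valM ?bar_eq0 // val_bar va; ilia.
  have := ballnn vK z; rewrite vz -[0](mulr0 e).
  have [x [y zE]] := coords_omega z; rewrite {1}zE => /ball_orth[bx by_].
  apply: (ha x y) => //; apply: (@alg_inj _ Kv) => /=; rewrite az zE.
  rewrite rmorphD rmorphM !bar_fix !algD !algX !algM -sE -nE; ring.
have v2 : 0 <= vF 2%:R by apply/ballE => //; exact: ball_natr.
have pin0 k : uniformizer vF ^ k != 0 by exact: pi_neq0.
have vpi k : vF (uniformizer vF ^ k) = k by exact: val_pi.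
(* If y were too large, n y^2 would dominate s x y and T, and x^2 - 1 would have an odd valuation
   below 2 v(2). *)
have key x y T i tau : y != 0 -> vF y = i -> ball vF (2 * i + 2) (s * x * y) ->
    x ^+ 2 - 1 + (s * x * y + n * y ^+ 2) = T -> ball vF tau T -> 2 * i + 1 < tau ->
    2 * i + 1 < 2 * vF 2%:R -> False.
  move=> y0 vy bs XY bT it i2.
  have ny0 : n * y ^+ 2 != 0 by rewrite mulf_neq0 ?expf_neq0.
  have vny : vF (n * y ^+ 2) = 2 * i + 1 by rewrite valM ?expf_neq0 // valX // vn vy; ilia.
  have [|Y0 vY] := valDl hF (y := s * x * y) ny0.
    by rewrite vny; apply: ball_le bs; ilia.
  have [||X0 vX] := valDl hF (x := - (n * y ^+ 2 + s * x * y)) (y := T).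
  - by rewrite oppr_eq0.
  - by rewrite valN // vY vny; apply: ball_le bT; ilia.
  have XE : - (n * y ^+ 2 + s * x * y) + T = (x - 1) * (x - 1 + 2%:R) by rewrite -XY; ring.
  have := even_val XE X0; rewrite ballE // vX valN // vY vny => -[|[k]]; ilia.
(* If v(s) > v(2), the critical degree is 2 v(2): for x = 1 + P z one has x^2 - 1 = P^2 ((2 / P) z +
   z^2), and the terms in y are smaller. *)
case: (pselect (ball vF (vF 2%:R + 1) s)) => hs.
  set k := vF 2%:R in v2 hs key; set P := uniformizer vF ^ k.
  have P0 : P != 0 by exact: pin0.
  have vP : vF P = k by exact: vpi.
  have [|||c bc hc] := @quadratic_not_onto _ _ hFv (2%:R / P) 1 _ _ (oner_neq0 _).
  - by rewrite mulf_neq0 ?invr_eq0.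
  - by rewrite valM ?invr_eq0 // valV // vP subrr.
  - exact: val1.
  have vPP : vF (P ^+ 2) = 2 * k by rewrite valX // vP.
  have PP0 : P ^+ 2 != 0 by rewrite expf_neq0.
  have bT : ball vF (2 * k) (c * P ^+ 2).
    by rewrite [c * _]mulrC ball_mull // vPP subrr.
  exists (1 + c * P ^+ 2).
  have [a0 va] : 1 + c * P ^+ 2 != 0 /\ vF (1 + c * P ^+ 2) = 0.
    (* For k = 0 the element 1 + c is not near 1, but it is a unit: z = -1 gives the value 2 z + z^2
       = -1, which c avoids. *)
    have [k0|k0] := eqVneq k 0; last first.
      by apply: ball1_unit => //; rewrite addrC addKr; apply: ball_le bT; try (move: k0); ilia.
    have P1 : P = 1 by rewrite /P k0.
    rewrite P1 expr1n mulr1.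
    have n1 : ~ ball vF 1 (1 + c).
      have := hc (-1); rewrite P1 divr1 => h b1; apply: h.
        by right; rewrite valN // val1.
      by have -> : c - (2%:R * -1 + 1 * (-1) ^+ 2) = 1 + c by ring.
    have b0 : ball vF 0 (1 + c) by apply: ballD => //; right; rewrite val1.
    have [c0 _] := not_ball n1.
    by split=> //; move: b0 n1; rewrite !ballE //; lia.
  split=> // x y bx by_ aE.
  have XY : x ^+ 2 - 1 + (s * x * y + n * y ^+ 2) = c * P ^+ 2.
    by rewrite -[RHS](addKr 1) aE; ring.
  have yk : ball vF k y.
    apply: contrapT => nyk; have [y0 lt] := not_ball nyk.
    apply: (key x y _ _ _ y0 erefl _ XY bT); [|ilia|ilia].
    by apply: ball_le (ballM hF (ballM hF hs bx) (ballnn vF y)); ilia.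
  have bY : ball vF (2 * k + 1) (s * x * y + n * y ^+ 2).
    apply: ballD => //; first by apply: ball_le (ballM hF (ballM hF hs bx) yk); ilia.
    by rewrite expr2; apply: ball_le (ballM hF (ballnn vF n) (ballM hF yk yk)); ilia.
  have XE : x ^+ 2 - 1 = (x - 1) * (x - 1 + 2%:R) by ring.
  have bX : ball vF (2 * k) (x ^+ 2 - 1).
    rewrite -(addrK (s * x * y + n * y ^+ 2) (x ^+ 2 - 1)) XY.
    by apply: ballB => //; apply: ball_le bY; ilia.
  have xk : ball vF k (x - 1).
    apply: contrapT => nxk; have [x1 lt] := not_ball nxk.
    have [|h1 h2] := valDl hF (y := 2%:R) x1; first by apply/ballE => //; ilia.
    by move: bX; rewrite XE ballE ?mulf_neq0 // valM // h2; ilia.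
  apply: (hc ((x - 1) / P)).
    by rewrite mulrC ball_mull ?invr_eq0 // valV // vP opprK add0r.
  have -> : c - (2%:R / P * ((x - 1) / P) + 1 * ((x - 1) / P) ^+ 2) =
      (P ^+ 2)^-1 * (s * x * y + n * y ^+ 2).
    have -> : c = (P ^+ 2)^-1 * (c * P ^+ 2) by field.
    by rewrite -XY XE; field.
  by rewrite ball_mull ?invr_eq0 // valV // vPP; apply: ball_le bY; ilia.
have [s0 _] := not_ball hs.
(* Now 1 <= j <= v(2) and the critical degree is 2 j - 1: for y = P z the terms s y and n y^2 both
   have it when z is a unit, while x^2 - 1, having even valuation, is smaller. *)
set j := vF s; have j1 : 1 <= j by move: s1; rewrite ballE.
have j2 : j <= vF 2%:R.
  by move: hs; rewrite ballE // /j => hs; rewrite leNgt; apply/negP => h; apply: hs; ilia.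
set P := uniformizer vF ^ (j - 1); set p := uniformizer vF.
have p0 : p != 0 by exact: (pin0 1).
have vp : vF p = 1 by exact: (vpi 1).
have P0 : P != 0 by exact: pin0.
have vP : vF P = j - 1 by exact: vpi.
have [||||c bc hc] := @quadratic_not_onto _ _ hFv (s / (P * p)) (n / p).
- by rewrite mulf_neq0 ?invr_eq0 ?mulf_neq0.
- by rewrite valM ?invr_eq0 ?mulf_neq0 // valV // valM // vP vp /j; ilia.
- by rewrite mulf_neq0 ?invr_eq0.
- by rewrite valM ?invr_eq0 // valV // vn vp.
have PP0 : P ^+ 2 * p != 0 by rewrite mulf_neq0 ?expf_neq0.
have vPP : vF (P ^+ 2 * p) = 2 * j - 1.
  by rewrite valM ?expf_neq0 // valX // vP vp; ilia.
have bT : ball vF (2 * j - 1) (c * (P ^+ 2 * p)).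
  by rewrite [c * _]mulrC ball_mull // vPP subrr.
exists (1 + c * (P ^+ 2 * p)).
have [a0 va] : 1 + c * (P ^+ 2 * p) != 0 /\ vF (1 + c * (P ^+ 2 * p)) = 0.
  by apply: ball1_unit => //; rewrite addrC addKr; apply: ball_le bT; try (move: k0); ilia.
split=> // x y bx by_ aE.
have XY : x ^+ 2 - 1 + (s * x * y + n * y ^+ 2) = c * (P ^+ 2 * p).
  by rewrite -[RHS](addKr 1) aE; ring.
have yk : ball vF (j - 1) y.
  apply: contrapT => nyk; have [y0 lt] := not_ball nyk.
  apply: (key x y _ _ _ y0 erefl _ XY bT); [|ilia|ilia].
  by apply: ball_le (ballM hF (ballM hF (ballnn vF s) bx) (ballnn vF y)); ilia.
have bY : ball vF (2 * j - 1) (s * x * y + n * y ^+ 2).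
  apply: ballD => //.
    by apply: ball_le (ballM hF (ballM hF (ballnn vF s) bx) yk); ilia.
  by rewrite expr2; apply: ball_le (ballM hF (ballnn vF n) (ballM hF yk yk)); ilia.
have XE : x ^+ 2 - 1 = (x - 1) * (x - 1 + 2%:R) by ring.
have bX : ball vF (2 * j) (x ^+ 2 - 1).
  have bX' : ball vF (2 * j - 1) (x ^+ 2 - 1).
    by rewrite -(addrK (s * x * y + n * y ^+ 2) (x ^+ 2 - 1)) XY; apply: ballB.
  have [->|X0] := eqVneq (x ^+ 2 - 1) 0; first by left.
  have [h|[i hi]] := even_val XE X0; first by apply: ball_le h; ilia.
  by move: bX'; rewrite !ballE // hi; ilia.
have xk : ball vF 1 (x - 1).
  apply: contrapT => nxk; have [x1 lt] := not_ball nxk.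
  have [|h1 h2] := valDl hF (y := 2%:R) x1; first by apply/ballE => //; ilia.
  by move: bX; rewrite XE ballE ?mulf_neq0 // valM // h2; ilia.
have b0 : ball vF 0 (y / P).
  by rewrite mulrC ball_mull ?invr_eq0 // valV // vP opprK add0r.
apply: (hc (y / P)) => //.
have -> : c - (s / (P * p) * (y / P) + n / p * (y / P) ^+ 2) =
    (P ^+ 2 * p)^-1 * (x ^+ 2 - 1) + s / (P * p) * ((x - 1) * (y / P)).
  have -> : c = (P ^+ 2 * p)^-1 * (c * (P ^+ 2 * p)) by field; rewrite P0 p0.
  by rewrite -XY; field; rewrite P0 p0.
apply: ballD => //.
  by rewrite ball_mull ?invr_eq0 // valV // vPP; apply: ball_le bX; ilia.
rewrite ball_mull ?mulf_neq0 ?invr_eq0 ?mulf_neq0 //.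
rewrite valM ?invr_eq0 ?mulf_neq0 // valV // valM // vP vp.
by apply: ball_le (ballM hF xk b0); rewrite /j; ilia.
Qed.

End RamifiedNorms.
End OrthogonalBasis.
End QuadraticExtension.

(** * Residue characteristic different from p *)

Section ResidueCardinal.
Variables (L : fieldType) (w : L -> int).
Hypothesis hL : local_field w.
Let hw : finite_place w. Proof. by case: hL. Qed.

(* Cauchy's theorem, applied to the translations of the residue field. *)
Lemma residue_card_coprime p : prime p -> p%:R != 0 :> L -> w p%:R = 0 ->
  coprime p (residue_card w).
Proof.
move=> pp p0 wp; rewrite prime_coprime //; apply/negP => pq.
have [r hr sr] := reps_ball hL 0 1; rewrite expn1 add0r in hr sr.
have [rA _] := hr; pose T := 'I_(size r).
pose rep (i : T) := nth 0 r i.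
have repA i : ball w 0 (rep i) by apply: rA; apply: mem_nth.
have /choice[cls clsP] : forall x, exists i : T, ball w 0 x -> ball w 1 (x - rep i).
  have r_gt0 : (0 < size r)%N by have [x] := reps_mem hr (@ball0 _ w 0); case: (r).
  move=> x; case: (pselect (ball w 0 x)) => hx; last by exists (Ordinal r_gt0).
  have [y yr xy] := reps_mem hr hx.
  have iy : (index y r < size r)%N by rewrite index_mem.
  by exists (Ordinal iy) => _; rewrite /rep nth_index.
have cls_eq x i : ball w 0 x -> ball w 1 (x - rep i) -> cls x = i.
  move=> hx xi; apply/val_inj/eqP.
  rewrite -(nth_uniq 0 (ltn_ord (cls x)) (ltn_ord i) (reps_uniq (@ball0 _ w 1) hr)).
  apply/eqP; apply: (reps_inj (@ball0 _ w 1) hr); try exact: mem_nth.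
  have -> : nth 0 r (cls x) - nth 0 r i = (x - rep i) - (x - rep (cls x)).
    by rewrite /rep; ring.
  by apply: ballB => //; apply: clsP.
have b0D i j : ball w 0 (rep i + rep j) by exact: ballD.
have cls_inj i : injective (fun j : T => cls (rep j + rep i)).
  move=> j k e; rewrite -(cls_eq (rep j) k) //.
    by apply/esym/cls_eq => //; rewrite subrr; left.
  have -> : rep j - rep k = (rep j + rep i - rep (cls (rep j + rep i))) -
     (rep k + rep i - rep (cls (rep k + rep i))) by rewrite e; ring.
  by apply: ballB => //; exact: clsP.
pose P i := perm (@cls_inj i).
have PE i j : ball w 1 (rep j + rep i - rep (P i j)) by rewrite permE; exact: clsP.
have P_eq x i j : P i = P j -> ball w 0 x -> ball w 1 (x - rep i) -> ball w 1 (x - rep j).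
  move=> e hx xi; have := PE i i; have := PE j i; rewrite e => hj hi.
  have -> : x - rep j = x - rep i + ((rep i + rep i - rep (P j i)) -
    (rep i + rep j - rep (P j i))) by ring.
  by apply: ballD => //; apply: ballB.
have PM i j : (P i * P j)%g = P (cls (rep i + rep j)).
  apply/perm.permP => k; rewrite permM !permE; apply: cls_eq => //.
  have -> : rep (cls (rep k + rep i)) + rep j - rep (cls (rep k + rep (cls (rep i + rep j))))
    = (rep k + rep (cls (rep i + rep j)) - rep (cls (rep k + rep (cls (rep i + rep j)))))
      - (rep k + rep i - rep (cls (rep k + rep i)))
      + (rep i + rep j - rep (cls (rep i + rep j))) by ring.
  by apply: ballD => //; [apply: ballB => //|]; exact: clsP.
pose G := imset P (mem (@predT T)).
have cls0 : ball w 1 (rep (cls 0)).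
  by have := ballN hw (clsP 0 (@ball0 _ w 0)); rewrite opprB subr0.
have P1 : P (cls 0) = 1%g.
  apply/perm.permP => k; rewrite permE perm1; apply: cls_eq => //.
  by rewrite addrAC subrr add0r.
have gG : group_set G.
  apply/group_setP; split; first by rewrite -P1 imset_f.
  by move=> _ _ /imsetP[i _ ->] /imsetP[j _ ->]; rewrite PM imset_f.
have [|x xG ox] := @pgroup.Cauchy _ p (fingroup.Group gG) pp.
  rewrite /= card_in_imset ?card_ord ?sr // => i j _ _ e.
  rewrite -(cls_eq (rep i) i) //; last by rewrite subrr; left.
  by apply: cls_eq => //; apply: (P_eq _ _ _ e) => //; rewrite subrr; left.
have /imsetP[i _ xE] := xG.
have xX k : exists j, (x ^+ k)%g = P j /\ ball w 1 (rep i *+ k - rep j).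
  elim: k => [|k [j [IHk bk]]].
    by exists (cls 0); rewrite expg0 P1; split=> //; apply/clsP/ball0.
  exists (cls (rep j + rep i)); rewrite expgSr IHk xE PM; split=> //.
  have -> : rep i *+ k.+1 - rep (cls (rep j + rep i)) =
    (rep i *+ k - rep j) + (rep j + rep i - rep (cls (rep j + rep i))).
    by rewrite mulrSr; ring.
  by apply: ballD => //; exact: clsP.
have [j [xp bj]] := xX p.
have bin k : ball w 0 (rep i *+ k).
  by rewrite -mulr_natl; have := ballM hw (ball_natr hw k) (repA i); rewrite add0r.
have bp : ball w 1 (rep i *+ p).
  have e : P j = P (cls 0) by rewrite -xp P1 -ox expg_order.
  have h := P_eq _ _ _ e (bin p) bj.
  by rewrite -(subrK (rep (cls 0)) (rep i *+ p)); apply: ballD.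
(* A translation of order p comes from a class killed by p, and p is a unit. *)
have bi : ball w 1 (rep i) by move: bp; rewrite -mulr_natl ball_mull // wp subr0.
have x1 : x = 1%g.
  rewrite xE -P1; congr P; rewrite -(cls_eq (rep i) i) //; last by rewrite subrr; left.
  by apply: cls_eq => //; apply: ballB.
by move: ox pp; rewrite x1 order1 => <-.
Qed.

End ResidueCardinal.

(* [d] will be [1 / (4 theta)]: then [A_beta] is a Fourier coefficient of
   [lam^-1] along the line [Fv + d]. *)
Record residual_setup (p : nat) (R : realType) (Cp : closedFieldType)
  (ord : Cp -> \bar R) (iota_p : {rmorphism algC -> Cp}) (Fv : fieldType)
  (vF : Fv -> int) (Kv : fieldExtType Fv) (vK : Kv -> int)
  (bar : {rmorphism Kv -> Kv}) (e : int) (d omega : Kv) (t x0 : Fv)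
  (lam : Kv -> algC) (psi : Fv -> algC) (cF cK : algC) (m : int) : Prop := {
  res_prime : prime p;
  res_odd : odd p;
  res_padic : is_padic_complex p ord;
  res_quad : quad_setup vF vK bar e d;
  res_orth : orth_setup vF vK e d omega t x0;
  res_p_neq0 : p%:R != 0 :> Fv;
  res_p_unit : vF p%:R = 0;
  res_lam : quasicharacter vK lam;
  res_psi : nontrivial_additive_character vF psi;
  res_conductor : conductor vF psi m;
  res_dualF : self_dual vF psi cF;
  res_dualK : self_dual vK (psi_ext bar psi) cK;
  res_self_dual : forall x : Fv, x != 0 ->
    congr_p ord iota_p (star vK lam x%:A) (quad_char bar x) }.

Section PadicHaar.
Variables (R : realType) (p : nat) (Cp : closedFieldType) (ord : Cp -> \bar R).
Hypothesis hCp : is_padic_complex p ord.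
Variable iota_p : {rmorphism algC -> Cp}.
Local Notation ov := (ordp ord iota_p).
Local Notation cong := (congr_p ord iota_p).
Variables (L : fieldType) (w : L -> int) (c : algC).
Hypotheses (hL : local_field w) (ov_q : ov (residue_card w)%:R = 0%E)
  (ov_c : (0 <= ov c)%E).

Let scale_int k : (0 <= ov (c * (residue_card w)%:R ^ k)%R)%E.
Proof. by rewrite mulrC (ov_unitM hCp) // (ov_unitXz hCp). Qed.

Lemma ov_haar M f : schwartz w f -> (forall x, (M <= ov (f x))%E) ->
  (M <= ov (haar w c f))%E.
Proof.
move=> sf hf; have [k [r ->]] := haar_ex hL c sf.
by apply: (ov_geM hCp) => //; apply: (ov_sum hCp).
Qed.

Lemma ov_haar_gt M f : (M < +oo)%E -> schwartz w f -> (forall x, (M < ov (f x))%E) ->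
  (M < ov (haar w c f))%E.
Proof.
move=> Moo sf hf; have [k [r ->]] := haar_ex hL c sf.
by apply: (ov_gtM hCp) => //; apply: (ov_sum_gt hCp).
Qed.

Lemma cong_haar f g : schwartz w f -> schwartz w g -> (forall x, cong (f x) (g x)) ->
  cong (haar w c f) (haar w c g).
Proof.
move=> sf sg fg; rewrite /congr_p -haarB //; apply: ov_haar_gt => //.
apply: schwartzD => //; have -> : (fun x => - g x) = (fun x => (-1) * g x).
  by apply/funext => x; rewrite mulN1r.
exact: schwartzZ.
Qed.

End PadicHaar.

Section QuasiCharacters.
Variables (L : fieldType) (w : L -> int) (lam : L -> algC).
Hypothesis hlam : quasicharacter w lam.

Lemma lam_neq0 x : x != 0 -> lam x != 0. Proof. by case: hlam => h _ _; exact: h. Qed.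
Lemma lamM x y : x != 0 -> y != 0 -> lam (x * y) = lam x * lam y.
Proof. by case: hlam => _ h _; exact: h. Qed.
Lemma lam1 : lam 1 = 1.
Proof.
have n1 := oner_neq0 L; have := lamM n1 n1; rewrite mulr1.
by move=> h; apply: (mulfI (lam_neq0 n1)); rewrite -h mulr1.
Qed.
Lemma lamV x : x != 0 -> lam x^-1 = (lam x)^-1.
Proof.
move=> x0; apply: (mulfI (lam_neq0 x0)).
by rewrite -lamM ?invr_eq0 // !divff ?lam_neq0 // lam1.
Qed.
Lemma lamX x n : x != 0 -> lam (x ^+ n) = lam x ^+ n.
Proof.
move=> x0'; elim: n => [|n IHn]; first by rewrite !expr0 lam1.
by rewrite !exprS lamM ?expf_neq0 // IHn.
Qed.
Lemma lamXz x (n : int) : x != 0 -> lam (x ^ n) = lam x ^ n.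
Proof.
move=> x0'; case: n => n; first exact: lamX.
by rewrite NegzE -!exprnN lamV ?expf_neq0 // lamX.
Qed.

End QuasiCharacters.

(** * Subgroups on which a character congruent to 1 is trivial *)

Section ResiduallyTrivial.
Variables (R : realType) (p : nat) (Cp : closedFieldType) (ord : Cp -> \bar R).
Hypothesis hCp : is_padic_complex p ord.
Variable iota_p : {rmorphism algC -> Cp}.
Local Notation ov := (ordp ord iota_p).
Local Notation cong := (congr_p ord iota_p).
Variables (L : fieldType) (w : L -> int) (lam : L -> algC).
Hypotheses (hL : local_field w) (ov_q : ov (residue_card w)%:R = 0%E)
  (hlam : quasicharacter w lam).
Hypothesis lam_cong1 : forall z, z != 0 -> cong (lam z) 1.
Let hw : finite_place w. Proof. by case: hL. Qed.
Local Notation q := ((residue_card w)%:R : algC).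

(* Averaging over a compact open subgroup whose measure is a p-adic unit. *)
Let averaging f u : schwartz w f -> (forall x, ball w 1 x -> f x = 0) ->
  (forall x, f x = 0 \/ f x = 1) -> ov (haar w 1 f) = 0%E ->
  u != 0 -> w u = 0 -> (forall x, f (u * x) = f x) -> lam u = 1.
Proof.
move=> sf f0 f01 hf u0 wu fu; apply/eqP/negPn/negP => lu.
have [k k0 hk] := quasi_mulinv hL hlam.
have sfl := schwartz_annulus hL k0 sf f0 hk.
have h0 : haar w 1 (fun x => f x * lam x) = 0.
  apply: (haar_mtwist0 hL 1 sfl u0 wu lu) => x; rewrite fu.
  have [->|x0] := eqVneq x 0; first by rewrite f0 ?mul0r ?mulr0 //; left.
  by rewrite (lamM hlam) //; ring.
have : cong (haar w 1 (fun x => f x * lam x)) (haar w 1 f).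
  apply: (cong_haar hCp hL ov_q) => //; first by rewrite (ov1 hCp).
  move=> x; have [->|x0] := eqVneq x 0.
    by rewrite f0 ?mul0r; [exact: (cong_refl hCp)|left].
  case: (f01 x) => ->; rewrite ?mul0r ?mul1r; first exact: (cong_refl hCp).
  exact: lam_cong1.
by rewrite h0 /congr_p sub0r (ovN hCp) hf ltxx.
Qed.

(** The subgroup is the ball of radius 1 around 1, whose measure 1/q is a p-adic unit. *)
Lemma lam_tame u : ball w 1 (u - 1) -> lam u = 1.
Proof.
move=> bu; have [u0 wu] := ball1_unit hw bu.
apply: (averaging (f := fun x => ind (ball w 1) (x - 1))) => //.
- by apply: (schwartz_shift hL (-1)); exact: schwartz_ball.
- move=> x bx; apply: ind0 => bx1; have := ballB hw bx bx1.
  by rewrite subKr ballE ?oner_neq0 // val1.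
- by move=> x; rewrite /ind; case: asboolP; [right|left].
- rewrite (haar_shift hL 1 (-1)) ?haar_ball //; last exact: schwartz_ball.
  by rewrite mul1r; apply: (ov_unitXz hCp).
move=> x; apply: ind_equiv.
have -> : u * x - 1 = u * (x - 1) + (u - 1) by ring.
by rewrite (ballDr hw _ bu) ball_mull // wu subr0.
Qed.

(** The subgroup of all units has measure 1 - 1/q. For Fv this is congruent to 2 once q is congruent
    to -1; for Kv, with residue cardinality q^2, it is not a unit, which leaves room for a ramified
    [lam]. *)
Lemma lam_units : ov (1 - q^-1) = 0%E -> forall u, u != 0 -> w u = 0 -> lam u = 1.
Proof.
move=> q1 u u0 wu.
have s0 := schwartz_ball hL 0; have s1 := schwartz_ball hL 1.
apply: (averaging (f := fun x => ind (ball w 0) x - ind (ball w 1) x)) => //.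
- have -> : (fun x => ind (ball w 0) x - ind (ball w 1) x) =
    (fun x => ind (ball w 0) x + (-1) * ind (ball w 1) x).
    by apply/funext => x; rewrite mulN1r.
  by apply: schwartzD => //; apply: schwartzZ.
- by move=> x bx; rewrite !ind1 ?subrr //; apply: ball_le bx.
- move=> x; case: (pselect (ball w 1 x)) => b1.
    by rewrite !ind1 ?subrr; [left| |apply: ball_le b1].
  by rewrite (ind0 b1) subr0 /ind; case: asboolP; [right|left].
- by rewrite haarB // !haar_ball // !mul1r oppr0 expr0z.
by move=> x; congr (_ - _); apply: ind_equiv; rewrite ball_mull // wu subr0.
Qed.

End ResiduallyTrivial.

Section Shells.
Variables (L : fieldType) (w : L -> int).
Hypothesis hL : local_field w.
Let hw : finite_place w. Proof. by case: hL. Qed.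
Local Notation q := ((residue_card w)%:R : algC).

Definition shell n (x : L) : algC := ind (ball w n) x - ind (ball w (n + 1)) x.

Lemma shellT n x : x != 0 -> w x = n -> shell n x = 1.
Proof.
move=> x0 wx; rewrite /shell ind1 ?ind0 ?subr0 //; last by right; rewrite wx.
by rewrite ballE // wx; lia.
Qed.

Lemma shellF n x : (x = 0 \/ w x <> n) -> shell n x = 0.
Proof.
move=> h; rewrite /shell; case: (pselect (ball w (n + 1) x)) => b1.
  by rewrite !ind1 ?subrr //; apply: ball_le b1; lia.
rewrite (ind0 b1) subr0 ind0 // => b0; have [x0 _] := not_ball b1.
case: h => [x00|]; first by rewrite x00 eqxx in x0.
by move: b0 b1; rewrite !ballE //; lia.
Qed.

Lemma shellP n x : (x != 0 /\ w x = n /\ shell n x = 1) \/ shell n x = 0.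
Proof.
case: (eqVneq x 0) => [x0|x0]; first by right; apply: shellF; left.
case: (eqVneq (w x) n) => [wx|/eqP wx]; last by right; apply: shellF; right.
by left; rewrite shellT.
Qed.

Lemma shell_mul n u x : u != 0 -> w u = 0 -> shell n (u * x) = shell n x.
Proof.
by move=> u0 wu; congr (_ - _); apply: ind_equiv; rewrite ball_mull // wu subr0.
Qed.

Lemma schwartz_shell n : schwartz w (shell n).
Proof.
have -> : shell n = (fun x => ind (ball w n) x + (-1) * ind (ball w (n + 1)) x).
  by apply/funext => x; rewrite mulN1r.
apply: schwartzD => //; first exact: schwartz_ball.
by apply: schwartzZ => //; exact: schwartz_ball.
Qed.

Lemma schwartz_shell_mul n k g : 0 < k -> mulinv w k g ->
  schwartz w (fun x => shell n x * g x).
Proof.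
move=> k0 hg; apply: (schwartz_annulus hL (b := n + 1) k0 (schwartz_shell n) _ hg) => x bx.
by rewrite /shell !ind1 ?subrr //; apply: ball_le bx; lia.
Qed.

Lemma haar_shell c n : haar w c (shell n) = c * q ^ (- n) * (1 - q^-1).
Proof.
rewrite /shell haarB // ?haar_ball //; try exact: schwartz_ball.
by rewrite opprD expfzDr ?q_neq0 // -[q ^ (-1)]/(q^-1); ring.
Qed.

Lemma shell_integralE c chi f n : shell_integral w c chi f n =
  q ^ n * haar w c (fun x => shell n x * (f x * chi x)).
Proof.
congr (_ * haar _ _ _); apply/funext => x; case: ifP => [/andP[x0 /eqP wx]|].
  by rewrite shellT // mul1r.
move/negbT; rewrite negb_and negbK => h; rewrite shellF ?mul0r //.
by case/orP: h => /eqP; [left|right].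
Qed.

End Shells.

Lemma seq_argmin (R : realType) (T : eqType) (F : T -> \bar R) (r : seq T) x :
  x \in r -> exists2 y, y \in r & forall z, z \in r -> (F y <= F z)%E.
Proof.
elim: r x => // a r IHr x _; case: r IHr => [|b r] IHr.
  by exists a; rewrite ?inE // => z; rewrite inE => /eqP ->.
have [y yr ymin] := IHr b (mem_head _ _).
have [ay|ya] := leP (F a) (F y).
  exists a; rewrite ?mem_head // => z; rewrite inE => /orP[/eqP -> //|/ymin].
  exact: le_trans.
exists y; first by rewrite inE yr orbT.
by move=> z; rewrite inE => /orP[/eqP ->|/ymin //]; exact: ltW.
Qed.

(** * Residually self-dual characters *)

Section Residual.
Variables (p : nat) (R : realType) (Cp : closedFieldType) (ord : Cp -> \bar R)
  (iota_p : {rmorphism algC -> Cp}) (Fv : fieldType) (vF : Fv -> int)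
  (Kv : fieldExtType Fv) (vK : Kv -> int) (bar : {rmorphism Kv -> Kv}) (e : int)
  (d omega : Kv) (t x0 : Fv) (lam : Kv -> algC) (psi : Fv -> algC) (cF cK : algC)
  (m : int).
Hypothesis S : residual_setup p ord iota_p vF vK bar e d omega t x0 lam psi cF cK m.
Let pp : prime p. Proof. by case: S. Qed.
Let podd : odd p. Proof. by case: S. Qed.
Let hCp : is_padic_complex p ord. Proof. by case: S. Qed.
Let H : quad_setup vF vK bar e d. Proof. by case: S. Qed.
Let O : orth_setup vF vK e d omega t x0. Proof. by case: S. Qed.
Let hFv : local_field vF. Proof. by case: H. Qed.
Let hKv : local_field vK. Proof. by case: H. Qed.
Let hF : finite_place vF. Proof. by case: hFv. Qed.
Let hK : finite_place vK. Proof. by case: hKv. Qed.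
Let e_gt0 : 0 < e. Proof. by case: H. Qed.
Let vKe (x : Fv) : vK x%:A = e * vF x. Proof. by case: H. Qed.
Let d_neq0 : d != 0. Proof. by case: H. Qed.
Let two_neq0 : 2%:R != 0 :> Fv. Proof. by case: H. Qed.
Let hlam : quasicharacter vK lam. Proof. by case: S. Qed.
Let hpsi : nontrivial_additive_character vF psi. Proof. by case: S. Qed.
Let hm : conductor vF psi m. Proof. by case: S. Qed.
Local Notation q := ((residue_card vF)%:R : algC).
Local Notation qK := ((residue_card vK)%:R : algC).
Local Notation ov := (ordp ord iota_p).
Local Notation cong := (congr_p ord iota_p).
Local Notation tau := (quad_char bar).
Local Notation lams := (star vK lam).

Lemma coprime_q : coprime p (residue_card vF).
Proof. exact (residue_card_coprime hFv pp (res_p_neq0 S) (res_p_unit S)). Qed.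

Lemma ov_q : ov q = 0%E.
Proof. apply: (ov_nat_coprime pp hCp); exact: coprime_q. Qed.

Lemma ov_qK : ov qK = 0%E.
Proof.
apply: (@ov_root_unit _ _ _ _ hCp _ _ (absz e)); first by move: e_gt0; clear; lia.
rewrite -natrX (residue_card_quad H O) natrX; apply: (ov_unitX hCp) => //; exact: ov_q.
Qed.

Lemma nabsF_neq0 (x : Fv) : x != 0 -> nabs vF x != 0.
Proof. by move=> x0'; rewrite gt_eqF // nabs_gt0. Qed.

Lemma nabsK_neq0 z : z != 0 -> nabs vK z != 0.
Proof. by move=> x0'; rewrite gt_eqF // nabs_gt0. Qed.

Lemma sqrtK_neq0 z : z != 0 -> sqrtC (nabs vK z) != 0.
Proof. by move=> z0; rewrite sqrtC_eq0 nabsK_neq0. Qed.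

Lemma ov_nabsF (x : Fv) : x != 0 -> ov (nabs vF x) = 0%E.
Proof. by move=> x0'; rewrite /nabs (negPf x0'); apply: (ov_unitXz hCp) => //; exact: ov_q. Qed.

Lemma tau_sign x : tau x = 1 \/ tau x = -1.
Proof. by rewrite /quad_char; case: asboolP; [left|right]. Qed.

Lemma ov_tau x : ov (tau x) = 0%E.
Proof. by apply: (ov_sqr1 hCp) => //; case: (tau_sign x) => ->; rewrite ?sqrrN expr1n. Qed.

Lemma starE (x : Fv) : lams x%:A = lam x%:A / nabs vF x.
Proof. by rewrite /star (sqrt_nabs_alg H O). Qed.

Lemma lamF (x : Fv) : x != 0 -> cong (lam x%:A) (tau x * nabs vF x).
Proof.
move=> x0'; have h := res_self_dual S x0'; rewrite starE in h.
have -> : lam x%:A = nabs vF x * (lam x%:A / nabs vF x).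
  by rewrite mulrCA divff ?mulr1 // nabsF_neq0.
by rewrite [tau x * _]mulrC; apply: (congMl hCp) => //; rewrite ov_nabsF.
Qed.

Lemma tau_cong (x : Fv) : x != 0 -> cong (lams x%:A) (tau x).
Proof. exact: (res_self_dual S). Qed.

Lemma ov_lamF (x : Fv) : x != 0 -> ov (lam x%:A) = 0%E.
Proof.
move=> x0'; apply: (cong_unit hCp (lamF x0')).
by rewrite (ov_unitM hCp) ?ov_tau // ov_nabsF.
Qed.

Lemma lam_unit_root u : u != 0 -> vK u = 0 -> exists2 k, (0 < k)%N & lam u ^+ k = 1.
Proof.
move=> u0 vu; case: hlam => _ _ [n n0 hn].
have [k k0 hk] := unit_pow_near1 hKv u0 vu (ltW n0).
by exists k => //; rewrite -(lamX hlam) // hn.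
Qed.

(** z^e is a scalar times a unit of Kv: self-duality controls [lam] on scalars, and on units its
    values are roots of unity. *)
Lemma ov_lam z : z != 0 -> ov (lam z) = 0%E.
Proof.
move=> z0; have z_neq0 := z0.
apply: (@ov_root_unit _ _ _ _ hCp _ _ (absz e)); first by move: e_gt0; clear; lia.
set x := uniformizer vF ^ vK z; have x0' : x != 0 by exact: pi_neq0.
have xA0 : x%:A != 0 :> Kv by rewrite alg_eq0.
pose u := z ^+ absz e / x%:A.
have u0 : u != 0 by rewrite mulf_neq0 ?invr_eq0 ?expf_neq0.
have vu : vK u = 0.
  rewrite valM ?expf_neq0 ?invr_eq0 // valV // valX // vKe val_pi //.
  by move: (vK z) e_gt0; clear; lia.
have [k k0 uk] := lam_unit_root u0 vu.
have -> : lam z ^+ absz e = lam x%:A * lam u.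
  rewrite -(lamX hlam) // -(lamM hlam) // /u mulrCA divff ?mulr1 //.
rewrite (ov_unitM hCp) ?ov_lamF //; apply: (@ov_root_unit _ _ _ _ hCp _ _ k) => //.
by rewrite uk (ov1 hCp).
Qed.

Lemma norm_ex z : z != 0 -> exists n : Fv,
  [/\ n != 0, z * bar z = n%:A & nabs vF n = nabs vK z].
Proof.
move=> z0; have [|n nE] := bar_fixed H (z := z * bar z).
  by rewrite rmorphM (barK H) mulrC.
have n0 : n != 0 by rewrite -(alg_eq0 Kv) -nE mulf_neq0 ?bar_eq0.
exists n; split=> //; rewrite -(sqrt_nabs_alg H O) -nE.
rewrite /nabs mulf_eq0 bar_eq0 orbb (negPf z0) valM ?bar_eq0 // (val_bar H O).
rewrite opprD expfzDr ?q_neq0 // -expr2 sqrCK //.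
by rewrite exprz_ge0.
Qed.

(** This is self-duality at the norm z * bar z, where [quad_char] is 1. *)
Lemma lam_bar z : z != 0 -> cong (lam z / nabs vK z) (lam (bar z))^-1.
Proof.
move=> z0; have [n [n0 nE nabsE]] := norm_ex z0.
have bz0 : bar z != 0 by rewrite bar_eq0.
have -> : lam z / nabs vK z = (lam (bar z))^-1 * (lam n%:A / nabs vF n).
  by rewrite -nE (lamM hlam) // -nabsE; field; rewrite nabsF_neq0 ?(lam_neq0 hlam).
rewrite -[X in cong _ X]mulr1; apply: (congMl hCp) => //; first by rewrite (ov_unitV hCp) ?ov_lam.
rewrite -starE; have <- : tau n = 1; last exact: tau_cong.
by rewrite /quad_char; case: asboolP => // -[]; exists z.
Qed.

Lemma xd_neq0 (x : Fv) : x%:A + d != 0. Proof. exact: d_notin H x. Qed.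

(** The line Fv + d stays away from 0, so the relative precision of [lam] becomes uniform along
    it. *)
Lemma lam_near : exists2 k : int, 0 <= k &
  forall (x : Fv) z, ball vK k z -> lam (x%:A + d + z) = lam (x%:A + d).
Proof.
have [C hC] := dist_bounded H; have [k k0 hk] := quasi_mulinv hKv hlam.
have [K K0 CK] : exists2 K : int, 0 <= K & C + k <= K by exists `|C + k|; lia.
exists K => // x z bz; apply: (mulinvE hKv hk); first exact: xd_neq0.
by apply: ball_le bz; have := hC x; lia.
Qed.

Lemma lam_far : exists N0 : nat, forall x : Fv, x != 0 -> vF x < - N0%:Z ->
  [/\ vK (x%:A + d) = vK x%:A & lam (x%:A + d) = lam x%:A].
Proof.
have [k k0 hk] := quasi_mulinv hKv hlam.
exists (absz (vK d) + absz k)%N => x x0' vx.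
have vxd : vK x%:A + k <= vK d.
  by rewrite vKe; have := e_gt0; nia.
have xA0 : x%:A != 0 :> Kv by rewrite alg_eq0.
have bd j : j <= k -> ball vK (vK x%:A + j) d by move=> jk; apply: ball_val => //; lia.
split; last by apply: (mulinvE hKv hk) => //; exact: bd.
by have [|_ ->] := valDl hK (y := d) xA0; first by apply: bd; lia.
Qed.

Lemma lam_far_shift : exists (N0 : nat) (k : int), 0 < k /\
  forall x y : Fv, x != 0 -> vF x < - N0%:Z -> ball vF (vF x + k) y ->
  lam ((x + y)%:A + d) = lam (x%:A + d).
Proof.
have [N0 hN0] := lam_far; have [k k0 hk] := quasi_mulinv hKv hlam.
exists N0, k; split=> // x y x0' vx by_.
rewrite algD addrAC; apply: (mulinvE hKv hk); first exact: xd_neq0.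
have [-> _] := hN0 x x0' vx; rewrite vKe.
have : ball vK (e * (vF x + k)) (y%:A : Kv) by apply/(ball_alg H).
by apply: ball_le; have := e_gt0; nia.
Qed.

(* The integrand of A_beta: the factors |.|^(1/2) in [star] and in [A_coef] cancel. *)
Definition trunc (n : int) (x : Fv) : algC :=
  ind (ball vF (- n)) x * (lam (x%:A + d))^-1.

Lemma schwartz_trunc (n : int) : schwartz vF (trunc n).
Proof.
have [k k0 hk] := lam_near.
have nk : - n <= `|k| + `|n| by lia.
apply: (@sch_schwartz _ _ (- n) (`|k| + `|n|)); apply: sch_mul => //; first exact: sch_ball.
move=> x y _ ky; rewrite algD addrAC hk //.
by have /(ball_alg H) := ky; apply: ball_le; have := e_gt0; nia.
Qed.

Lemma fourier_step : exists (N0 : nat) (k : int), forall (beta : Fv) (n : int),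
  beta != 0 -> N0%:Z <= n -> vF beta + k - m <= n ->
  fourier vF cF psi (trunc (n + 1)) beta = fourier vF cF psi (trunc n) beta.
Proof.
have [N0 [k [k0 hk]]] := lam_far_shift; exists N0, k => beta n b0 Nn bn.
have nb : ~ ball vF (m - (- n - 1 + k)) beta by rewrite ballE //; lia.
have [y by_ py] := psi_nontriv hFv hm nb.
pose g x := trunc (n + 1) x - trunc n x.
have sg : schwartz vF g.
  have -> : g = (fun x => trunc (n + 1) x + (-1) * trunc n x).
    by apply/funext => x; rewrite mulN1r.
  by apply: schwartzD => //; try (apply: schwartzZ => //); exact: schwartz_trunc.
have gy x : g (x - y) = g x.
  have yn : ball vF (- n) (- y) by apply: ballN => //; apply: ball_le by_; lia.
  have yn1 : ball vF (- (n + 1)) (- y) by apply: ball_le yn; lia.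
  rewrite /g /trunc (ind_equiv (ballDr hF x yn)) (ind_equiv (ballDr hF x yn1)).
  rewrite -!mulrBl; case: (pselect (ball vF (- n) x)) => xn.
    by rewrite !ind1 ?subrr ?mul0r //; apply: ball_le xn; lia.
  case: (pselect (ball vF (- (n + 1)) x)) => xn1; last by rewrite !ind0 ?subrr ?mul0r.
  have [x_neq0 _] := not_ball xn.
  have vx : vF x = - (n + 1) by move: xn xn1; rewrite !ballE //; lia.
  rewrite hk // vx; first by lia.
  by apply: ballN => //; apply: ball_le by_; lia.
apply/eqP; rewrite -subr_eq0 /fourier -haarB //;
  try (by apply: (schwartz_psiN hFv hpsi hm) => //; exact: schwartz_trunc).
apply/eqP; transitivity (haar vF cF (fun x => g x * psi (- (x * beta)))).
  by congr haar; apply/funext => x; rewrite mulrBl.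
apply: (@haar_twist0 _ _ hFv _ _ (- y) (psi (y * beta))) => //.
  exact: (schwartz_psiN hFv hpsi hm).
by move=> x; rewrite gy [(x - y) * beta]mulrBl opprB (psiD hpsi) mulrCA.
Qed.

Variables (theta : Kv) (eps : algC).
Hypotheses (theta_neq0 : theta != 0) (dth : d = (4%:R * theta)^-1).
Hypothesis heps : is_epsilon_half vK cK (psi_ext bar psi) lams eps.
Local Notation A := (A_coef vF vK cF psi lams theta).

(** The bound on n involves beta only through its valuation: Fourier inversion needs one truncation
    for all large beta simultaneously. *)
Lemma A_stable : exists (N0 : nat) (k : int), forall (beta : Fv) (n : nat),
  beta != 0 -> (N0 <= n)%N -> vF beta + k - m <= n%:Z ->
  A_coef vF vK cF psi lams theta beta = fourier vF cF psi (trunc n) beta.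
Proof.
have [N0 [k hk]] := fourier_step; exists N0, k => beta n b0 Nn bn.
apply: stable_valueP; exists n => n' nn'.
transitivity (fourier vF cF psi (trunc n') beta).
  congr haar; apply/funext => x; rewrite /trunc /ind.
  case: asboolP => _; last by rewrite !mul0r.
  rewrite -dth mul1r /star [beta * x]mulrC; congr (_ * _).
  by rewrite -invfM divfK ?sqrtK_neq0 ?xd_neq0.
rewrite -(subnKC nn'); elim: (n' - n)%N => [|i IHi]; first by rewrite addn0.
have -> : (n + i.+1)%N%:Z = (n + i)%N%:Z + 1 by lia.
by rewrite hk //; lia.
Qed.

(** * Product functions in the coordinates x + y d *)

Section ProductFunctions.

Let cF_gt0 : 0 < cF. Proof. by case: (res_dualF S). Qed.
Let cK_gt0 : 0 < cK. Proof. by case: (res_dualK S). Qed.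

(* Ratio of the self-dual measure of [Kv] to the product of those of [Fv] in the
   coordinates x + y d. *)
Definition ratio : algC := cK * q ^ (- vF t) / cF ^+ 2.

Lemma ratio_gt0 : 0 < ratio.
Proof. by rewrite !mulr_gt0 ?invr_gt0 ?exprn_gt0 ?exprz_gt0 ?q_gt0. Qed.

Lemma fubini_self_dual f : schwartz vK f -> haar vK cK f =
  ratio * haar vF cF (fun y => haar vF cF (fun x => f (x%:A + y%:A * d))).
Proof. by move=> sf; apply: (fubini H O) => //; rewrite gt_eqF. Qed.

Variable D : Fv.
Hypotheses (D_neq0 : D != 0) (dd : d * d = D%:A).

Definition cx (z : Kv) : Fv := quad_trace bar z / 2%:R.
Definition cy (z : Kv) : Fv := quad_trace bar (z * d) / (2%:R * D).

Lemma cxE (x y : Fv) : cx (x%:A + y%:A * d) = x.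
Proof. by rewrite /cx (quad_traceE H) mulrC mulKf. Qed.

Lemma cyE (x y : Fv) : cy (x%:A + y%:A * d) = y.
Proof.
have -> : cy (x%:A + y%:A * d) = quad_trace bar ((y * D)%:A + x%:A * d) / (2%:R * D).
  by rewrite /cy algM -dd; congr (quad_trace _ _ / _); ring.
by rewrite (quad_traceE H); field; rewrite D_neq0 two_neq0.
Qed.

Lemma coords_ball (k : int) : exists K : int, forall x y : Fv,
  ball vK K (x%:A + y%:A * d) -> ball vF k x /\ ball vF k y.
Proof.
have t0 := orth_t_neq0 O.
have [j [j1 j2 j3]] : exists j : int, [/\ k <= j, k <= j - vF t & k <= j - vF t + vF x0].
  by exists (`|k| + `|vF t| + `|vF x0|); split; ilia.
exists (e * j) => x y.
have -> : x%:A + y%:A * d = (x + y * x0)%:A + (t * y)%:A * omega.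
  by rewrite (orth_dE O) algD !algM; ring.
move=> /(ball_orth H O)[bx]; rewrite ball_mull // => by_.
have by' : ball vF k y by apply: ball_le by_.
split=> //; rewrite -(addrK (y * x0) x); apply: ballB => //; first exact: ball_le bx.
by apply: ball_le (ballM hF by_ (ballnn vF x0)).
Qed.

Lemma ball_coords (k : int) : exists K : int, forall x y : Fv,
  ball vF k x -> ball vF k y -> ball vK K (x%:A + y%:A * d).
Proof.
exists (e * k - `|vK d|) => x y /(ball_alg H) bx /(ball_alg H) by_.
apply: ballD => //; first by apply: ball_le bx; ilia.
by apply: ball_le (ballM hK by_ (ballnn vK d)); ilia.
Qed.

Definition prodf (f g : Fv -> algC) (z : Kv) : algC := f (cx z) * g (cy z).

Lemma prodfE f g (x y : Fv) : prodf f g (x%:A + y%:A * d) = f x * g y.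
Proof. by rewrite /prodf cxE cyE. Qed.

Lemma schwartz_prodf f g : schwartz vF f -> schwartz vF g -> schwartz vK (prodf f g).
Proof.
move=> sf sg; have [n [k [nk [f0 fB] [g0 gB]]]] := schwartz2 sf sg.
have [N hN] := ball_coords n; have [K hK'] := coords_ball k.
apply: (@sch_schwartz _ _ N K); split=> [z nz|z z' Kz'].
  have [x [y zE]] := coords H z; rewrite zE prodfE.
  case: (pselect (ball vF n x)) => nx; last by rewrite f0 ?mul0r.
  case: (pselect (ball vF n y)) => ny; last by rewrite g0 ?mulr0.
  by case: nz; rewrite zE; apply: hN.
have [x [y zE]] := coords H z; have [x' [y' zE']] := coords H z'.
have [kx ky] : ball vF k x' /\ ball vF k y' by apply: hK'; rewrite -zE'.
have -> : z + z' = (x + x')%:A + (y + y')%:A * d by rewrite zE zE' !algD; ring.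
by rewrite zE !prodfE (fB _ _ kx) (gB _ _ ky).
Qed.

Lemma haar_prodf f g : schwartz vF f -> schwartz vF g ->
  haar vK cK (prodf f g) = ratio * (haar vF cF f * haar vF cF g).
Proof.
move=> sf sg; rewrite fubini_self_dual; last exact: schwartz_prodf.
congr (_ * _).
transitivity (haar vF cF (fun y => haar vF cF f * g y)); last by rewrite haarZ.
congr haar; apply/funext => y.
transitivity (haar vF cF (fun x => g y * f x)); last by rewrite haarZ // mulrC.
by congr haar; apply/funext => x; rewrite prodfE mulrC.
Qed.

(** As tr (z z') = 2 (x x' + D y y'), the basis (1, d) is orthogonal for the trace form and the
    transform factors. *)
Lemma fourier_prodf f g : schwartz vF f -> schwartz vF g ->
  fourier vK cK (psi_ext bar psi) (prodf f g) =
  (fun z => ratio * prodf (fun x => fourier vF cF psi f (2%:R * x))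
                          (fun y => fourier vF cF psi g (2%:R * D * y)) z).
Proof.
move=> sf sg; apply/funext => z; have [x [y zE]] := coords H z.
rewrite zE prodfE /fourier -haar_prodf; try exact: (schwartz_psiN hFv hpsi hm).
congr haar; apply/funext => z'; have [x' [y' ->]] := coords H z'.
have -> : - ((x'%:A + y'%:A * d) * (x%:A + y%:A * d)) =
   (- (x' * x) - (y' * y * D))%:A + (- (x' * y + y' * x))%:A * d.
  by rewrite algD !algN algD !algM -dd; ring.
rewrite (psi_extE H) !prodfE.
have -> : 2%:R * (- (x' * x) - y' * y * D) = - (x' * (2%:R * x)) - y' * (2%:R * D * y).
  by ring.
by rewrite (psiD hpsi) mulrACA.
Qed.

(** Fourier inversion at 0 on Kv for a product of indicators is compared with inversion on Fv; the
    scalings by 2 and 2 D give the power of q. *)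
Lemma ratio_sqr : ratio ^+ 2 = q ^ (- vF 2%:R - vF (2%:R * D)).
Proof.
have si := schwartz_ball hFv 0; set i0 := ind (ball vF 0) in si.
have [_ /(_ _ (schwartz_prodf si si) 0)] := res_dualK S.
have z0 : (0 : Kv) = (0 : Fv)%:A + (0 : Fv)%:A * d by rewrite scale0r mul0r addr0.
have fi : schwartz vF (fourier vF cF psi i0) by exact: (schwartz_fourier hFv hpsi hm).
have D20 : 2%:R * D != 0 by rewrite mulf_neq0.
have hi : haar vF cF (fourier vF cF psi i0) = 1.
  have [_ /(_ _ si 0)] := res_dualF S; rewrite oppr0 {2}/i0 ind1; last by left.
  by move=> <-; congr haar; apply/funext => x; rewrite mulr0 oppr0 (psi0 hpsi) mulr1.
rewrite oppr0 {2}z0 prodfE /i0 ind1; last by left.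
rewrite mulr1 -/i0 fourier_prodf // {1}/fourier.
have -> : (fun x : Kv => ratio * prodf (fun x1 => fourier vF cF psi i0 (2%:R * x1))
    (fun y => fourier vF cF psi i0 (2%:R * D * y)) x * psi_ext bar psi (- (x * 0))) =
  (fun x => ratio * prodf (fun x1 => fourier vF cF psi i0 (2%:R * x1))
    (fun y => fourier vF cF psi i0 (2%:R * D * y)) x).
  apply/funext => x; rewrite mulr0 oppr0 z0 (psi_extE H) mulr0 (psi0 hpsi) mulr1 //.
have s1 := schwartz_scale hFv two_neq0 fi; have s2 := schwartz_scale hFv D20 fi.
rewrite haarZ //; last exact: schwartz_prodf.
rewrite haar_prodf // !haar_scale // hi !mulr1.
rewrite mulrA -expr2 -expfzDr ?q_neq0 // => h.
transitivity (ratio ^+ 2 * q ^ (vF 2%:R + vF (2%:R * D)) * q ^ (- vF 2%:R - vF (2%:R * D))).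
  rewrite -mulrA -expfzDr ?q_neq0 //.
  by rewrite [X in q ^ X](_ : _ = 0) ?expr0z ?mulr1 //; ilia.
by rewrite h mul1r.
Qed.

Lemma ov_ratio : ov ratio = 0%E.
Proof.
apply: (@ov_root_unit _ _ _ _ hCp _ _ 2) => //; rewrite ratio_sqr.
by apply: (ov_unitXz hCp); exact: ov_q.
Qed.

End ProductFunctions.

Lemma ov_cF : ov cF = 0%E.
Proof.
apply: (@ov_root_unit _ _ _ _ hCp _ _ 2) => //.
rewrite (self_dual_sqr hFv hpsi hm (res_dualF S)).
by apply: (ov_unitXz hCp); exact: ov_q.
Qed.

Lemma ov_psi x : ov (psi x) = 0%E.
Proof.
have [N N0 hN] := multiple_near0 hFv m x.
apply: (@ov_root_unit _ _ _ _ hCp _ _ N) => //.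
suff -> : psi x ^+ N = psi (x *+ N) by rewrite (psi_ball hm hN) (ov1 hCp).
elim: (N) => [|k IHk]; first by rewrite expr0 mulr0n (psi0 hpsi).
by rewrite exprS IHk mulrS (psiD hpsi).
Qed.

(* Fourier inversion: a function all of whose nontrivial Fourier coefficients
   vanish is constant; here modulo the maximal ideal. *)
Lemma nonvanishing_coef : (exists2 z, z != 0 & ~ cong (lam z) 1) ->
  exists2 beta : Fv, beta != 0 & ~ cong (A beta) 0.
Proof.
move=> [z z0 nz]; apply: contrapT => no; apply: nz.
have A0 beta : beta != 0 -> cong (A_coef vF vK cF psi lams theta beta) 0.
  by move=> b0; apply: contrapT => nb; apply: no; exists beta.
have [N0 [k hk]] := A_stable.
have hconst (x1 x2 : Fv) : cong (lam (x1%:A + d))^-1 (lam (x2%:A + d))^-1.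
  have [n [Nn n1 n2]] : exists n : nat, [/\ (N0 <= n)%N,
      ball vF (- n%:Z) x1 /\ ball vF (k - 1 - n%:Z) x1 &
      ball vF (- n%:Z) x2 /\ ball vF (k - 1 - n%:Z) x2].
    have [n [h0 h1 h2]] : exists n : nat, [/\ (N0 <= n)%N,
        - n%:Z <= vF x1 /\ k - 1 - n%:Z <= vF x1 & - n%:Z <= vF x2 /\ k - 1 - n%:Z <= vF x2].
      move: (vF x1) (vF x2) => v1 v2; clear.
      by exists (N0 + absz v1 + absz v2 + absz (k - 1))%N; split; [|split|split]; ilia.
    by exists n; split=> //; case: h1 h2 => ? ? [? ?]; split;
      apply: ball_le (@ballnn _ vF _).
  have sT := schwartz_trunc n.
  have [_ /(_ _ sT) inv] := res_dualF S.
  have [G GE] : exists G, G = fourier vF cF psi (trunc n) by eexists.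
  have tE (x : Fv) : ball vF (- n%:Z) x ->
      (lam (x%:A + d))^-1 = fourier vF cF psi G (- x).
    by move=> bx; rewrite GE inv opprK /trunc ind1 ?mul1r.
  have sG : schwartz vF G by rewrite GE; exact: (schwartz_fourier hFv hpsi hm).
  rewrite /congr_p (tE _ (proj1 n1)) (tE _ (proj1 n2)) /fourier -haarB //;
    try exact: (schwartz_psiN hFv hpsi hm).
  apply: (ov_haar_gt hCp hFv ov_q) => //; first by rewrite ov_cF.
    have -> : (fun x => G x * psi (- (x * - x1)) - G x * psi (- (x * - x2))) =
      (fun x => G x * psi (- (x * - x1)) + (-1) * (G x * psi (- (x * - x2)))).
      by apply/funext => x; rewrite mulN1r.
    by apply: schwartzD => //; last apply: schwartzZ => //;
      exact: (schwartz_psiN hFv hpsi hm).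
  move=> y; rewrite -mulrBr.
  (* Frequencies near 0 do not separate x1 from x2; at the others [G y] is the coefficient [A y],
     divisible by assumption. *)
  case: (pselect (ball vF (n%:Z + m - k + 1) y)) => yb.
    rewrite !(psi_ball hm) ?subrr ?mulr0 ?(ov0 hCp) //; rewrite mulrN opprK.
      by apply: ball_le (ballM hF yb (proj2 n2)); ilia.
    by apply: ball_le (ballM hF yb (proj2 n1)); ilia.
  have [y0 _] := not_ball yb.
  have GA : (0 < ov (G y))%E.
    apply/(@cong0 _ _ ord); rewrite GE -hk //; first exact: A0.
    by move: yb; rewrite ballE //; ilia.
  rewrite mulrC; apply: (ov_gtM hCp) => //.
  by apply: (ov_geD hCp); rewrite ?(ovN hCp) (ov_psi _).
have [N1 hN1] := lam_far.
(* Far out [lam (x + d)] is [lam x]; comparing x with x y isolates [lam y]. *)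
have far (y : Fv) : y != 0 -> cong (lam y%:A) 1.
  move=> y0; pose x := uniformizer vF ^ (- (N1%:Z + absz (vF y) + 1)).
  have x_neq0 : x != 0 by exact: pi_neq0.
  have vx : vF x = - (N1%:Z + absz (vF y) + 1) by exact: val_pi.
  have [|_ e1] := hN1 x x_neq0; first by rewrite vx; ilia.
  have [||_ e2] := hN1 (x * y); first by rewrite mulf_neq0.
    by rewrite valM // vx; ilia.
  have xA0 : x%:A != 0 :> Kv by rewrite alg_eq0.
  have yA0 : y%:A != 0 :> Kv by rewrite alg_eq0.
  have := hconst x (x * y); rewrite e1 e2 algM (lamM hlam) // invfM => /(congMl hCp).
  move=> /(_ (lam x%:A * lam y%:A)); rewrite (ov_unitM hCp) ?ov_lam // => /(_ (lexx _)).
  have -> : lam x%:A * lam y%:A * (lam x%:A)^-1 = lam y%:A.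
    by field; rewrite (lam_neq0 hlam).
  have -> // : lam x%:A * lam y%:A * ((lam x%:A)^-1 / lam y%:A) = 1.
  by field; rewrite !(lam_neq0 hlam).
have c1 x : cong (lam (x%:A + d))^-1 1.
  pose x' := uniformizer vF ^ (- (N1%:Z + 1)).
  have x_neq0 : x' != 0 by exact: pi_neq0.
  have [|_ e1] := hN1 x' x_neq0; first by rewrite val_pi //; ilia.
  apply: (cong_trans hCp (hconst x x')); rewrite e1.
  by have := congV hCp (ov1 hCp iota_p) (far x' x_neq0); rewrite invr1.
have [x [y zE]] := coords H z.
have [y0|y0] := eqVneq y 0.
  rewrite zE y0 scale0r mul0r addr0; apply: far.
  by apply/eqP => x_0; move/eqP: z0; rewrite zE y0 x_0 !scale0r mul0r addr0.
have -> : z = y%:A * ((x / y)%:A + d).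
  by rewrite mulrDr -algM mulrCA divff // mulr1.
rewrite (lamM hlam) ?alg_eq0 ?xd_neq0 // -[X in cong _ X]mulr1.
apply: (congM hCp); rewrite ?(ov1 hCp) ?ov_lam ?alg_eq0 //; first exact: far.
by have := congV hCp (ov1 hCp iota_p) (c1 (x / y)); rewrite invrK invr1.
Qed.

(** * Zeta integrals and Euler factors at s = 1/2 *)

Local Notation rho chi := (1 - L_coef vK chi * (sqrtC qK)^-1).

Let qK_gt0 : 0 < qK. Proof. exact: q_gt0 hKv. Qed.
Let s_neq0 : sqrtC qK != 0. Proof. by rewrite sqrtC_eq0 gt_eqF. Qed.

Lemma nabsM (z z' : Kv) : z != 0 -> z' != 0 -> nabs vK (z * z') = nabs vK z * nabs vK z'.
Proof.
move=> z0 z0'; rewrite /nabs mulf_eq0 (negPf z0) (negPf z0') /= valM // opprD.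
by rewrite expfzDr // q_neq0.
Qed.

Lemma sqrt_nabs z : z != 0 -> sqrtC (nabs vK z) = sqrtC qK ^ (- vK z).
Proof.
move=> z0; have -> : nabs vK z = (sqrtC qK ^ (- vK z)) ^+ 2.
  rewrite /nabs (negPf z0) -{1}(sqrtCK qK).
  by rewrite ![_ ^+ 2]exprnP exprzAC.
by rewrite sqrCK // exprz_ge0 // sqrtC_ge0 ltW.
Qed.

Lemma nabs_sqrt z : z != 0 -> nabs vK z = (sqrtC qK ^ (- vK z)) ^+ 2.
Proof. by move=> z0; rewrite -sqrt_nabs // sqrtCK. Qed.

Lemma mulinv_nabs k : 0 < k -> mulinv vK k (nabs vK).
Proof.
move=> k0 x u xn ku; have [u0 vu] : u != 0 /\ vK u = 0.
  by apply: ball1_unit => //; apply: ball_le ku; ilia.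
by rewrite nabsM // {2}/nabs (negPf u0) vu oppr0 expr0z mulr1.
Qed.

Lemma mulinv_star : exists2 k, 0 < k & mulinv vK k lam /\ mulinv vK k lams.
Proof.
have [k k0 hk] := quasi_mulinv hKv hlam; exists k => //; split=> //.
by move=> x u xn ku; rewrite /star hk // (mulinv_nabs k0).
Qed.

(** The weight |z|^(-1/2) of the zeta integral doubles the one in [star]; for the inverse character,
    in [zeta_starV], the two cancel. *)
Lemma zeta_star f (b : int) : schwartz vK f -> (forall z, ball vK b z -> f z = 0) ->
  zeta_over_L vK cK lams f (sqrtC qK)^-1 =
    rho lams * haar vK cK (fun z => f z * (lam z / nabs vK z)).
Proof.
move=> sf fb; have [k k0 [_ hk]] := mulinv_star.
rewrite (zeta_annulus hKv cK (invr_neq0 s_neq0) k0 hk sf fb); congr (_ * haar _ _ _).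
apply/funext => z; have [->|z0] := eqVneq z 0; first by rewrite fb ?mul0r //; left.
congr (_ * _); rewrite /star sqrt_nabs // nabs_sqrt //.
have -> : qK / sqrtC qK = sqrtC qK by rewrite -{1}(sqrtCK qK) expr2 mulfK.
by rewrite -invr_expz; field; rewrite expfz_neq0.
Qed.

Lemma zeta_starV f (b : int) : schwartz vK f -> (forall z, ball vK b z -> f z = 0) ->
  zeta_over_L vK cK (fun z => (lams z)^-1) f (sqrtC qK)^-1 =
    rho (fun z => (lams z)^-1) * haar vK cK (fun z => f z * (lam z)^-1).
Proof.
move=> sf fb; have [k k0 [_ hk]] := mulinv_star.
have hk' := mulinv_comp (fun x => x^-1) hk.
rewrite (zeta_annulus hKv cK (invr_neq0 s_neq0) k0 hk' sf fb); congr (_ * haar _ _ _).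
apply/funext => z; have [->|z0] := eqVneq z 0; first by rewrite fb ?mul0r //; left.
congr (_ * _); rewrite /star sqrt_nabs //.
have -> : qK / sqrtC qK = sqrtC qK by rewrite -{1}(sqrtCK qK) expr2 mulfK.
by rewrite -invr_expz; field; rewrite expfz_neq0 // (lam_neq0 hlam).
Qed.

Lemma norm_even z : z != 0 -> e = 1 -> forall x : Fv, x%:A = z * bar z -> vF x = 2 * vK z.
Proof.
move=> z0 e1 x xE; have := vKe x.
by rewrite xE valM ?bar_eq0 // (val_bar H O) e1; ilia.
Qed.

Lemma tau_pi (x : Fv) : e = 1 -> vF x = 1 -> tau x = -1.
Proof.
move=> e1 vx; rewrite /quad_char; case: asboolP => // -[z [z0 xE]].
by have := norm_even z0 e1 xE; rewrite vx; ilia.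
Qed.

Lemma qK_sqr : e = 1 -> qK = q ^+ 2.
Proof. by move=> e1; rewrite -(qK_e H O) e1 expr1z. Qed.

Lemma sqrt_qK : e = 1 -> sqrtC qK = q.
Proof. by move=> e1; rewrite qK_sqr // sqrCK // ler0n. Qed.

Lemma tau_units_e1 : (forall x : Fv, x != 0 -> vF x = 0 -> tau x = 1) -> e = 1.
Proof.
move=> h; case: (orth_e12 O) => // e2; have [a [a0 va na]] := ramified_nonnorm H O e2.
have := h a a0 va; rewrite /quad_char; case: asboolP => // _ /eqP.
by rewrite eq_sym -addr_eq0 -[1 + 1]/(2%:R) pnatr_eq0.
Qed.

Lemma tau_lam1 (x : Fv) : x != 0 -> vF x = 0 -> cong (lam x%:A) 1 -> tau x = 1.
Proof.
move=> xn vx hx; apply: (cong_sign pp podd hCp (iota_p := iota_p)); [exact: tau_sign|by left|].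
apply: (cong_trans hCp) hx; apply: (cong_sym hCp).
have := lamF xn; by rewrite /nabs (negPf xn) vx oppr0 expr0z mulr1.
Qed.

(* The two Euler factors are 1 unless [lam] is unramified; then Kv / Fv is
   unramified, the Frobenius eigenvalue is congruent to -1, and both are congruent
   to 1 + 1 / q. *)
Lemma rho_cong : (exists2 z, z != 0 & ~ cong (lam z) 1) ->
  ov (rho lams) = 0%E /\ cong (rho (fun z => (lams z)^-1)) (rho lams).
Proof.
move=> [z z0 nz]; rewrite /L_coef.
have nabs_unit u : u != 0 -> vK u = 0 -> lams u = lam u.
  by move=> u0 vu; rewrite /star sqrt_nabs // vu oppr0 expr0z divr1.
have unrV : unramified vK (fun z => (lams z)^-1) <-> unramified vK lams.
  by split=> h x xn vx; have := h x xn vx; [move/(congr1 GRing.inv)|move=> ->];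
    rewrite ?invrK invr1.
rewrite (asbool_equiv_eq unrV); case: asboolP => [unr|_]; last first.
  by rewrite !mul0r subr0 (ov1 hCp); split=> //; exact: (cong_refl hCp).
have lam_u u : u != 0 -> vK u = 0 -> lam u = 1.
  by move=> u0 vu; rewrite -nabs_unit // unr.
have e1 : e = 1.
  apply: tau_units_e1 => x xn vx; apply: tau_lam1 => //.
  by rewrite lam_u ?alg_eq0 // ?vKe ?vx ?mulr0 //; exact: (cong_refl hCp).
rewrite sqrt_qK //; set P := uniformizer vK.
have [P0 vP] := uniformizerP hK; rewrite -/P in P0 vP.
pose x := uniformizer vF; have [xn vx] := uniformizerP hF; rewrite -/x in xn vx.
have xA0 : x%:A != 0 :> Kv by rewrite alg_eq0.
have lamP : lam P = lam x%:A.
  have -> : P = x%:A * (P / x%:A) by rewrite mulrCA divff // mulr1.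
  rewrite (lamM hlam) ?mulf_neq0 ?invr_eq0 // [lam (P / _)]lam_u ?mulr1 //.
    by rewrite mulf_neq0 ?invr_eq0.
  by rewrite valM ?invr_eq0 // valV // vKe e1 vP vx.
have lamsP : cong (lams P) (-1).
  rewrite -(tau_pi e1 vx) /star sqrt_nabs // vP lamP sqrt_qK //.
  have := tau_cong xn; rewrite /star (sqrt_nabs_alg H O) /nabs (negPf xn) vx.
  exact.
have lamsP' : cong (lams P)^-1 (-1).
  have ovm : ov (-1) = 0%E by apply: (ov_sqr1 hCp); rewrite sqrrN expr1n.
  by have := congV hCp ovm lamsP; rewrite invrN invr1.
have ovq := ov_q; have ovqV := ov_unitV hCp ovq.
have rc y : cong y (-1) -> cong (1 - y / q) (1 + q^-1).
  move=> hy; apply: (congD hCp); first exact: (cong_refl hCp).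
  have := congN hCp (congMl hCp (eq_ind_r (fun v => (0 <= v)%E) (lexx _) ovqV) hy).
  by rewrite mulrN1 opprK mulrC.
split; last by apply: (cong_trans hCp (rc _ lamsP')); apply: (cong_sym hCp); exact: rc.
apply: (cong_unit hCp (rc _ lamsP)); apply/eqP; rewrite eq_le.
have ge0 : (0 <= ov (1 + q^-1)%R)%E.
  by apply: (ov_geD hCp); rewrite ?(ov1 hCp) // ovqV.
(* If 1 + 1/q were not a unit, [lam P] would be congruent to -1/q, hence to 1, and the unramified
   [lam] would be congruent to 1 everywhere. *)
rewrite ge0 andbT leNgt; apply/negP => lt; apply: nz.
have lamPE : lam P = lams P / q.
  by rewrite /star sqrt_nabs // vP sqrt_qK // -invr_expz expr1z invrK mulfK ?q_neq0.
have lamP1 : cong (lam P) 1.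
  rewrite lamPE; apply: (cong_trans hCp (y := - q^-1)).
    have := congMl hCp (eq_ind_r (fun v => (0 <= v)%E) (lexx _) ovqV) lamsP.
    by rewrite mulrN1 mulrC.
  by rewrite /congr_p -opprD (ovN hCp) addrC.
have zE : z = P ^ vK z * (z / P ^ vK z) by rewrite mulrCA divff ?mulr1 // expfz_neq0.
rewrite zE (lamM hlam) ?mulf_neq0 ?invr_eq0 ?expfz_neq0 //.
rewrite [lam (z / _)]lam_u ?mulf_neq0 ?invr_eq0 ?expfz_neq0 // ?mulr1; last first.
  by rewrite valM ?invr_eq0 ?expfz_neq0 // valV // val_pi // subrr.
rewrite (lamXz hlam) //; case: (vK z) => j; last rewrite NegzE -exprnN.
  by rewrite -(expr1n _ j); apply: (congX hCp) => //; rewrite (ov1 hCp).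
rewrite -[X in cong _ X]invr1; apply: (congV hCp); rewrite ?(ov1 hCp) //.
by rewrite -(expr1n _ j.+1); apply: (congX hCp) => //; rewrite (ov1 hCp).
Qed.

Lemma two_theta : 2%:R * theta = (2%:R * d)^-1.
Proof.
have t2 := two_neq0K H; rewrite dth.
by field; rewrite t2 theta_neq0 -[4%:R]/(2 * 2)%:R natrM mulf_neq0.
Qed.

(** Since 2 theta = 1 / (2 d), this makes [ratio / lam (2 d)] the value [lams (2 theta)] of the
    conclusion. *)
Lemma ratio_sqrt (D : Fv) : D != 0 -> d * d = D%:A -> ratio = sqrtC (nabs vK (2%:R * d)).
Proof.
move=> D0 dd; have t2 := two_neq0K H.
have d2 : 2%:R * d != 0 by rewrite mulf_neq0.
have r0 : 0 <= ratio by rewrite ltW // ratio_gt0.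
rewrite -[LHS]sqrCK // (ratio_sqr D0 dd); congr sqrtC.
have D4 : 2%:R * (2%:R * D) != 0 :> Fv by rewrite !mulf_neq0.
have : nabs vK (2%:R * d) ^+ 2 = (q ^ (- vF 2%:R - vF (2%:R * D))) ^+ 2.
  rewrite expr2 -nabsM //.
  have -> : 2%:R * d * (2%:R * d) = (2%:R * (2%:R * D))%:A.
    by rewrite !algM -dd alg_nat; ring.
  rewrite (nabs_alg H O) /nabs (negPf D4) valM ?mulf_neq0 //.
  by rewrite opprD.
by move=> /eqP; rewrite eqrXn2 ?ltW ?nabs_gt0 ?exprz_gt0 ?q_gt0 // => /eqP.
Qed.

Lemma tau_lam_inv (b : Fv) : b != 0 -> cong ((lam b%:A)^-1 * nabs vF b) (tau b).
Proof.
move=> b0; have nb := ov_nabsF b0.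
have tt : (tau b)^-1 = tau b by case: (tau_sign b) => ->; rewrite ?invrN invr1.
have ovtn : ov (tau b * nabs vF b) = 0%E by rewrite (ov_unitM hCp) ?ov_tau.
have := congMl hCp (eq_ind_r (fun v => (0 <= v)%E) (lexx _) nb) (congV hCp ovtn (lamF b0)).
have -> : nabs vF b * (tau b * nabs vF b)^-1 = tau b.
  by rewrite invfM tt mulrCA divff ?mulr1 // nabsF_neq0.
by rewrite mulrC.
Qed.

(* The functional equation is tested on the product [f] of the indicator of a small
   ball around [beta / 2] (in [x]) and of [psi (2 d^2 y)] cut off to a large ball
   (in [y]).  The Fourier transform of [f] is concentrated near [y = 1], so its zeta
   integral is a multiple of [A_beta]; by residual self-duality in the form [lam_bar]
   that of [f] is congruent to a multiple of [A_beta] too. *)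
Lemma eps_of_nonvanishing (beta : Fv) : beta != 0 -> ~ cong (A beta) 0 ->
  (exists2 z, z != 0 & ~ cong (lam z) 1) ->
  cong eps (tau beta * lams (2%:R * theta)).
Proof.
move=> b0 nA hz; have t2 := two_neq0K H; have [D D0 dd] := d_sqr H.
have [N0 [k hk]] := A_stable.
have [k1 k10 hk1] := lam_near.
have [k2 k20 [hk2 _]] := mulinv_star.
have hG : mulinv vK k2 (fun z => lam z / nabs vK z).
  by apply: mulinvM => //; apply: mulinv_comp; exact: mulinv_nabs.
set G := fun z => lam z / nabs vK z in hG.
have D20 : 2%:R * D != 0 by rewrite mulf_neq0.
have pE := prodfE D0 dd.
(* The trace doubles x, so centering at beta / 2 yields the phase psi (- beta x) of A_beta. *)
pose b2 := beta / 2%:R; have b20 : b2 != 0 by rewrite mulf_neq0 ?invr_eq0.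
(* Chosen so that b2 - y d = (beta / (2 d)) (y / a + d), with phase psi (2 D y) = psi (- beta (y /
   a)): the y-integral is again A_beta. *)
pose a := - beta / (2%:R * D).
have a0 : a != 0 by rewrite mulf_neq0 ?oppr_eq0 ?invr_eq0.
have [K hK'] := coords_ball (vF b2 + 1).
have zb2 (y : Fv) : b2%:A + y%:A * d != 0 /\ vK (b2%:A + y%:A * d) < K.
  have nb : ~ ball vK K (b2%:A + y%:A * d).
    by move=> /hK'[]; rewrite ballE //; ilia.
  have [z0 _] := not_ball nb.
  by split=> //; rewrite ltNge; apply/negP => h; apply: nb; apply/ballE.
(* N' and n are dual radii: the ball of radius N' around b2 transforms into the truncation at n.
   Likewise, below, the cut-off b in y is the truncation at n', and M is its dual radius around y =
   1. *)
have [n [N' [NE Nn bn Nb NK]]] : exists (n : nat) (N' : int),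
    [/\ N' = m - vF 2%:R + n%:Z, (N0 <= n)%N, vF beta + k - m <= n%:Z,
        vF b2 + 1 <= N' & K + k2 <= N' /\ 0 <= N'].
  move: (vF 2%:R) (vF beta) (vF b2) => v2 vb vb2; clear.
  exists (N0 + absz (vb + k - m)%R + absz (m - v2)%R + absz (vb2 + 1)%R + absz (K + k2)%R)%N.
  by eexists; split; [reflexivity|lia|lia|lia|split; lia].
have [n' [b [M [bE ME Nn' bn' Mk]]]] : exists (n' : nat) (b M : int),
    [/\ b = vF a - n'%:Z, M = m - b - vF (2%:R * D), (N0 <= n')%N,
      vF beta + k - m <= n'%:Z & 1 <= M /\ k1 - vK d <= M].
  move: (vF a) (vF beta) (vF (2%:R * D)) (vK d) => va vb vD vd; clear.
  exists (N0 + absz (vb + k - m)%R + absz (m - va - vD)%R + absz (k1 - vd)%R + 1)%N.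
  by do 2 eexists; split; [reflexivity|reflexivity|lia|lia|split; lia].
have AE : A beta = fourier vF cF psi (trunc n) beta by apply: hk.
have AE' : A beta = fourier vF cF psi (trunc n') beta by apply: hk.
pose V (j : int) := cF * q ^ (- j).
have ovV j : ov (V j) = 0%E.
  by rewrite (ov_unitM hCp) ?ov_cF //; apply: (ov_unitXz hCp); exact: ov_q.
pose f1 (x : Fv) := ind (ball vF N') (x - b2).
pose f2 (y : Fv) := ind (ball vF b) y * psi (y * (2%:R * D)).
have sf1 : schwartz vF f1 by apply: (schwartz_shift hFv (- b2)); exact: schwartz_ball.
have sf2 : schwartz vF f2 by apply: (schwartz_psi hFv hpsi hm); exact: schwartz_ball.
have F1 u : fourier vF cF psi f1 u = psi (- (b2 * u)) * (V N' * ind (ball vF (m - N')) u).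
  rewrite /V -(fourier_ball hFv hpsi hm) /fourier -haarZ //; last first.
    by apply: (schwartz_psiN hFv hpsi hm); exact: schwartz_ball.
  rewrite -[LHS](haar_shift hFv cF b2); last exact: (schwartz_psiN hFv hpsi hm).
  congr haar; apply/funext => x; rewrite /f1 addrK mulrDl opprD (psiD hpsi).
  by rewrite mulrA mulrC.
have F2 u : fourier vF cF psi f2 u = V b * ind (ball vF (m - b)) (u - 2%:R * D).
  rewrite /V -(fourier_ball hFv hpsi hm) /fourier; congr haar; apply/funext => y.
  by rewrite /f2 -mulrA -(psiD hpsi); congr (_ * psi _); ring.
pose f := prodf D f1 f2.
have sf : schwartz vK f by exact: schwartz_prodf.
have fhat : fourier vK cK (psi_ext bar psi) f =
    (fun z => ratio * prodf D (fun x => fourier vF cF psi f1 (2%:R * x))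
      (fun y => fourier vF cF psi f2 (2%:R * D * y)) z).
  exact: (fourier_prodf D0 dd sf1 sf2).
have sF1 : schwartz vF (fun x => fourier vF cF psi f1 (2%:R * x)).
  by apply: schwartz_scale => //; exact: (schwartz_fourier hFv hpsi hm).
have sF2 : schwartz vF (fun y => fourier vF cF psi f2 (2%:R * D * y)).
  by apply: schwartz_scale => //; exact: (schwartz_fourier hFv hpsi hm).
have sfhat : schwartz vK (fourier vK cK (psi_ext bar psi) f).
  by rewrite fhat; apply: schwartzZ => //; exact: schwartz_prodf.
have indM (y : Fv) : ind (ball vF (m - b)) (2%:R * D * y - 2%:R * D) = ind (ball vF M) (y - 1).
  apply: ind_equiv; have -> : 2%:R * D * y - 2%:R * D = 2%:R * D * (y - 1) by ring.
  by rewrite ball_mull // ME.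
(* [f] and its transform both vanish near 0, as x is close to b2 on the first support and y is close
   to 1 on the second; the zeta integrals are then plain integrals. *)
have fb (z : Kv) : ball vK K z -> f z = 0.
  have [x [y ->]] := coords H z => /hK'[bx _].
  rewrite /f pE /f1 ind0 ?mul0r // => bx2.
  have h : ball vF (vF b2 + 1) (x - b2) by apply: ball_le bx2.
  by have := ballB hF bx h; rewrite subKr ballE //; ilia.
have [K1 hK1] := coords_ball 1.
have fhatb (z : Kv) : ball vK K1 z -> fourier vK cK (psi_ext bar psi) f z = 0.
  have [x [y ->]] := coords H z => /hK1[_ by_].
  rewrite fhat pE F2 indM ind0 ?mulr0 // => by2.
  have h : ball vF 1 (y - 1) by apply: ball_le by2; case: Mk.
  by have := ballB hF by_ h; rewrite subKr ballE ?oner_neq0 // val1.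
have := heps sf; rewrite (zeta_star sf fb) (zeta_starV sfhat fhatb).
have Tn j : schwartz vF (fun x => trunc j x * psi (- (x * beta))).
  by apply: (schwartz_psiN hFv hpsi hm); exact: schwartz_trunc.
have sM : schwartz vF (fun y => ind (ball vF M) (y - 1)).
  by apply: (schwartz_shift hFv (-1)); exact: schwartz_ball.
have -> : haar vK cK (fun z => fourier vK cK (psi_ext bar psi) f z * (lam z)^-1) =
    ratio * (V N' * V b) * (ratio * (A beta * V M)).
  have -> : A beta * V M = haar vF cF (fun x => trunc n x * psi (- (x * beta))) *
      haar vF cF (fun y => ind (ball vF M) (y - 1)).
    rewrite AE /fourier; congr (_ * _); rewrite (haar_shift hFv cF (-1)) ?haar_ball //.
    exact: schwartz_ball.
  rewrite -(haar_prodf D0 dd) // -haarZ //; last exact: schwartz_prodf.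
  congr haar; apply/funext => z; have [x [y ->]] := coords H z.
  rewrite fhat !pE F1 F2 indM /trunc.
  case: (pselect (ball vF M (y - 1))) => by_; last by rewrite (ind0 by_) !mulr0 !mul0r.
  have -> : lam (x%:A + y%:A * d) = lam (x%:A + d).
    have -> : x%:A + y%:A * d = x%:A + d + (y - 1)%:A * d by rewrite algD algN scale1r; ring.
    apply: hk1; have /(ball_alg H) hb := by_.
    apply: ball_le (ballM hK hb (ballnn vK d)).
    by move: Mk e_gt0; move: (vK d) => vd; clear; nia.
  have -> : ind (ball vF (m - N')) (2%:R * x) = ind (ball vF (- n%:Z)) x.
    by apply: ind_equiv; rewrite ball_mull // NE;
      have -> : m - (m - vF 2%:R + n%:Z) - vF 2%:R = - n%:Z by ilia.
  have -> : b2 * (2%:R * x) = x * beta by rewrite /b2; field.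
  rewrite (ind1 by_); ring.
set J := haar vK cK _ => epsE.
pose c0 := (lam (beta%:A / (2%:R * d)))^-1.
have bd0 : beta%:A / (2%:R * d) != 0 by rewrite mulf_neq0 ?invr_eq0 ?mulf_neq0 ?alg_eq0.
have ovc0 : ov c0 = 0%E by rewrite (ov_unitV hCp) // ov_lam.
have f2G (y : Fv) : f2 y * (lam (b2%:A - y%:A * d))^-1 =
    c0 * (trunc n' (a^-1 * y) * psi (- (a^-1 * y * beta))).
  rewrite /f2 /trunc /c0.
  have -> : ind (ball vF (- n'%:Z)) (a^-1 * y) = ind (ball vF b) y.
    by apply: ind_equiv; rewrite ball_mull ?invr_eq0 // valV // bE;
      have -> : - n'%:Z - - vF a = vF a - n'%:Z by ilia.
  have -> : - (a^-1 * y * beta) = y * (2%:R * D).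
    by rewrite /a; field; rewrite ?oppr_eq0 ?b0 ?D0 ?two_neq0.
  have -> : b2%:A - y%:A * d = beta%:A / (2%:R * d) * ((a^-1 * y)%:A + d).
    have D0K : D%:A != 0 :> Kv by rewrite alg_eq0.
    have bA0 : beta%:A != 0 :> Kv by rewrite alg_eq0.
    rewrite /b2 /a !(algM, algV, algN) !alg_nat -dd.
    by field; rewrite ?oppr_eq0 ?d_neq0 ?t2 ?bA0.
  by rewrite (lamM hlam) ?xd_neq0 // invfM; ring.
have sJ2 : schwartz vF (fun y => f2 y * (lam (b2%:A - y%:A * d))^-1).
  have -> : (fun y => f2 y * (lam (b2%:A - y%:A * d))^-1) = (fun y =>
    c0 * (trunc n' (a^-1 * y) * psi (- (a^-1 * y * beta)))) by apply/funext.
  apply: schwartzZ => //; apply: (schwartz_scale hFv (invr_neq0 a0) (Tn _)).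
have sG : schwartz vF (fun y => f2 y * G (b2%:A + y%:A * d)).
  have [n0 [m0 [nm0 hf2]]] := schwartz_sch sf2.
  have [m1 [h1 h2 h3]] : exists m1 : int, [/\ n0 <= m1, m0 <= m1 & K + k2 <= e * m1 + vK d].
    move: (vK d) e_gt0 => vd; clear => eg; exists (`|n0| + `|m0| + `|K + k2 - vd|).
    by split; nia.
  apply: (@sch_schwartz _ _ n0 m1); apply: (sch_mul h1); first exact: sch_le hf2.
  move=> y y' _ by_; rewrite algD mulrDl addrA.
  have [z0 zK] := zb2 y; apply: (mulinvE hKv hG z0).
  have /(ball_alg H) hb := by_.
  by apply: ball_le (ballM hK hb (ballnn vK d)); move: zK h3; move: (vK _) (vK d); clear; lia.
have JE : J = ratio * (V N' * haar vF cF (fun y => f2 y * G (b2%:A + y%:A * d))).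
  have -> : V N' = haar vF cF f1.
    by rewrite /f1 (haar_shift hFv cF (- b2)) ?haar_ball //; exact: schwartz_ball.
  rewrite -(haar_prodf D0 dd) //; congr haar; apply/funext => z.
  have [x [y ->]] := coords H z; rewrite /f !pE -/(G _) -mulrA /f1.
  case: (pselect (ball vF N' (x - b2))) => bx; last by rewrite (ind0 bx) !mul0r.
  congr (_ * (_ * _)); have -> : x%:A + y%:A * d = b2%:A + y%:A * d + (x - b2)%:A.
    by rewrite algD algN; ring.
  have [z0 zK] := zb2 y; apply: (mulinvE hKv hG z0).
  have /(ball_alg H) hb := bx; apply: ball_le hb.
  by case: NK zK e_gt0; move: (vK _); clear; nia.
(* Residual self-duality enters here: [lam_bar] replaces lam z / |z| by the inverse of [lam] at b2 -
   y d, and [f2G] recognizes the integrand of A_beta. *)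
have Jc : cong J (ratio * V N' * (c0 * q ^ (- vF a) * A beta)).
  rewrite JE mulrA; apply: (congMl hCp).
    by rewrite (ov_unitM hCp) ?ovV // (ov_ratio D0 dd).
  have -> : c0 * q ^ (- vF a) * A beta =
      haar vF cF (fun y => f2 y * (lam (b2%:A - y%:A * d))^-1).
    have -> : (fun y => f2 y * (lam (b2%:A - y%:A * d))^-1) = (fun y =>
      c0 * (trunc n' (a^-1 * y) * psi (- (a^-1 * y * beta)))) by apply/funext.
    have sT := schwartz_scale hFv (invr_neq0 a0) (Tn n'%:Z).
    rewrite haarZ // (haar_scale hFv cF (invr_neq0 a0) (Tn n'%:Z)) valV // AE'.
    by rewrite mulrA.
  apply: (cong_haar hCp hFv ov_q) => //; first by rewrite ov_cF.
  move=> y; apply: (congMl hCp).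
    rewrite /f2 mulrC (ov_unitM hCp) ?ov_psi // /ind.
    by case: asboolP => _; rewrite ?(ov1 hCp) // (ov0 hCp).
  have [z0 _] := zb2 y; have := lam_bar z0.
  by rewrite (bar_coords H).
have ovr : ov ratio = 0%E by exact (ov_ratio D0 dd).
have A_int : (0 <= ov (A beta))%E.
  rewrite AE; apply: (ov_haar hCp hFv ov_q) => //; first by rewrite ov_cF.
  move=> x; rewrite mulrC (ov_unitM hCp) ?ov_psi // /trunc mulrC.
  rewrite (ov_unitM hCp); last by rewrite (ov_unitV hCp) // ov_lam // xd_neq0.
  by rewrite /ind; case: asboolP => _; rewrite ?(ov1 hCp) // (ov0 hCp).
have ovA : ov (A beta) = 0%E.
  apply/eqP; rewrite eq_le A_int andbT leNgt; apply/negP => lt; apply: nA.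
  exact/cong0.
have ovqa : ov (q ^ (- vF a)) = 0%E by apply: (ov_unitXz hCp); exact: ov_q.
pose U := ratio * V N' * A beta.
have ovU : ov U = 0%E by rewrite (ov_unitM hCp) // (ov_unitM hCp) // ovV.
have ovJ : ov J = 0%E.
  apply: (cong_unit hCp Jc); rewrite (ov_unitM hCp); last first.
    by rewrite (ov_unitM hCp) // ovV.
  by rewrite (ov_unitM hCp) // (ov_unitM hCp).
have [ovrho rhoc] := rho_cong hz.
rewrite -(congMl_unit hCp _ _ (_ : ov (rho lams * J) = 0%E)); last by rewrite (ov_unitM hCp).
rewrite [_ * eps]mulrC -epsE -[X in cong _ X]mulrA.
have th20 : 2%:R * theta != 0 by rewrite mulf_neq0.
have d20 : 2%:R * d != 0 by rewrite mulf_neq0.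
have lamsE : lams (2%:R * theta) = ratio / lam (2%:R * d).
  rewrite (ratio_sqrt D0 dd) /star two_theta (lamV hlam) // !sqrt_nabs ?invr_eq0 //.
  by rewrite valV // opprK -invr_expz mulrC.
have ovtl : ov (tau beta * lams (2%:R * theta)) = 0%E.
  rewrite (ov_unitM hCp) ?ov_tau // lamsE (ov_unitM hCp) //.
  by rewrite (ov_unitV hCp) // ov_lam.
have WE : ratio * (V N' * V b) * (ratio * (A beta * V M)) = U * (ratio * q ^ vF (2%:R * D)).
  have -> : q ^ vF (2%:R * D) = V b * V M.
    have cF2 := self_dual_sqr hFv hpsi hm (res_dualF S).
    rewrite /V mulrACA -expr2 cF2 -!expfzDr ?q_neq0 //; congr (_ ^ _); rewrite ME.
    by move: (vF _); clear; lia.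
  by rewrite /U; ring.
have ovqD : ov (q ^ vF (2%:R * D)) = 0%E by apply: (ov_unitXz hCp); exact: ov_q.
have ovW : ov (ratio * (V N' * V b) * (ratio * (A beta * V M))) = 0%E.
  by rewrite WE (ov_unitM hCp) // (ov_unitM hCp).
apply: (congM hCp) => //; [|by rewrite (cong_unit hCp rhoc)|by rewrite (ov_unitM hCp) ?ovtl].
apply: (cong_trans hCp (y := U * (c0 * q ^ (- vF a)) * (tau beta * lams (2%:R * theta))));
  last first.
  apply: (congM hCp); rewrite ?ovtl //; last 1 first.
  - by rewrite (ov_unitM hCp) // (ov_unitM hCp) // ovqa.
  - apply: (cong_sym hCp); move: Jc; rewrite /U; congr (cong J _); ring.
  exact: (cong_refl hCp).
rewrite WE -mulrA; apply: (congMl hCp); first by rewrite ovU.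
have bA0 : beta%:A != 0 :> Kv by rewrite alg_eq0.
have -> : c0 * q ^ (- vF a) * (tau beta * lams (2%:R * theta)) =
    ratio * q ^ vF (2%:R * D) * tau beta * ((lam beta%:A)^-1 * nabs vF beta).
  have -> : q ^ (- vF a) = q ^ vF (2%:R * D) * nabs vF beta.
    rewrite /nabs (negPf b0) -expfzDr ?q_neq0 //; congr (_ ^ _).
    have -> : vF a = vF beta - vF (2%:R * D).
      by rewrite [LHS]valM ?oppr_eq0 ?invr_eq0 // valN // valV.
    by move: (vF _) (vF _); clear; lia.
  rewrite lamsE /c0 (lamM hlam) ?invr_eq0 // (lamV hlam) // invfM invrK.
  by field; rewrite !(lam_neq0 hlam).
have tt : tau beta * tau beta = 1.
  by case: (tau_sign beta) => ->; rewrite ?mulrNN mulr1.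
rewrite -[X in cong X _]mulr1 -[X in cong (_ * X) _]tt [X in cong X _]mulrA; apply: (congMl hCp).
  by rewrite (ov_unitM hCp) ?ov_tau // (ov_unitM hCp) // ovqD.
by apply: (cong_sym hCp); exact: tau_lam_inv.
Qed.

(** * Residually trivial characters *)

Section CongruentToOne.

Hypothesis lam_cong1 : forall z, z != 0 -> cong (lam z) 1.

Lemma e_eq1 : e = 1.
Proof.
apply: tau_units_e1 => x xn vx; apply: tau_lam1 => //.
by apply: lam_cong1; rewrite alg_eq0.
Qed.

Lemma vK_alg (x : Fv) : vK x%:A = vF x.
Proof. by rewrite vKe e_eq1 mul1r. Qed.

(** At a uniformizer of Fv, 1 is congruent to tau |.| = -1/q. *)
Lemma q_congN1 : cong q (-1).
Proof.
have [xn vx] := uniformizerP hF; set x := uniformizer vF in xn vx.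
have ovq := ov_q; have xA0 : x%:A != 0 :> Kv by rewrite alg_eq0.
have := cong_trans hCp (cong_sym hCp (lam_cong1 xA0)) (lamF xn).
rewrite (tau_pi e_eq1 vx) /nabs (negPf xn) vx mulN1r.
move=> /(congMl hCp (a := q)); rewrite ovq => /(_ (lexx _)).
by rewrite mulrN mulr1 -invr_expz expr1z divff // q_neq0.
Qed.

Lemma congXz x y (n : int) : ov y = 0%E -> cong x y -> cong (x ^ n) (y ^ n).
Proof.
move=> y0 xy; case: n => n; first by apply: (congX hCp); rewrite ?y0.
rewrite !NegzE -!exprnN; apply: (congV hCp); first exact: (ov_unitX hCp).
by apply: (congX hCp); rewrite ?y0.
Qed.

Lemma ov_N1 : ov (-1) = 0%E.
Proof. by apply: (ov_sqr1 hCp); rewrite sqrrN expr1n. Qed.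

Lemma qX_cong (n : int) : cong (q ^ n) ((-1) ^ n).
Proof. by apply: congXz; [exact: ov_N1|exact: q_congN1]. Qed.

(** q + 1 is a rational integer in the maximal ideal, hence divisible by p. *)
Lemma q_succ_ge1 : (1 <= ov (q + 1)%R)%E.
Proof.
rewrite natr1; apply: (ov_dvd_ge1 hCp); apply: (ov_nat_dvd pp hCp (iota_p := iota_p)).
by have := q_congN1; rewrite /congr_p opprK natr1.
Qed.

Lemma lam_unitsF (x : Fv) : x != 0 -> vF x = 0 -> lam x%:A = 1.
Proof.
move=> xn vx; apply: (@lam_units _ _ _ _ hCp iota_p _ vF (fun x => lam x%:A)) => //.
- exact: ov_q.
- split=> [y y0|y z y0 z0|]; first by rewrite (lam_neq0 hlam) // alg_eq0.
    by rewrite algM (lamM hlam) ?alg_eq0.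
  case: hlam => _ _ [n n0 hn]; exists n => // y ny; apply: hn.
  have : ball vK (e * n) ((y - 1)%:A : Kv) by apply/(ball_alg H).
  by rewrite e_eq1 mul1r algD algN scale1r.
- by move=> z z0; apply: lam_cong1; rewrite alg_eq0.
have : cong (1 - q^-1) (1 + 1).
  apply: (congD hCp); first exact: (cong_refl hCp).
  have := congN hCp (congV hCp ov_N1 q_congN1).
  by rewrite invrN invr1 opprK.
by move=> /(cong_unit hCp); apply; rewrite -[1 + 1]/(2%:R) (ov2 pp podd hCp).
Qed.

Lemma lam_near1 u : ball vK 1 (u - 1) -> lam u = 1.
Proof. exact (lam_tame hCp hKv ov_qK hlam lam_cong1 (u := u)). Qed.

Lemma q_neq1 : q != 1.
Proof.
apply/eqP => q1; have := q_congN1; rewrite q1 /congr_p opprK -[1 + 1]/(2%:R).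
by rewrite (ov2 pp podd hCp) ltxx.
Qed.

(** The exponent of the different of O_F + O_F omega. It is carried along symbolically: it enters
    the conductor of [psi_ext] and the valuation of 2 d, and cancels in the final parity. *)
Definition kappa : int := vK (omega - bar omega).

Lemma omega_diff (x : Fv) : x%:A - omega != 0.
Proof.
apply/negP; rewrite subr_eq0 => /eqP ox; have := xd_neq0 (- (t * x + x0)).
by rewrite (orth_dE O) -ox algN algD algM addNr eqxx.
Qed.

Lemma bar_omega : exists s : Fv, omega + bar omega = s%:A.
Proof. by apply: (bar_fixed H); rewrite rmorphD (barK H) addrC. Qed.

Lemma bar_omega_neq : omega - bar omega != 0.
Proof.
apply/eqP => h; have [x hx] : exists x : Fv, omega = x%:A.
  by apply: (bar_fixed H); apply/eqP; rewrite eq_sym -subr_eq0 h.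
by have := omega_diff x; rewrite -hx subrr eqxx.
Qed.

Lemma ball_omega n (x y : Fv) :
  ball vK n (x%:A + y%:A * omega) <-> ball vF n x /\ ball vF n y.
Proof. by have := ball_orth H O n x y; rewrite e_eq1 mul1r. Qed.

(** In coordinates omega - bar omega is -s + 2 omega, so [kappa] is the least valuation among 2 and
    s, the coefficients of the trace tr (x + y omega) = 2 x + s y. *)
Lemma kappaP s : omega + bar omega = s%:A ->
  [/\ ball vF kappa s, ball vF kappa (2%:R : Fv) &
      ~ (ball vF (kappa + 1) s /\ ball vF (kappa + 1) (2%:R : Fv))].
Proof.
move=> sE; have E : omega - bar omega = (- s)%:A + (2%:R : Fv)%:A * omega.
  by rewrite algN -sE alg_nat; ring.
have := ballnn vK (omega - bar omega); rewrite -/kappa {1}E => /ball_omega[h1 h2].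
split=> //; first by rewrite -[s]opprK; apply: ballN.
case=> h3 h4; have : ball vK (kappa + 1) (omega - bar omega).
  by rewrite E; apply/ball_omega; split=> //; apply: ballN.
by rewrite ballE ?bar_omega_neq // -/kappa; ilia.
Qed.

Lemma psi_ext_omega s (x y : Fv) : omega + bar omega = s%:A ->
  psi_ext bar psi (x%:A + y%:A * omega) = psi (2%:R * x + s * y).
Proof.
move=> sE; rewrite /psi_ext; congr psi; apply: xget_unique => [|u].
  rewrite /= rmorphD rmorphM !(quad_bar_fix H) algD !algM alg_nat -sE; ring.
move=> hu; apply: (@alg_inj _ Kv); rewrite /= hu.
rewrite rmorphD rmorphM !(quad_bar_fix H) algD !algM alg_nat -sE; ring.
Qed.

Lemma psi_ext_conductor : nontrivial_additive_character vK (psi_ext bar psi) /\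
  conductor vK (psi_ext bar psi) (m - kappa).
Proof.
have [s sE] := bar_omega; have [ks k2 kn] := kappaP sE.
have cond : conductor vK (psi_ext bar psi) (m - kappa).
  split=> [z|]; have psiE := fun x y => psi_ext_omega x y sE.
    have [x [y ->]] := coords_omega H O z => /ball_omega[bx by_].
    rewrite psiE (psi_ball hm) //; apply: ballD => //.
      by apply: ball_le (ballM hF k2 bx); ilia.
    by apply: ball_le (ballM hF ks by_); ilia.
  case: hm => _ [u bu pu].
  have inv (a : Fv) : ball vF kappa a -> ~ ball vF (kappa + 1) a ->
      a != 0 /\ ball vF (m - kappa - 1) (u / a).
    move=> ka nka; have [a0 _] := not_ball nka.
    split=> //; rewrite mulrC ball_mull ?invr_eq0 // valV //; apply: ball_le bu.
    by move: ka nka; rewrite !ballE //; move: (vF a); clear; lia.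
  case: (pselect (ball vF (kappa + 1) (2%:R : Fv))) => h2.
    have [|s0 hu] := inv s ks; first by move=> h; apply: kn.
    exists ((0 : Fv)%:A + (u / s)%:A * omega).
      by apply/ball_omega; split=> //; left.
    by rewrite psiE mulr0 add0r mulrCA divff // mulr1.
  have [_ hu] := inv _ k2 h2; exists ((u / 2%:R)%:A + (0 : Fv)%:A * omega).
    by apply/ball_omega; split=> //; left.
  by rewrite psiE mulr0 addr0 mulrCA divff // mulr1.
split=> //; split.
- move=> z z'; have [x [y ->]] := coords_omega H O z.
  have [x' [y' ->]] := coords_omega H O z'.
  have -> : x%:A + y%:A * omega + (x'%:A + y'%:A * omega) =
    (x + x')%:A + (y + y')%:A * omega by rewrite !algD; ring.
  by rewrite !(psi_ext_omega _ _ sE) -(psiD hpsi); congr psi; ring.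
- by exists (m - kappa); case: cond.
by case: cond => _ [z _ hz]; exists z.
Qed.

Lemma cK_E : cK = q ^ (m - kappa).
Proof.
have [hpK hcK] := psi_ext_conductor; have := self_dual_sqr hKv hpK hcK (res_dualK S).
rewrite (qK_sqr e_eq1) [q ^+ 2]exprnP exprzAC -exprnP => /eqP.
have [cK0 _] := res_dualK S.
by rewrite eqrXn2 ?ltW ?exprz_gt0 ?q_gt0 // => /eqP.
Qed.

Lemma v_two_d : vK (2%:R * d) = vF t + kappa.
Proof.
have t0 := orth_t_neq0 O; have -> : 2%:R * d = t%:A * (omega - bar omega).
  have -> : 2%:R * d = d - bar d by rewrite (quad_bar_d H); ring.
  rewrite (orth_dE O) rmorphD rmorphM !(quad_bar_fix H); ring.
by rewrite valM ?alg_eq0 ?bar_omega_neq // vK_alg.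
Qed.

Let e1 : e = 1. Proof. exact: e_eq1. Qed.
Let X : algC := (sqrtC qK)^-1.
Let mK := m - kappa.
Let XE : X = q^-1. Proof. by rewrite /X (sqrt_qK e1). Qed.
Let qKE : qK = q ^+ 2. Proof. exact: (qK_sqr e1). Qed.
Let hpK := proj1 psi_ext_conductor.
Let hcK := proj2 psi_ext_conductor.
Let q1 : 1 - qK^-1 != 0.
Proof.
rewrite subr_eq0 eq_sym invr_eq1 qKE sqrf_eq1 negb_or q_neq1 /=.
apply/eqP => h; have := q_gt0 hFv; rewrite h.
by rewrite oppr_gt0 ltr10.
Qed.

Lemma lams_val z : z != 0 -> lams z = lam z * q ^ vK z.
Proof.
by move=> z0; rewrite /star sqrt_nabs // (sqrt_qK e1) -invr_expz invrK.
Qed.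

Lemma lams_cong z : z != 0 -> cong (lams z) ((-1) ^ vK z).
Proof.
move=> z0; rewrite lams_val // -[X in cong _ X]mul1r; apply: (congM hCp).
- exact: lam_cong1.
- exact: qX_cong _.
- by rewrite ov_lam.
by rewrite (ov_unitXz hCp) // ov_N1.
Qed.

Lemma lams_neq0 z : z != 0 -> lams z != 0.
Proof.
move=> z0; rewrite lams_val // mulf_neq0 ?(lam_neq0 hlam) //; exact: qz_neq0.
Qed.

Lemma sign_inv (n : int) : ((-1) ^ n)^-1 = (-1) ^ n :> algC.
Proof. by rewrite invr_expz -exprz_inv invrN invr1. Qed.

(** * Epsilon factors of characters congruent to 1 *)

Section Unramified.
Hypothesis unr : unramified vK lam.
Let P := uniformizer vK.

Lemma lams_unram z : z != 0 -> lams z = lams P ^ vK z.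
Proof.
move=> z0; have [P0 vP] := uniformizerP hK.
rewrite !lams_val // vP expr1z expfzMl; congr (_ * _).
rewrite -(lamXz hlam) //.
have zP0 : z / P ^ vK z != 0 by rewrite mulf_neq0 ?invr_eq0 ?expfz_neq0.
have vzP : vK (z / P ^ vK z) = 0.
  by rewrite valM ?invr_eq0 ?expfz_neq0 // valV // val_pi // subrr.
rewrite -[RHS]mulr1 -(unr zP0 vzP) -(lamM hlam) ?expfz_neq0 //.
by congr lam; rewrite mulrCA divff ?mulr1 // expfz_neq0.
Qed.

(* Only the lowest shell survives the Euler factor. *)
Let zeta_ball (chi : Kv -> algC) (g a : algC) (j : int) : g != 0 -> a != 0 ->
  (forall z, z != 0 -> chi z = g ^ vK z) ->
  zeta_over_L vK cK chi (fun z => a * ind (ball vK j) z) X =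
    a * g ^ j * X ^ j * (cK * (1 - qK^-1)).
Proof.
move=> g0 a0 chiE; have [P0 vP] := uniformizerP hK.
have LE : L_coef vK chi = g.
  rewrite /L_coef; case: asboolP => [_|[]]; first by rewrite chiE // vP expr1z.
  by move=> u u0 vu; rewrite chiE // vu expr0z.
have sh (n : int) : shell_integral vK cK chi (fun z => a * ind (ball vK j) z) n =
    if j <= n then a * g ^ n * (cK * (1 - qK^-1)) else 0.
  rewrite shell_integralE; case: ifP => jn.
    transitivity (qK ^ n * haar vK cK (fun z => a * g ^ n * shell vK n z)).
      congr (_ * haar _ _ _); apply/funext => z.
      case: (shellP vK n z) => [[z0 [vz ->]]|->]; last by rewrite mul0r mulr0.
      rewrite mul1r mulr1 chiE // vz ind1 ?mulr1 //.
      by apply/ballE => //; rewrite vz.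
    rewrite haarZ ?haar_shell //; last exact: schwartz_shell.
    by rewrite -invr_expz; field; rewrite expfz_neq0 gt_eqF ?q_gt0.
  transitivity (qK ^ n * haar vK cK (fun=> 0)); last by rewrite haar0 ?mulr0.
  congr (_ * haar _ _ _); apply/funext => z.
  case: (shellP vK n z) => [[z0 [vz ->]]|->]; last by rewrite mul0r.
  by rewrite ind0 ?(mulr0, mul0r) // ballE // vz jn.
rewrite (zeta_finite (a := j) (k := 1)); last first.
  move=> n hn; rewrite /zeta_term LE !sh.
  have [jn|jn] := leP j n; last first.
    have -> : (j <= n - 1) = false by move: jn; clear; lia.
    by rewrite mulr0 subr0 mul0r.
  have -> : (j <= n - 1) = true by move: hn jn; clear; lia.
  have -> : g ^ n = g * g ^ (n - 1).
    transitivity (g ^ (1 + (n - 1))); first by congr (exprz _ _); clear; lia.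
    by rewrite expfzDr // expr1z.
  by ring.
rewrite big_ord1 addr0 /zeta_term LE !sh lexx.
have -> : (j <= j - 1) = false by clear; lia.
by rewrite mulr0 subr0; ring.
Qed.

(** The functional equation for the indicator of the integers of Kv gives [eps] as the inverse of
    g^mK, where g is the Frobenius eigenvalue, congruent to -1. *)
Lemma eps_unram : cong eps ((-1) ^ mK).
Proof.
have [P0 vP] := uniformizerP hK; have g0 := lams_neq0 P0; set g := lams P in g0.
have sb := schwartz_ball hKv 0.
have := heps sb; rewrite -/X.
have -> : ind (ball vK 0) = (fun z => 1 * ind (ball vK 0) z).
  by apply/funext => z; rewrite mul1r.
have fE : fourier vK cK (psi_ext bar psi) (fun z => 1 * ind (ball vK 0) z) =
    (fun z => cK * ind (ball vK mK) z).
  have -> : (fun z => 1 * ind (ball vK 0) z) = ind (ball vK 0).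
    by apply/funext => z; rewrite mul1r.
  by apply/funext => z; rewrite (fourier_ball hKv hpK hcK) oppr0 expr0z mulr1 subr0.
have cK0 : cK != 0 by rewrite cK_E; exact: qz_neq0.
rewrite fE (zeta_ball (g := g^-1)) ?invr_eq0 //; last first.
  by move=> z z0; rewrite (lams_unram z0) -/g exprz_inv invr_expz.
rewrite (zeta_ball (g := g)) ?oner_neq0 //; last exact: lams_unram.
rewrite !expr0z !mulr1 mul1r => /(mulIf (mulf_neq0 cK0 q1)) <-.
rewrite {1}cK_E -/mK XE.
have -> : q ^ mK * g^-1 ^ mK * q^-1 ^ mK = (g ^ mK)^-1.
  rewrite !exprz_inv -!invr_expz; field.
  by rewrite !expfz_neq0 // q_neq0.
have gc : cong g (-1) by have := lams_cong P0; rewrite vP expr1z.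
have h := congV hCp (ov_unitXz hCp mK ov_N1) (congXz mK ov_N1 gc).
by rewrite sign_inv in h.
Qed.

End Unramified.

Hypothesis ram : ~ unramified vK lam.

Lemma ramified_unit : exists u, [/\ u != 0, vK u = 0 & lam u != 1].
Proof.
apply: contrapT => no; apply: ram => u u0 vu; apply/eqP/negPn/negP => lu.
by apply: no; exists u.
Qed.

(* The Gauss sum of a tame character: only the shell of valuation [mK - 1]
   contributes, and there [lam] is congruent to 1. *)
Lemma eps_ram : cong eps (- (-1) ^ mK).
Proof.
have [w [w0 vw lw]] := ramified_unit.
have cK0 : cK != 0 by rewrite cK_E; exact: qz_neq0.
have near1 u : ball vK 1 (u - 1) -> lam u = 1 by exact: lam_near1.
have L0 : L_coef vK lams = 0 /\ L_coef vK (fun z => (lams z)^-1) = 0.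
  rewrite /L_coef; split; case: asboolP => // unr; case/eqP: lw;
    have := unr w w0 vw; rewrite lams_val // vw expr0z mulr1 //.
  by move=> h; rewrite -[LHS]invrK h invr1.
have [k k0 [hk1 hk2]] := mulinv_star.
have hk2V := mulinv_comp (fun x => x^-1) hk2.
have hk1V := mulinv_comp (fun x => x^-1) hk1.
pose f z := ind (ball vK 1) (z - 1).
have sf : schwartz vK f by apply: (schwartz_shift hKv (-1)); exact: schwartz_ball.
have hf : haar vK cK f = cK / qK.
  by rewrite /f (haar_shift hKv cK (-1)) ?haar_ball //; exact: schwartz_ball.
have fT z : ball vK 1 (z - 1) -> f z = 1 by move=> h; rewrite /f ind1.
have zf : zeta_over_L vK cK lams f X = cK / qK.
  rewrite (zeta_finite (a := 0) (k := 1)).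
    rewrite big_ord1 addr0 /zeta_term (proj1 L0) mul0r subr0 expr0z mulr1.
    rewrite shell_integralE expr0z mul1r -hf; congr haar; apply/funext => z.
    case: (pselect (ball vK 1 (z - 1))) => bz; last by rewrite /f ind0 ?mul0r ?mulr0.
    have [z0 vz] := ball1_unit hK bz.
    by rewrite (shellT z0 vz) lams_val // vz expr0z near1 // !mulr1 mul1r.
  move=> n hn; rewrite /zeta_term (proj1 L0) mul0r subr0 shell_integralE.
  have -> : (fun z => shell vK n z * (f z * lams z)) = (fun=> 0).
    apply/funext => z.
    case: (pselect (ball vK 1 (z - 1))) => bz; last by rewrite /f ind0 ?mul0r ?mulr0.
    have [z0 vz] := ball1_unit hK bz; rewrite shellF ?mul0r //; right.
    by rewrite vz; move: hn; clear; lia.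
  by rewrite haar0 // mulr0 mul0r.
pose n := mK - 1.
have fE y : fourier vK cK (psi_ext bar psi) f y =
    cK / qK * (psi_ext bar psi (- y) * ind (ball vK n) y).
  transitivity (psi_ext bar psi (- y) *
      fourier vK cK (psi_ext bar psi) (ind (ball vK 1)) y); last first.
    by rewrite (fourier_ball hKv hpK hcK) -[qK ^ (- 1)]/(qK^-1) mulrCA.
  rewrite /fourier -haarZ //; last first.
    by apply: (schwartz_psiN hKv hpK hcK); exact: schwartz_ball.
  rewrite -[LHS](haar_shift hKv cK 1); last exact: (schwartz_psiN hKv hpK hcK).
  congr haar; apply/funext => z; rewrite /f addrK mulrDl mul1r opprD (psiD hpK).
  by rewrite [psi_ext bar psi (- (z * y)) * _]mulrC mulrCA.
pose g y := shell vK n y * psi_ext bar psi (- y).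
have sg : schwartz vK g.
  have -> : g = (fun y => shell vK n y * psi_ext bar psi (- (y * 1))).
    by apply/funext => y; rewrite mulr1.
  by apply: (schwartz_psiN hKv hpK hcK); exact: schwartz_shell.
have sgl : schwartz vK (fun y => g y * (lam y)^-1).
  apply: (schwartz_annulus hKv (b := n + 1) k0 sg _ hk1V) => y by_.
  by rewrite /g /shell !ind1 ?subrr ?mul0r //; apply: ball_le by_; clear; lia.
have hatE : zeta_over_L vK cK (fun z => (lams z)^-1)
    (fourier vK cK (psi_ext bar psi) f) X = cK / qK * haar vK cK (fun y => g y * (lam y)^-1).
  rewrite (zeta_finite (a := n) (k := 1)).
    rewrite big_ord1 addr0 /zeta_term (proj2 L0) mul0r subr0 shell_integralE.
    rewrite -haarZ // mulrAC -haarZ //.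
      congr haar; apply/funext => y.
      case: (shellP vK n y) => [[y0 [vy sy]]|sy]; last by rewrite /g sy !mul0r !mulr0.
      rewrite /g sy fE lams_val // vy ind1; last by right; rewrite vy.
      rewrite XE qKE !exprz_inv -!invr_expz [q ^+ 2]exprnP exprzAC -exprnP.
      by field; rewrite expfz_neq0 ?(lam_neq0 hlam) ?q_neq0.
    have -> : (fun y => shell vK n y * (fourier vK cK (psi_ext bar psi) f y * (lams y)^-1)) =
      (fun y => cK / qK * (shell vK n y * psi_ext bar psi (- y) * ind (ball vK n) y) *
         (lams y)^-1).
      by apply/funext => y; rewrite fE; ring.
    apply: (schwartz_annulus hKv (b := n + 1) k0 _ _ hk2V) => [|y by_]; last first.
      by rewrite /shell !ind1 ?subrr ?mul0r ?mulr0 //; apply: ball_le by_; clear; lia.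
    apply: schwartzZ => //; have -> : (fun y => shell vK n y * psi_ext bar psi (- y) *
        ind (ball vK n) y) = g; last exact: sg.
    apply/funext => y; rewrite /g; case: (shellP vK n y) => [[y0 [vy sy]]|->].
      by rewrite ind1 ?mulr1 //; right; rewrite vy.
    by rewrite !mul0r.
  move=> j hj; rewrite /zeta_term (proj2 L0) mul0r subr0 shell_integralE.
  have [jn|jn] := ltP j n.
    have -> : (fun z => shell vK j z * (fourier vK cK (psi_ext bar psi) f z * (lams z)^-1)) =
        (fun=> 0).
      apply/funext => z; rewrite fE; case: (shellP vK j z) => [[z0 [vz _]]|->].
        by rewrite ind0 ?(mulr0, mul0r) // ballE // vz; move: jn; clear; lia.
      by rewrite mul0r.
    by rewrite haar0 // mulr0 mul0r.
  (* On these shells [psi_ext] is trivial, and the ramified character integrates to 0. *)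
  have jm : mK <= j by move: hj jn; rewrite /n; clear; lia.
  rewrite (@haar_mtwist0 _ _ hKv cK _ w (lam w)^-1) ?mulr0 ?mul0r //.
  - have -> : (fun z => shell vK j z * (fourier vK cK (psi_ext bar psi) f z * (lams z)^-1)) =
        (fun z => cK / qK * (shell vK j z * (lams z)^-1)).
      apply/funext => z; rewrite fE; case: (shellP vK j z) => [[z0 [vz ->]]|->].
        have bz : ball vK mK z by right; rewrite vz.
        rewrite (psi_ball hcK) ?ind1; [ring|by apply: ball_le bz; rewrite /n; clear; lia|].
        exact: ballN.
      by rewrite !mul0r mulr0.
    by apply: schwartzZ => //; apply: (schwartz_shell_mul _ _ k0 hk2V).
  - by rewrite invr_eq1.
  move=> z; rewrite (shell_mul hKv) // !fE.
  case: (shellP vK j z) => [[z0 [vz ->]]|->]; last by rewrite !mul0r mulr0.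
  have bz : ball vK mK z by right; rewrite vz.
  have bwz : ball vK mK (w * z) by rewrite ball_mull // vw subr0.
  have le_n : n <= mK by rewrite /n; clear; lia.
  rewrite !(psi_ball hcK) ?ind1; try (by apply: (ball_le le_n)); try exact: ballN.
  rewrite !lams_val ?mulf_neq0 // valM // vw add0r (lamM hlam) // !mul1r.
  by field; rewrite !(lam_neq0 hlam) // expfz_neq0 // q_neq0.
have := heps sf; rewrite -/X hatE zf [eps * _]mulrC.
have cq0 : cK / qK != 0 by rewrite mulf_neq0 // invr_eq0 q_neq0.
move=> /(mulfI cq0) <-.
have ovcK : (0 <= ov cK)%E.
  by rewrite cK_E (ov_unitXz hCp) //; exact: ov_q.
(* With [lam] replaced by 1 there remains the integral of [psi_ext] over the shell n: it is 0 on
   [ball vK n], so only minus the measure of [ball vK mK] is left. *)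
apply: (cong_trans hCp (y := haar vK cK g)).
  apply: (cong_haar hCp hKv ov_qK) => // y; rewrite -[X in cong _ X]mulr1 /g.
  case: (shellP vK n y) => [[y0 [vy ->]]|->]; last by rewrite !mul0r; exact: (cong_refl hCp).
  apply: (congMl hCp).
    rewrite mul1r; have [a [b ->]] := coords H y.
    have -> : - (a%:A + b%:A * d) = (- a)%:A + (- b)%:A * d by rewrite !algN; ring.
    by rewrite (psi_extE H) ov_psi.
  by have := congV hCp (ov1 hCp iota_p) (lam_cong1 y0); rewrite invr1.
have -> : haar vK cK g = - (q ^ (- mK)).
  have E j : haar vK cK (fun y => ind (ball vK j) y * psi_ext bar psi (- (y * 1))) =
      cK * qK ^ (- j) * ind (ball vK (mK - j)) 1.
    by rewrite -(fourier_ball hKv hpK hcK).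
  have -> : g = (fun y => ind (ball vK n) y * psi_ext bar psi (- (y * 1)) -
      ind (ball vK (n + 1)) y * psi_ext bar psi (- (y * 1))).
    by apply/funext => y; rewrite /g /shell mulr1 mulrBl.
  rewrite haarB //; try by apply: (schwartz_psiN hKv hpK hcK); exact: schwartz_ball.
  rewrite !E ind0; last by rewrite ballE ?oner_neq0 // val1 // /n; clear; lia.
  rewrite ind1; last by right; rewrite val1 // /n; clear; lia.
  rewrite mulr0 mulr1 sub0r; congr (- _).
  have -> : - (n + 1) = - mK by rewrite /n; clear; lia.
  rewrite cK_E -/mK qKE -!invr_expz [q ^+ 2]exprnP exprzAC -exprnP.
  by field; rewrite expfz_neq0 // q_neq0.
have := congN hCp (qX_cong (- mK)).
by have -> : (-1) ^ (- mK) = (-1) ^ mK :> algC by rewrite -invr_expz sign_inv.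
Qed.

(** * Explicit Fourier coefficients along the line Fv + omega *)

Variable varpi : Fv.
Hypotheses (varpi_neq0 : varpi != 0) (v_varpi : vF varpi = 1).
Let near1 u : ball vK 1 (u - 1) -> lam u = 1. Proof. exact: lam_near1. Qed.
Let unitF (x : Fv) : x != 0 -> vF x = 0 -> lam x%:A = 1.
Proof. exact: lam_unitsF. Qed.
Let vKA (x : Fv) : vK x%:A = vF x. Proof. exact: vK_alg. Qed.
Let ball_om n (x y : Fv) :
  ball vK n (x%:A + y%:A * omega) <-> ball vF n x /\ ball vF n y.
Proof. exact: ball_omega. Qed.
Let v_om : vK omega = 0. Proof. by rewrite (orth_v_omega O) e1 subrr. Qed.
Let om0 : omega != 0. Proof. exact: orth_omega_neq0 O. Qed.

Lemma xom_neq0 (x : Fv) : x%:A + omega != 0.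
Proof. by have := omega_diff (- x); rewrite algN -opprD oppr_eq0. Qed.

Lemma v_xom (x : Fv) : vK (x%:A + omega) <= 0.
Proof.
rewrite leNgt; apply/negP => lt; have : ball vK 1 (x%:A + (1 : Fv)%:A * omega).
  by rewrite scale1r mul1r; apply: ball_val => //; exact: xom_neq0.
by move=> /ball_om[_]; rewrite ballE ?oner_neq0 // val1.
Qed.

Lemma v_xomO (x : Fv) : ball vF 0 x -> vK (x%:A + omega) = 0.
Proof.
move=> bx; apply/eqP; rewrite eq_le v_xom /=.
have : ball vK 0 (x%:A + (1 : Fv)%:A * omega).
  by apply/ball_om; split=> //; right; rewrite val1.
by rewrite scale1r mul1r ballE ?xom_neq0.
Qed.

Definition lam_inv (x : Fv) : algC := (lam (x%:A + omega))^-1.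

(** As x + omega has valuation at most 0, the shift multiplies it by an element of [ball vK 1]
    around 1, where the tame [lam] is trivial. *)
Lemma lam_inv_near x y : ball vF 1 y -> lam_inv (x + y) = lam_inv x.
Proof.
move=> by_; rewrite /lam_inv; congr (_^-1).
have -> : (x + y)%:A + omega = (x%:A + omega) * (1 + y%:A / (x%:A + omega)).
  by rewrite algD; field; exact: xom_neq0.
have b1 : ball vK 1 (y%:A / (x%:A + omega)).
  rewrite mulrC ball_mull ?invr_eq0 ?xom_neq0 // valV // opprK.
  have : ball vK 1 (y%:A : Kv) by have /(ball_alg H) := by_; rewrite e1 mul1r.
  by apply: ball_le; have := v_xom x; move: (vK _); clear; lia.
have b1' : ball vK 1 (1 + y%:A / (x%:A + omega) - 1) by rewrite addrAC subrr add0r.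
have [u0 _] := ball1_unit hK b1'.
by rewrite (lamM hlam) ?xom_neq0 // (near1 b1') mulr1.
Qed.

Lemma lamF_val (x : Fv) : x != 0 -> lam x%:A = lam varpi%:A ^ vF x.
Proof.
move=> xn; have vA : varpi%:A != 0 :> Kv by rewrite alg_eq0.
have pn : varpi ^ vF x != 0 by rewrite expfz_neq0.
have u0 : x / varpi ^ vF x != 0 by rewrite mulf_neq0 ?invr_eq0.
have vu : vF (x / varpi ^ vF x) = 0.
  by rewrite valM ?invr_eq0 // valV // valXz // v_varpi mulr1 subrr.
have -> : x%:A = varpi%:A ^ vF x * (x / varpi ^ vF x)%:A :> Kv.
  have -> : varpi%:A ^ vF x = (varpi ^ vF x)%:A :> Kv.
    case: (vF x) => j; first by rewrite -!exprnP algX.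
    by rewrite !NegzE -!exprnN algV algX.
  by rewrite -algM mulrCA divff ?mulr1.
by rewrite (lamM hlam) ?expfz_neq0 ?alg_eq0 // (lamXz hlam) // (unitF u0 vu) mulr1.
Qed.

Lemma lam_inv_far (x : Fv) : x != 0 -> vF x < 0 -> lam_inv x = lam varpi%:A ^ (- vF x).
Proof.
move=> xn vx; have xA : x%:A != 0 :> Kv by rewrite alg_eq0.
have b1 : ball vK 1 (1 + omega / x%:A - 1).
  rewrite addrAC subrr add0r; right; rewrite valM ?invr_eq0 // valV // v_om vKA.
  by move: vx; clear; lia.
have [u0 _] := ball1_unit hK b1.
have -> : lam_inv x = (lam x%:A)^-1.
  rewrite /lam_inv; have -> : x%:A + omega = x%:A * (1 + omega / x%:A).
    by rewrite mulrDr mulr1 mulrCA divff ?mulr1.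
  by rewrite (lamM hlam) // (near1 b1) mulr1.
by rewrite lamF_val // invr_expz.
Qed.

Definition trunc_omega (j : int) (x : Fv) : algC := ind (ball vF (- j)) x * lam_inv x.

Lemma sch_trunc_omega (j : int) : 0 <= j -> sch vF (- j) 1 (trunc_omega j).
Proof.
move=> j0; have le : - j <= 1 by move: j0; clear; lia.
apply: sch_mul => //; first exact: sch_ball.
by move=> x y _; exact: lam_inv_near.
Qed.

Lemma schwartz_trunc_omega j : 0 <= j -> schwartz vF (trunc_omega j).
Proof. by move=> /sch_trunc_omega; exact: sch_schwartz. Qed.

(** The substitution u = (x + x0) / t writes x + d as t (u + omega); [c0] collects the resulting
    units. *)
Lemma A_trunc_omega (beta : Fv) : beta != 0 -> exists c0, ov c0 = 0%E /\
  exists J : int, forall j : int, J <= j ->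
  A_coef vF vK cF psi lams theta beta = c0 * fourier vF cF psi (trunc_omega j) (t * beta).
Proof.
move=> b0; have t0 := orth_t_neq0 O; have tA : t%:A != 0 :> Kv by rewrite alg_eq0.
have [N0 [k hk]] := A_stable.
exists ((lam t%:A)^-1 * psi (x0 * beta) * q ^ vF t^-1); split.
  rewrite (ov_unitM hCp) ?(ov_unitXz hCp) ?ov_q // (ov_unitM hCp) ?ov_psi //.
  by rewrite (ov_unitV hCp) ?ov_lam.
have [J hJ] : exists J : int, forall j, J <= j -> [/\ 0 <= j, 0 <= j - vF t,
    (N0 <= absz (j - vF t)%R)%N, vF beta + k - m <= j - vF t & - (j - vF t) <= vF x0].
  move: (vF t) (vF x0) (vF beta) => a b c.
  exists (N0%:Z + `|a| + `|b| + `|c + k - m|); clear => j hj.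
  by split; lia.
exists J => j /hJ[j0 n0 Nn bn xn]; pose n := absz (j - vF t).
have nE : n%:Z = j - vF t by rewrite /n; move: n0; clear; lia.
rewrite (hk beta n) //; last by rewrite nE.
have sT := schwartz_trunc_omega j0.
pose G u := trunc_omega j u * psi (- (u * (t * beta))).
have sG : schwartz vF G by exact: (schwartz_psiN hFv hpsi hm).
have sGt := schwartz_scale hFv (invr_neq0 t0) sG.
have -> : fourier vF cF psi (trunc_omega j) (t * beta) = haar vF cF G by [].
rewrite -[RHS]mulrA -(haar_scale hFv cF (invr_neq0 t0) sG).
rewrite -[in RHS](haar_shift hFv cF x0 sGt) -(haarZ hFv);
  last exact: (schwartz_shift hFv x0 sGt).
congr haar; apply/funext => x; rewrite /trunc /G /trunc_omega.
have -> : ind (ball vF (- n%:Z)) x = ind (ball vF (- j)) (t^-1 * (x + x0)).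
  apply: ind_equiv; rewrite ball_mull ?invr_eq0 // valV // opprK nE.
  have -> : - j + vF t = - (j - vF t) by clear; lia.
  by rewrite ballDr //; apply: ball_le xn (@ballnn _ vF x0).
have -> : x%:A + d = t%:A * ((t^-1 * (x + x0))%:A + omega).
  by rewrite (orth_dE O) algM algV algD; field.
rewrite (lamM hlam) ?xom_neq0 // /lam_inv invfM.
have -> : - (x * beta) = x0 * beta - t^-1 * (x + x0) * (t * beta) by field.
by rewrite (psiD hpsi); ring.
Qed.

Lemma trunc_omega_succ (j : nat) (x : Fv) : trunc_omega (j%:Z + 1) x = trunc_omega j x +
  lam varpi%:A ^ (j%:Z + 1) * (ind (ball vF (- (j%:Z + 1))) x - ind (ball vF (- j%:Z)) x).
Proof.
rewrite /trunc_omega; case: (pselect (ball vF (- j%:Z) x)) => bj.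
  have b1 : ball vF (- (j%:Z + 1)) x by apply: ball_le bj; clear; lia.
  by rewrite !ind1 // subrr mulr0 addr0.
rewrite (ind0 bj) mul0r add0r subr0.
case: (pselect (ball vF (- (j%:Z + 1)) x)) => b1; last by rewrite (ind0 b1) mul0r mulr0.
have [xn _] := not_ball bj.
have vx : vF x = - (j%:Z + 1).
  by move: bj b1; rewrite !ballE //; move: (vF x); clear; lia.
rewrite ind1 // mul1r mulr1 lam_inv_far // vx ?opprK //; clear; lia.
Qed.

Lemma fourier_trunc_omega_succ (j : nat) b :
  fourier vF cF psi (trunc_omega (j%:Z + 1)) b = fourier vF cF psi (trunc_omega j) b +
  cF * lam varpi%:A ^ (j%:Z + 1) * (q ^ (j%:Z + 1) * ind (ball vF (m + (j%:Z + 1))) b -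
     q ^ j%:Z * ind (ball vF (m + j%:Z)) b).
Proof.
have sb i := schwartz_ball hFv i.
have sp f : schwartz vF f -> schwartz vF (fun x => f x * psi (- (x * b))).
  exact: (schwartz_psiN hFv hpsi hm).
have sT := schwartz_trunc_omega (_ : 0 <= j%:Z).
have sd : schwartz vF (fun x => ind (ball vF (- (j%:Z + 1))) x - ind (ball vF (- j%:Z)) x).
  have -> : (fun x => ind (ball vF (- (j%:Z + 1))) x - ind (ball vF (- j%:Z)) x) =
    (fun x => ind (ball vF (- (j%:Z + 1))) x + (-1) * ind (ball vF (- j%:Z)) x).
    by apply/funext => x; rewrite mulN1r.
  by apply: schwartzD => //; apply: schwartzZ.
transitivity (haar vF cF (fun x => trunc_omega j x * psi (- (x * b)) +
   lam varpi%:A ^ (j%:Z + 1) * ((ind (ball vF (- (j%:Z + 1))) x - ind (ball vF (- j%:Z)) x) *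
     psi (- (x * b))))).
  by congr haar; apply/funext => x; rewrite trunc_omega_succ mulrDl mulrA.
rewrite haarD //; [|by apply: sp; apply: sT|by apply: schwartzZ => //; exact: sp].
congr (_ + _); rewrite haarZ //; last exact: sp.
have -> : (fun x => (ind (ball vF (- (j%:Z + 1))) x - ind (ball vF (- j%:Z)) x) *
    psi (- (x * b))) = (fun x => ind (ball vF (- (j%:Z + 1))) x * psi (- (x * b)) -
      ind (ball vF (- j%:Z)) x * psi (- (x * b))).
  by apply/funext => x; rewrite mulrBl.
rewrite haarB //; try exact: sp.
have E i : haar vF cF (fun x => ind (ball vF i) x * psi (- (x * b))) =
  cF * q ^ (- i) * ind (ball vF (m - i)) b by exact: (fourier_ball hFv hpsi hm).
by rewrite !E !opprK; ring.
Qed.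

Let qF1 : 1 - q^-1 != 0.
Proof. by rewrite subr_eq0 eq_sym invr_eq1 q_neq1. Qed.

Lemma lam_near_unit (x y : Fv) : x%:A + y%:A * omega != 0 ->
  vK (x%:A + y%:A * omega) = 0 -> ball vF 1 y -> lam (x%:A + y%:A * omega) = 1.
Proof.
move=> z0 vz b1; have [bx _] : ball vF 0 x /\ ball vF 0 y by apply/ball_om; right; rewrite vz.
have nx : ~ ball vF 1 x by move=> bx1; have /ball_om := conj bx1 b1; rewrite ballE // vz.
have [xn vx] := val_eq bx nx.
have xA : x%:A != 0 :> Kv by rewrite alg_eq0.
have -> : x%:A + y%:A * omega = x%:A * (1 + (y / x)%:A * omega) by rewrite algM algV; field.
have bu : ball vK 1 (1 + (y / x)%:A * omega - 1).
  rewrite addrAC subrr add0r -[_ * omega]add0r -(scale0r (1 : Kv)).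
  apply/ball_om; split; first by left.
  by rewrite mulrC ball_mull ?invr_eq0 // valV // vx oppr0 subr0.
have [w0 _] := ball1_unit hK bu.
by rewrite (lamM hlam) // (near1 bu) (unitF xn vx) mulr1.
Qed.

(* [lam] sums to 0 over the unit shell of [Kv], which Fubini slices into the
   translates of [Fv + omega] and the units of [Fv]. *)
Lemma haar_lam_inv : haar vF cF (trunc_omega 0) = - (cF * q^-1).
Proof.
have [u [u0 vu lu]] := ramified_unit.
have [k k0 [hk _]] := mulinv_star.
have hkV := mulinv_comp (fun x => x^-1) hk.
pose f z := shell vK 0 z * (lam z)^-1.
have sf : schwartz vK f by apply: (schwartz_shell_mul hKv _ k0 hkV).
have : haar vK 1 f = 0.
  apply: (@haar_mtwist0 _ _ hKv 1 f u (lam u)^-1) => //; first by rewrite invr_eq1.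
  move=> z; rewrite /f (shell_mul hKv) //.
  case: (shellP vK 0 z) => [[z0 [vz ->]]|->]; last by rewrite !mul0r mulr0.
  by rewrite (lamM hlam) // invfM; ring.
rewrite (fubini_omega H O) // mul1r.
have sT := schwartz_trunc_omega (lexx 0).
pose I := haar vF 1 (trunc_omega 0).
(* For a unit y, scaling by y gives the slice I; for y in the maximal ideal, [lam] is 1 on the
   slice, which is the unit shell of Fv. *)
have -> : (fun y => haar vF 1 (fun x => f (x%:A + y%:A * omega))) =
    (fun y => I * shell vF 0 y + (1 - q^-1) * ind (ball vF 1) y).
  apply/funext => y; case: (pselect (ball vF 0 y)) => b0; last first.
    have b1 : ~ ball vF 1 y by move=> b1; apply: b0; apply: ball_le b1.
    have sy : shell vF 0 y = 0 by rewrite /shell (ind0 b0) add0r ind0 ?oppr0.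
    rewrite sy (ind0 b1) !mulr0 addr0.
    transitivity (haar vF 1 (fun=> 0)); last exact: haar0.
    congr haar; apply/funext => x; rewrite /f.
    have bz j : 0 <= j -> ~ ball vK j (x%:A + y%:A * omega).
      by move=> j0 /ball_om[_ /(ball_le j0)].
    by rewrite /shell !ind0 ?subrr ?mul0r //; exact: bz.
  case: (pselect (ball vF 1 y)) => b1.
    have sy : shell vF 0 y = 0 by rewrite /shell !ind1 ?subrr.
    rewrite sy mulr0 add0r (ind1 b1) mulr1.
    transitivity (haar vF 1 (shell vF 0)).
      congr haar; apply/funext => x; rewrite /f.
      have <- : shell vK 0 (x%:A + y%:A * omega) = shell vF 0 x.
        rewrite /shell /ind; congr (_%:R - _%:R); congr nat_of_bool; apply: asbool_equiv_eq;
          rewrite ball_om; split=> [[]|bx] //; split=> //; exact: ball_le b1.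
      case: (shellP vK 0 (x%:A + y%:A * omega)) => [[z0 [vz ->]]|->]; last by rewrite mul0r.
      by rewrite mul1r lam_near_unit ?invr1.
    by rewrite haar_shell // mul1r oppr0 expr0z mul1r.
  have [yn vy] := val_eq b0 b1.
  rewrite (shellT yn vy) (ind0 b1) mulr0 addr0 mulr1.
  have yA : y%:A != 0 :> Kv by rewrite alg_eq0.
  transitivity (haar vF 1 (fun x => trunc_omega 0 (y^-1 * x))); last first.
    by rewrite haar_scale ?invr_eq0 // valV // vy oppr0 expr0z mul1r.
  congr haar; apply/funext => x; rewrite /f /trunc_omega oppr0.
  have -> : x%:A + y%:A * omega = y%:A * ((y^-1 * x)%:A + omega).
    by rewrite algM algV; field.
  have -> : ind (ball vF 0) (y^-1 * x) = ind (ball vF 0) x.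
    by apply: ind_equiv; rewrite ball_mull ?invr_eq0 // valV // vy oppr0 subr0.
  have zn : y%:A * ((y^-1 * x)%:A + omega) != 0 by rewrite mulf_neq0 ?xom_neq0.
  rewrite (lamM hlam) ?xom_neq0 // (unitF yn vy) mul1r -/(lam_inv _); congr (_ * _).
  have vzE : y%:A * ((y^-1 * x)%:A + omega) = x%:A + y%:A * omega.
    by rewrite algM algV; field.
  rewrite vzE; case: (pselect (ball vF 0 x)) => bx.
    rewrite (ind1 bx) shellT // -?vzE //.
    rewrite valM ?xom_neq0 // vKA vy v_xomO //.
    by rewrite ball_mull ?invr_eq0 // valV // vy oppr0 subr0.
  have nb j : 0 <= j -> ~ ball vK j (x%:A + y%:A * omega).
    by move=> j0 /ball_om[/(ball_le j0)].
  by rewrite (ind0 bx) /shell !ind0 ?subrr //; exact: nb.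
have sb1 := schwartz_ball hFv 1.
rewrite haarD ?haarZ ?haar_shell ?haar_ball //; try (apply: schwartzZ => //);
  try exact: schwartz_shell.
(* The slices add up to (1 - 1/q) (I + 1/q), and q is not 1. *)
rewrite !mul1r [I * _]mulrC -[q ^ (-1)]/(q^-1) -mulrDr => /eqP.
rewrite mulf_eq0 (negPf qF1) /= => /eqP h.
by rewrite haar_c // -/I -(addrK q^-1 I) h sub0r mulrN.
Qed.

Let T0 j := trunc_omega j.
Let gamma := lams varpi%:A.
Let q0 : q != 0. Proof. exact: q_neq0. Qed.
Let cF0 : cF != 0. Proof. by case: (res_dualF S) => h _; rewrite gt_eqF. Qed.
Let ovN1 : ov (-1) = 0%E. Proof. exact: ov_N1. Qed.

Lemma gammaE : gamma = lam varpi%:A * q.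
Proof. by rewrite /gamma lams_val ?alg_eq0 // vKA v_varpi expr1z. Qed.

Lemma gamma_cong : cong gamma (-1).
Proof.
have vA : varpi%:A != 0 :> Kv by rewrite alg_eq0.
by have := lams_cong vA; rewrite vKA v_varpi expr1z.
Qed.

Lemma ov_gamma : ov gamma = 0%E.
Proof. by apply: (cong_unit hCp gamma_cong). Qed.

(* [q / cF] times the Fourier coefficient of [lam_inv] at valuation [m + r];
   a geometric sum of ratio [gamma = -1] modulo the maximal ideal. *)
Fixpoint coef_sum (r : nat) : algC :=
  if r is r'.+1 then coef_sum r' + gamma ^+ r * (q - gamma) else - (1 + gamma).

Lemma fourier_T0_zero b : ball vF m b -> fourier vF cF psi (T0 0) b = - (cF * q^-1).
Proof.
move=> bm; rewrite -haar_lam_inv /fourier; congr haar; apply/funext => x.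
rewrite /T0 /trunc_omega oppr0; case: (pselect (ball vF 0 x)) => bx;
  last by rewrite (ind0 bx) !mul0r.
by rewrite (psi_ball hm) ?mulr1 //; apply: ballN => //; have := ballM hF bx bm; rewrite add0r.
Qed.

Let step (j : nat) b : fourier vF cF psi (T0 j.+1) b = fourier vF cF psi (T0 j) b +
  cF / q * gamma ^+ j.+1 * (q * ind (ball vF (m + j.+1%:Z)) b - ind (ball vF (m + j%:Z)) b).
Proof.
have -> : j.+1%:Z = j%:Z + 1 by clear; lia.
rewrite /T0 fourier_trunc_omega_succ; congr (_ + _).
have -> : j%:Z + 1 = j.+1%:Z by clear; lia.
rewrite -!exprnP gammaE exprMn !exprS; field; exact: q0.
Qed.

(** Up to cF / q, the annulus i contributes (q - 1) gamma^i for 1 <= i <= r, then - gamma^(r + 1)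
    for i = r + 1, then nothing. The summand gamma^(j + 1) removes that last boundary term, which
    [coef_sum j] already contains. *)
Lemma fourier_coef_sum_le (r : nat) b : b != 0 -> vF b = m + r%:Z ->
  forall j, (j <= r)%N -> fourier vF cF psi (T0 j) b = cF / q * (coef_sum j + gamma ^+ j.+1).
Proof.
move=> b0 vb; elim=> [|j IHj] jr.
  rewrite fourier_T0_zero /=; first by rewrite expr1; ring.
  by apply/ballE => //; rewrite vb; clear; lia.
have b1 : ball vF (m + j.+1%:Z) b by apply/ballE => //; rewrite vb; move: jr; clear; lia.
have b2 : ball vF (m + j%:Z) b by apply/ballE => //; rewrite vb; move: jr; clear; lia.
rewrite step (IHj (ltnW jr)) (ind1 b1) (ind1 b2) /= [gamma ^+ j.+2]exprS; ring.
Qed.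

Lemma fourier_coef_sum (r : nat) b : b != 0 -> vF b = m + r%:Z ->
  forall j, (r < j)%N -> fourier vF cF psi (T0 j) b = cF / q * coef_sum r.
Proof.
move=> b0 vb; elim=> // j IHj; rewrite ltnS leq_eqVlt => /orP[/eqP <-|rj].
  rewrite step (fourier_coef_sum_le b0 vb) // ind0 ?ind1; [ring| |].
    by apply/ballE => //; rewrite vb.
  by rewrite ballE // vb; clear; lia.
rewrite step IHj // !ind0 ?mulr0 ?subr0 ?mulr0 ?addr0 //; rewrite ballE // vb;
  move: rj; clear; lia.
Qed.

Lemma fourier_T0_const b : ~ ball vF m b -> forall j : nat,
  fourier vF cF psi (T0 j) b = fourier vF cF psi (T0 0) b.
Proof.
move=> nb; have nb' (j : nat) : ~ ball vF (m + j%:Z) b.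
  by move=> h; apply: nb; apply: ball_le h; clear; lia.
by elim=> // j IHj; rewrite step IHj !ind0 // mulr0 subr0 mulr0 addr0.
Qed.

Let q_gamma : (0 < ov (q - gamma)%R)%E.
Proof. exact (cong_trans hCp q_congN1 (cong_sym hCp gamma_cong)). Qed.

(** Two consecutive terms add up to (1 + gamma) gamma^i (q - gamma), and q - gamma is in the maximal
    ideal. *)
Lemma coef_sum_even k : exists2 rho, (0 < ov rho)%E & coef_sum k.*2 = - (1 + gamma) * (1 + rho).
Proof.
elim: k => [|k [rho hrho IHk]]; first by exists 0; rewrite ?(ov0 hCp) //= addr0 mulr1.
exists (rho - gamma ^+ k.*2.+1 * (q - gamma)).
  apply: (ov_gtD hCp) => //; rewrite (ovN hCp) (ov_unitM hCp) //.
  by apply: (ov_unitX hCp); exact: ov_gamma.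
by rewrite doubleS /= IHk !exprS; ring.
Qed.

Lemma ov_coef_sum_even k : ov (coef_sum k.*2) = ov (1 + gamma).
Proof.
have [rho hrho ->] := coef_sum_even k; rewrite mulNr (ovN hCp) mulrC (ov_unitM hCp) //.
by rewrite (ov_eqDl hCp) (ov1 hCp).
Qed.

(** The unpaired term has factor q - gamma = (q + 1) - (1 + gamma), so the coefficient of 1 + gamma
    becomes - (1 + rho + gamma^i) with i odd, which is in the maximal ideal. *)
Lemma ov_coef_sum_odd k : (ov (1 + gamma)%R < ov (q + 1)%R)%E ->
  (ov (1 + gamma)%R < ov (coef_sum k.*2.+1))%E.
Proof.
move=> lt; have [rho hrho E] := coef_sum_even k.
have -> : coef_sum k.*2.+1 = - (1 + gamma) * (rho + (1 + gamma ^+ k.*2.+1)) +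
    gamma ^+ k.*2.+1 * (q + 1) by rewrite /= E; ring.
have g0 : 1 + gamma != 0.
  by apply/eqP => g0; move: lt; rewrite g0 (ov0 hCp) ltNge leey.
apply: (ov_gtD hCp); last first.
  by apply: (ov_gtM hCp) => //; rewrite (ov_unitX hCp) // ov_gamma.
rewrite (ovM hCp) (ovN hCp); have := ov_fin hCp iota_p g0.
case: (ov (1 + gamma)) => // a _; rewrite lteDl //.
apply: (ov_gtD hCp) => //.
have : cong (1 + gamma ^+ k.*2.+1) (1 + (-1) ^+ k.*2.+1).
  apply: (congD hCp); first exact: (cong_refl hCp).
  by apply: (congX hCp); [rewrite ovN1|exact: gamma_cong].
by rewrite -signr_odd /= odd_double expr1 subrr => /cong0.
Qed.

(** Subtracting 1 makes all values of order at least [mu_units] while leaving the Fourier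
    coefficients outside [ball vF m] unchanged. *)
Definition lam_dev (x : Fv) : algC := ind (ball vF 0) x * (lam_inv x - 1).

Lemma schwartz_lam_dev : schwartz vF lam_dev.
Proof.
have -> : lam_dev = (fun x => T0 0 x + (-1) * ind (ball vF 0) x).
  by apply/funext => x; rewrite /lam_dev /T0 /trunc_omega oppr0; ring.
apply: schwartzD => //; first exact: schwartz_trunc_omega.
by apply: schwartzZ => //; exact: schwartz_ball.
Qed.

Lemma fourier_lam_dev b : fourier vF cF psi lam_dev b =
  fourier vF cF psi (T0 0) b - cF * ind (ball vF m) b.
Proof.
have := fourier_ball hFv hpsi hm cF 0 b; rewrite oppr0 expr0z mulr1 subr0 => <-.
rewrite /fourier -haarB //.
- by congr haar; apply/funext => x; rewrite /lam_dev /T0 /trunc_omega oppr0; ring.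
- apply: (schwartz_psiN hFv hpsi hm); exact: schwartz_trunc_omega.
by apply: (schwartz_psiN hFv hpsi hm); exact: schwartz_ball.
Qed.

Lemma lam_unit_coords u : u != 0 -> vK u = 0 ->
  lam u = 1 \/ exists2 x : Fv, ball vF 0 x & lam u = lam (x%:A + omega).
Proof.
move=> u0 vu; have [x [y uE]] := coords_omega H O u.
have [bx by_] : ball vF 0 x /\ ball vF 0 y by apply/ball_om; rewrite -uE; right; rewrite vu.
case: (pselect (ball vF 1 y)) => b1.
  by left; rewrite uE lam_near_unit -?uE.
have [yn vy] := val_eq by_ b1.
have yA : y%:A != 0 :> Kv by rewrite alg_eq0.
right; exists (x / y); first by rewrite mulrC ball_mull ?invr_eq0 // valV // vy oppr0 subr0.
have -> : u = y%:A * ((x / y)%:A + omega) by rewrite uE algM algV; field.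
by rewrite (lamM hlam yA (xom_neq0 (x / y))) (unitF yn vy) mul1r.
Qed.

(** * Comparison of the coefficients with the infima *)

Local Notation M := (mu_p_units ord iota_p vK lam).
Local Notation mu := (mu_p ord iota_p lam).

Lemma ov_lam_inv x : ov (lam_inv x - 1) = ov (lam (x%:A + omega) - 1).
Proof.
have x0' := xom_neq0 x; rewrite /lam_inv.
have -> : (lam (x%:A + omega))^-1 - 1 = (lam (x%:A + omega))^-1 * - (lam (x%:A + omega) - 1).
  by field; rewrite (lam_neq0 hlam).
by rewrite (ov_unitM hCp) ?(ovN hCp) // (ov_unitV hCp) // ov_lam.
Qed.

Lemma mu_units_le u : u != 0 -> vK u = 0 -> (M <= ov (lam u - 1)%R)%E.
Proof. by move=> u0 vu; apply: ereal_inf_lbound; exists u. Qed.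

Lemma mu_units_le_lam_inv x : ball vF 0 x -> (M <= ov (lam_inv x - 1)%R)%E.
Proof.
move=> bx; rewrite ov_lam_inv; apply: mu_units_le; first exact: xom_neq0.
exact: v_xomO.
Qed.

(** Up to units of Fv, where [lam] is 1, only the points x + omega matter, and there [lam] depends
    on the residue class of x: the infimum runs over a finite set. *)
Lemma mu_units_attained : exists2 x, ball vF 0 x & M = ov (lam_inv x - 1).
Proof.
have [r hr] := reps_ex hFv (ler01 : 0 <= 1 :> int); have [rA _] := hr.
have [x0' x0r _] := reps_mem hr (@ball0 _ vF 0).
have [x xr xmin] := seq_argmin (fun x => ov (lam_inv x - 1)) x0r.
exists x; first exact: rA.
have bx : ball vF 0 x by exact: rA.
apply/eqP; rewrite eq_le mu_units_le_lam_inv //=; apply: le_ereal_inf_tmp => _ [u [u0 vu] <-].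
have [->|[y by_ ->]] := lam_unit_coords u0 vu; first by rewrite subrr (ov0 hCp) leey.
have [z zr yz] := reps_mem hr by_.
have -> : y = z + (y - z) by rewrite addrC subrK.
by rewrite -ov_lam_inv lam_inv_near //; exact: xmin.
Qed.

(** A nontrivial value of [lam] at a unit is a root of unity congruent to 1, and its powers are
    again values at units. *)
Lemma mu_units_lt1 : (M < 1)%E.
Proof.
have [u [u0 vu /eqP lu]] := ramified_unit.
have [N N0 uN] := lam_unit_root u0 vu.
have [k hk] := root_of_unity_ord pp podd hCp N0 uN lu (lam_cong1 u0).
apply: le_lt_trans hk; rewrite -(lamX hlam) //; apply: mu_units_le; first by rewrite expf_neq0.
by rewrite valX // vu mulr0.
Qed.

Lemma mu_units_lt_q : (M < ov (q + 1)%R)%E.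
Proof. exact: lt_le_trans mu_units_lt1 q_succ_ge1. Qed.

Lemma mu_units_fin : (M < +oo)%E.
Proof. by apply: lt_trans mu_units_lt1 _; rewrite ltey. Qed.

Lemma mu_le z : z != 0 -> (mu <= ov (lam z - 1)%R)%E.
Proof. by move=> z0; apply: ereal_inf_lbound; exists z. Qed.

Lemma mu_le_units : (mu <= M)%E.
Proof. by have [x _ ->] := mu_units_attained; rewrite ov_lam_inv mu_le // xom_neq0. Qed.

Lemma ov_lam_varpi : ov (lam varpi%:A - 1) = ov (q - gamma).
Proof.
have -> : q - gamma = q * - (lam varpi%:A - 1) by rewrite gammaE; ring.
by rewrite (ov_unitM hCp) ?(ovN hCp) //; exact: ov_q.
Qed.

(** As e = 1, the units and varpi generate the multiplicative group of Kv. *)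
Lemma le_mu N : (forall u, u != 0 -> vK u = 0 -> (N <= ov (lam u - 1)%R)%E) ->
  (N <= ov (lam varpi%:A - 1)%R)%E -> (N <= mu)%E.
Proof.
move=> hu hv; have vA : varpi%:A != 0 :> Kv by rewrite alg_eq0.
have hX (n : nat) : (N <= ov (lam varpi%:A ^+ n - 1)%R)%E.
  elim: n => [|n IHn]; first by rewrite expr0 subrr (ov0 hCp) leey.
  have -> : lam varpi%:A ^+ n.+1 - 1 =
    lam varpi%:A * (lam varpi%:A ^+ n - 1) + (lam varpi%:A - 1) by rewrite exprS; ring.
  by apply: (ov_geD hCp) => //; rewrite (ov_unitM hCp) // ov_lam.
have hZ (n : int) : (N <= ov (lam varpi%:A ^ n - 1)%R)%E.
  case: n => n; first exact: hX.
  rewrite NegzE -exprnN; have l0 : lam varpi%:A ^+ n.+1 != 0.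
    by rewrite expf_neq0 // (lam_neq0 hlam).
  have -> : lam varpi%:A ^- n.+1 - 1 =
    (lam varpi%:A ^+ n.+1)^-1 * - (lam varpi%:A ^+ n.+1 - 1).
    by move: l0; set a := _ ^+ _ => l0; field.
  rewrite (ov_unitM hCp) ?(ovN hCp) // (ov_unitV hCp) // (ov_unitX hCp) //.
  exact: ov_lam.
apply: le_ereal_inf_tmp => _ [z z0 <-]; rewrite /= in z0.
have vn : varpi%:A ^ vK z != 0 :> Kv by rewrite expfz_neq0.
have u0 : z / varpi%:A ^ vK z != 0 by rewrite mulf_neq0 ?invr_eq0.
have vu : vK (z / varpi%:A ^ vK z) = 0.
  by rewrite valM ?invr_eq0 // valV // valXz // vKA v_varpi mulr1 subrr.
have -> : lam z = lam (z / varpi%:A ^ vK z) * lam varpi%:A ^ vK z.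
  by rewrite -(lamXz hlam) // -(lamM hlam) // divfK.
set u := z / _ in u0 vu *.
have -> : lam u * lam varpi%:A ^ vK z - 1 =
  lam u * (lam varpi%:A ^ vK z - 1) + (lam u - 1) by ring.
by apply: (ov_geD hCp); [rewrite (ov_unitM hCp) // ov_lam|exact: hu].
Qed.

Lemma mu_ge : (M <= ov (1 + gamma)%R)%E -> (M <= mu)%E.
Proof.
move=> hM; apply: le_mu; first exact: mu_units_le.
rewrite ov_lam_varpi; have -> : q - gamma = (q + 1) - (1 + gamma) by ring.
by apply: (ov_geD hCp); rewrite ?(ovN hCp) // ltW // mu_units_lt_q.
Qed.

Lemma ov_A_coef_sum (beta : Fv) (r : nat) : beta != 0 -> vF (t * beta) = m + r%:Z ->
  ov (A beta) = ov (coef_sum r).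
Proof.
move=> b0 vb; have [c0 [hc [J hJ]]] := A_trunc_omega b0.
have tb0 : t * beta != 0 by rewrite mulf_neq0 // (orth_t_neq0 O).
have hj : J <= (absz J + r.+1)%N%:Z by clear; lia.
have rj : (r < absz J + r.+1)%N by clear; lia.
rewrite (hJ _ hj) (fourier_coef_sum tb0 vb rj) (ov_unitM hCp) // (ov_unitM hCp) //.
have oq := ov_q; by rewrite (ov_unitM hCp) ?ov_cF // (ov_unitV hCp).
Qed.

Lemma ov_A_lam_dev (beta : Fv) : beta != 0 -> ~ ball vF m (t * beta) ->
  ov (A beta) = ov (fourier vF cF psi lam_dev (t * beta)).
Proof.
move=> b0 nb; have [c0 [hc [J hJ]]] := A_trunc_omega b0.
have hj : J <= (absz J)%:Z by clear; lia.
by rewrite (hJ _ hj) (ov_unitM hCp) // fourier_lam_dev ind0 // mulr0 subr0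
  -(fourier_T0_const nb (absz J)).
Qed.

(** [lam_dev] is invariant under [ball vF 1], so its transform lives on [ball vF (m - 1)]. *)
Lemma ov_A_zero (beta : Fv) : beta != 0 -> ~ ball vF (m - 1) (t * beta) ->
  ov (A beta) = +oo%E.
Proof.
move=> b0 nb; rewrite ov_A_lam_dev // => [|h]; last first.
  by apply: nb; apply: ball_le h; clear; lia.
have s1 : sch vF 0 1 lam_dev.
  apply: sch_mul => //; first exact: sch_ball.
  by move=> x y _ by_; rewrite lam_inv_near.
have [-> // _] := sch_fourier hFv hpsi hm cF ler01 s1; exact: (ov0 hCp).
Qed.

Lemma fourier_lam_dev_ge b : (M <= ov (fourier vF cF psi lam_dev b))%E.
Proof.
apply: (ov_haar hCp hFv ov_q); first by rewrite ov_cF.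
  by apply: (schwartz_psiN hFv hpsi hm); exact: schwartz_lam_dev.
move=> x; rewrite mulrC (ov_unitM hCp) ?ov_psi // /lam_dev.
case: (pselect (ball vF 0 x)) => bx; last by rewrite (ind0 bx) mul0r (ov0 hCp) leey.
by rewrite (ind1 bx) mul1r mu_units_le_lam_inv.
Qed.

(* Otherwise Fourier inversion would bound [lam_dev] beyond its minimal valuation. *)
Lemma fourier_lam_dev_attained : exists b : Fv,
  [/\ b != 0, vF b = m - 1 & ov (fourier vF cF psi lam_dev b) = M].
Proof.
apply: contrapT => no; have big b : (M < ov (fourier vF cF psi lam_dev b))%E.
  case: (pselect (ball vF m b)) => bm.
    (* On [ball vF m] the coefficient is a unit times q + 1, whose order exceeds [M]. *)
    rewrite fourier_lam_dev fourier_T0_zero // ind1 // mulr1.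
    have -> : - (cF * q^-1) - cF = - (cF * q^-1) * (q + 1) by field.
    rewrite (ov_unitM hCp) ?mu_units_lt_q // (ovN hCp) (ov_unitM hCp) ?ov_cF //.
    by rewrite (ov_unitV hCp) //; exact: ov_q.
  case: (pselect (ball vF (m - 1) b)) => bm1; last first.
    have s1 : sch vF 0 1 lam_dev.
      apply: sch_mul => //; first exact: sch_ball.
      by move=> x y _ by_; rewrite lam_inv_near.
    by have [-> // _] := sch_fourier hFv hpsi hm cF ler01 s1; rewrite (ov0 hCp) mu_units_fin.
  have [b0 _] := not_ball bm.
  have vb : vF b = m - 1 by move: bm bm1; rewrite !ballE //; move: (vF b); clear; lia.
  rewrite lt_neqAle fourier_lam_dev_ge andbT; apply/eqP => E; apply: no.
  by exists b.
have [x bx Mx] := mu_units_attained.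
have : (M < ov (lam_dev x))%E.
  have [_ /(_ _ schwartz_lam_dev (- x))] := res_dualF S; rewrite opprK => <-.
  apply: (ov_haar_gt hCp hFv ov_q); rewrite ?ov_cF ?mu_units_fin //.
    by apply: (schwartz_psiN hFv hpsi hm); apply: (schwartz_fourier hFv hpsi hm);
      exact: schwartz_lam_dev.
  by move=> y; rewrite mulrC (ov_unitM hCp) ?ov_psi.
by rewrite /lam_dev ind1 // mul1r -Mx ltxx.
Qed.

(** Everything is a sign: [lams z] is congruent to (-1)^(vK z), and [kappa] and an even multiple of
    [vF t] drop out of the parities. *)
Lemma eps_sign (beta : Fv) (r : int) : beta != 0 -> vF (t * beta) = m + r ->
  cong eps (- (-1) ^ r * (tau beta * lams (2%:R * theta))).
Proof.
move=> b0 vb; have t0 := orth_t_neq0 O; have bA : beta%:A != 0 :> Kv by rewrite alg_eq0.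
have th20 : 2%:R * theta != 0 by rewrite mulf_neq0 ?(two_neq0K H).
have h1 := cong_trans hCp (cong_sym hCp (tau_cong b0)) (lams_cong bA).
have h2 := lams_cong th20.
have vth : vK (2%:R * theta) = - (vF t + kappa).
  by rewrite two_theta valV // v_two_d.
have := congM hCp h1 h2; rewrite ov_tau (ov_unitXz hCp) // => /(_ (lexx _) (lexx _)).
rewrite vKA vth -expfzDr ?oppr_eq0 ?oner_eq0 // => h.
apply: (cong_trans hCp eps_ram).
apply: (cong_sym hCp); rewrite mulNr; apply: (congN hCp).
have -> : (-1) ^ (m - kappa) =
    (-1) ^ r * (-1) ^ (vF beta - (vF t + kappa)) :> algC.
  rewrite -expfzDr ?oppr_eq0 ?oner_eq0 //.
  have -> : m - kappa =
      r + (vF beta - (vF t + kappa)) + 2 * (vF t - r).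
    move: vb; rewrite valM //; move: (vF t) (vF beta) kappa; clear; lia.
  rewrite [LHS]expfzDr ?oppr_eq0 ?oner_eq0 //.
  have -> : (-1) ^ (2 * (vF t - r)) = 1 :> algC.
    by rewrite -exprz_exp -[(-1) ^ 2]/((-1) ^+ 2) sqrrN expr1n exp1rz.
  by rewrite mulr1.
apply: (congMl hCp) => //; by rewrite (ov_unitXz hCp).
Qed.

Lemma mu_attained_cases (beta : Fv) : beta != 0 -> ov (A beta) = mu ->
  vF (t * beta) = m - 1 \/ exists n : nat, vF (t * beta) = m + n%:Z.
Proof.
move=> b0 hmu; have tb0 : t * beta != 0 by rewrite mulf_neq0 // (orth_t_neq0 O).
case: (pselect (ball vF (m - 1) (t * beta))) => [|/(ov_A_zero b0) Aoo].
  rewrite ballE // le_eqVlt => /orP[/eqP <-|lt]; first by left.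
  right; exists (absz (vF (t * beta) - m)); move: lt; move: (vF _); clear; lia.
by have := le_lt_trans mu_le_units mu_units_fin; rewrite -hmu Aoo ltxx.
Qed.

Lemma odd_or_double n : exists k, n = k.*2 \/ n = k.*2.+1.
Proof.
by exists n./2; rewrite -{1 3}(odd_double_half n); case: (odd n); [right|left].
Qed.

Lemma eps_plus (beta : Fv) (r : int) : beta != 0 -> vF (t * beta) = m + r ->
  (-1) ^ r = -1 :> algC -> cong eps (tau beta * lams (2%:R * theta)).
Proof. by move=> b0 /(eps_sign b0) + r1; rewrite r1 opprK mul1r. Qed.

Lemma eps_minus (beta : Fv) (r : int) : beta != 0 -> vF (t * beta) = m + r ->
  (-1) ^ r = 1 :> algC -> cong eps (- tau beta * lams (2%:R * theta)).
Proof. by move=> b0 /(eps_sign b0) + r1; rewrite r1 mulNr mul1r mulNr. Qed.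

Let signN1 : (-1) ^ (-1) = -1 :> algC.
Proof. by rewrite exprN1 invrN invr1. Qed.

Let sign_double k : (-1) ^ (k.*2)%:Z = 1 :> algC.
Proof. by rewrite -exprnP -signr_odd odd_double. Qed.

Let sign_doubleS k : (-1) ^ (k.*2.+1)%:Z = -1 :> algC.
Proof. by rewrite -exprnP -signr_odd /= odd_double expr1. Qed.

Lemma eps_equal_case : ov (1 + gamma) = M ->
  forall delta : algC, delta = 1 \/ delta = -1 -> exists beta : Fv,
    [/\ beta != 0, ov (A beta) = mu & cong eps (delta * tau beta * lams (2%:R * theta))].
Proof.
move=> gM; have muM : mu = M by apply/eqP; rewrite eq_le mu_le_units mu_ge ?gM.
have t0 := orth_t_neq0 O; move=> _ [->|->].
  (* For delta = 1: r = -1, where the deviation from 1 on the units is attained. *)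
  have [b [b0 vb ob]] := fourier_lam_dev_attained.
  have tb : t * (t^-1 * b) = b by rewrite mulrA divff ?mul1r.
  have beta0 : t^-1 * b != 0 by rewrite mulf_neq0 ?invr_eq0.
  exists (t^-1 * b); split=> //.
    by rewrite ov_A_lam_dev // tb ?ob ?muM // ballE // vb; clear; lia.
  by rewrite mul1r; apply: (eps_plus beta0 _ signN1); rewrite tb.
(* For delta = -1: r = 0, where A_beta is a unit times 1 + gamma. *)
have v0 : varpi ^ m != 0 by rewrite expfz_neq0.
have vm : vF (varpi ^ m) = m + 0%:Z by rewrite valXz // v_varpi mulr1 addr0.
have tb : t * (t^-1 * varpi ^ m) = varpi ^ m by rewrite mulrA divff ?mul1r.
have beta0 : t^-1 * varpi ^ m != 0 by rewrite mulf_neq0 ?invr_eq0.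
exists (t^-1 * varpi ^ m); split=> //.
  by rewrite (@ov_A_coef_sum _ 0) ?tb // (ov_coef_sum_even 0) gM muM.
by rewrite mulN1r; apply: (eps_minus beta0 (r := 0)); rewrite ?tb.
Qed.

(** Even r >= 0 cannot occur, since A_beta would have the order of 1 + gamma, above [M] and so above
    [mu]. *)
Lemma eps_greater_case : (M < ov (1 + gamma)%R)%E ->
  forall beta : Fv, beta != 0 -> ov (A beta) = mu ->
    cong eps (tau beta * lams (2%:R * theta)).
Proof.
move=> gM beta b0 hmu; have [vb|[n vb]] := mu_attained_cases b0 hmu.
  exact: eps_plus b0 vb signN1.
have [k [nE|nE]] := odd_or_double n; last first.
  by apply: (eps_plus b0 vb); rewrite nE.
move: gM; rewrite -(ov_coef_sum_even k) -nE -(ov_A_coef_sum b0 vb) hmu.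
by rewrite ltNge mu_le_units.
Qed.

(** Here [mu] is at most the order of 1 + gamma. This excludes r = -1, where A_beta has order at
    least [M], and odd r >= 0 by [ov_coef_sum_odd]. *)
Lemma eps_less_case : (ov (1 + gamma)%R < M)%E ->
  forall beta : Fv, beta != 0 -> ov (A beta) = mu ->
    cong eps (- tau beta * lams (2%:R * theta)).
Proof.
move=> gM beta b0 hmu; have gq := lt_trans gM mu_units_lt_q.
have mug : (mu <= ov (1 + gamma)%R)%E.
  have vA : varpi%:A != 0 :> Kv by rewrite alg_eq0.
  apply: le_trans (mu_le vA) _; rewrite ov_lam_varpi.
  have -> : q - gamma = - (1 + gamma) + (q + 1) by ring.
  by rewrite (ov_eqDl hCp) (ovN hCp).
have [vb|[n vb]] := mu_attained_cases b0 hmu.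
  have nb : ~ ball vF m (t * beta).
    by rewrite ballE ?mulf_neq0 ?(orth_t_neq0 O) // vb; clear; lia.
  have := fourier_lam_dev_ge (t * beta); rewrite -ov_A_lam_dev // hmu.
  by move=> /(lt_le_trans gM); rewrite ltNge mug.
have [k [nE|nE]] := odd_or_double n; first by apply: (eps_minus b0 vb); rewrite nE.
by have := ov_coef_sum_odd k gq; rewrite -nE -(ov_A_coef_sum b0 vb) hmu ltNge mug.
Qed.

(** Positivity at each z does not bound the infimum; but it is bounded below by the value at varpi
    and by [M], which is attained. *)
Lemma mu_gt0 : (0 < mu)%E.
Proof.
have vA : varpi%:A != 0 :> Kv by rewrite alg_eq0.
have pos := lam_cong1 vA; have Mpos : (0 < M)%E.
  by have [x _ ->] := mu_units_attained; rewrite ov_lam_inv; apply: lam_cong1; exact: xom_neq0.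
have [le|/ltW le] := leP M (ov (lam varpi%:A - 1)).
  by apply: lt_le_trans Mpos _; apply: le_mu => // u; exact: mu_units_le.
apply: lt_le_trans pos _; apply: le_mu => // u u0 vu.
by apply: le_trans le _; exact: mu_units_le.
Qed.

End CongruentToOne.
End Residual.

Theorem proposition4p7
  (p : nat) (p_prime : prime p) (p_odd : odd p)
  (R : realType) (Cp : closedFieldType) (ord : Cp -> \bar R)
  (hCp : is_padic_complex p ord) (iota_p : {rmorphism algC -> Cp})
  (F : fieldExtType rat) (K : fieldExtType F) (hCM : CM_extension K)
  (Fv : fieldType) (vF : Fv -> int) (hFv : local_field vF)
  (iF : {rmorphism F -> Fv}) (iF_dense : dense_image vF iF)
  (v_notin_p : vF p%:R = 0)
  (Kv : fieldExtType Fv) (vK : Kv -> int) (hKv : local_field vK)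
  (iK : {rmorphism K -> Kv}) (iK_dense : dense_image vK iK)
  (Kv_quadratic : \dim {:Kv} = 2%N)
  (iFK : forall a : F, iK a%:A = (iF a)%:A)
  (vFK : exists2 e : int, 0 < e & forall x : Fv, vK x%:A = e * vF x)
  (bar : {rmorphism Kv -> Kv}) (bar_fix : forall x : Fv, bar x%:A = x%:A)
  (bar_nontrivial : exists x, bar x <> x)
  (chi : (K -> int) -> K -> algC) (hchi : algebraic_hecke_character chi)
  (lam : Kv -> algC) (hlam : quasicharacter vK lam)
  (lam_chi : forall a : K, a != 0 -> lam (iK a) = chi (vK \o iK) a)
  (psi : Fv -> algC) (hpsi : nontrivial_additive_character vF psi)
  (cF : algC) (hcF : self_dual vF psi cF)
  (cK : algC) (hcK : self_dual vK (psi_ext bar psi) cK)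
  (eps : algC)
  (heps : is_epsilon_half vK cK (psi_ext bar psi) (star vK lam) eps)
  (theta : Kv) (theta_neq0 : theta != 0) (bar_theta : bar theta = - theta)
  (lam_self_dual : forall x : Fv, x != 0 ->
     congr_p ord iota_p (star vK lam x%:A) (quad_char bar x)) :
  let cong := congr_p ord iota_p in
  let lams := star vK lam in
  let tau := quad_char bar in
  let A := A_coef vF vK cF psi lams theta in
  let mu := mu_p ord iota_p lam in
  let mu_units := mu_p_units ord iota_p vK lam in
  let ord_p := ordp ord iota_p in
  [/\ cong eps (lams (2%:R * theta)) \/ cong eps (- lams (2%:R * theta)),
      mu = 0%E ->
        forall beta : Fv, beta != 0 ->
          ~ cong (A beta) 0 -> cong eps (tau beta * lams (2%:R * theta)) &
      (0 < mu)%E -> ~ unramified vK lam ->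
        forall varpi : Fv, varpi != 0 -> vF varpi = 1 ->
        [/\ ord_p (lams varpi%:A + 1) = mu_units ->
              forall delta : algC, delta = 1 \/ delta = -1 ->
                exists beta : Fv,
                  [/\ beta != 0,
                      ord_p (A beta) = mu &
                      cong eps (delta * tau beta * lams (2%:R * theta))],
            (mu_units < ord_p (lams varpi%:A + 1)%R)%E ->
              forall beta : Fv, beta != 0 -> ord_p (A beta) = mu ->
                cong eps (tau beta * lams (2%:R * theta)) &
            (ord_p (lams varpi%:A + 1)%R < mu_units)%E ->
              forall beta : Fv, beta != 0 -> ord_p (A beta) = mu ->
                cong eps (- tau beta * lams (2%:R * theta))]].
Proof.
have char0 n : (0 < n)%N -> n%:R != 0 :> Fv.
  move=> n0; rewrite -(rmorph_nat iF) fmorph_eq0 -(rmorph_nat (in_alg F)) fmorph_eq0.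
  by rewrite pnatr_eq0 -lt0n.
have two0 : 2%:R != 0 :> Fv by exact: char0.
have four0 : 4%:R * theta != 0.
  by rewrite mulf_neq0 // -(rmorph_nat (in_alg Kv)) fmorph_eq0 char0.
set d := (4%:R * theta)^-1; have [e e_gt0 vKe] := vFK.
have H : quad_setup vF vK bar e d.
  split=> //; first by rewrite invr_eq0.
  by rewrite /d fmorphV rmorphM rmorph_nat bar_theta mulrN invrN.
have [omega [t [x0 O]]] := orth_setup_ex H; have [m hm] := conductor_ex hpsi.
have S : residual_setup p ord iota_p vF vK bar e d omega t x0 lam psi cF cK m.
  by split=> //; apply: char0; exact: prime_gt0.
have dth : d = (4%:R * theta)^-1 by [].
move=> cong lams tau A mu mu_units ord_p.
have th20 : 2%:R * theta != 0 by rewrite mulf_neq0 ?(two_neq0K H).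
have nonres : (exists2 z, z != 0 & ~ cong (lam z) 1) \/ (forall z, z != 0 -> cong (lam z) 1).
  case: (pselect (exists2 z, z != 0 & ~ cong (lam z) 1)) => [|no]; first by left.
  by right=> z z0; apply: contrapT => nz; apply: no; exists z.
have signE (i : int) : (-1) ^ i = 1 :> algC \/ (-1) ^ i = -1 :> algC.
  have h (n : nat) : (-1) ^+ n = 1 :> algC \/ (-1) ^+ n = -1 :> algC.
    by rewrite -signr_odd; case: (odd n); [right|left].
  case: i => n; first exact: h.
  by rewrite NegzE -exprnN; have [->|->] := h n.+1; rewrite ?invrN invr1; [left|right].
split.
- have [hz|lam1] := nonres.
    have [beta b0 nA] := nonvanishing_coef S theta_neq0 dth hz.
    have := eps_of_nonvanishing S theta_neq0 dth heps b0 nA hz.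
    by have [->|->] := tau_sign bar beta; rewrite ?mul1r ?mulN1r; [left|right].
  have hl := cong_sym hCp (lams_cong S lam1 th20).
  (* For [lam] congruent to 1, both [eps] and [lams (2 theta)] are congruent to signs. *)
  have key (i : int) : cong eps ((-1) ^ i) \/ cong eps (- (-1) ^ i) ->
      cong eps (lams (2%:R * theta)) \/ cong eps (- lams (2%:R * theta)).
    have same : cong eps ((-1) ^ vK (2%:R * theta)) -> cong eps (lams (2%:R * theta)).
      by move=> h; exact (cong_trans hCp h hl).
    have opp : cong eps (- (-1) ^ vK (2%:R * theta)) -> cong eps (- lams (2%:R * theta)).
      by move=> h; exact (cong_trans hCp h (congN hCp hl)).
    move: same opp; have [->|->] := signE i; have [->|->] := signE (vK (2%:R * theta));
      rewrite ?opprK; tauto.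
  have [un|ram] := pselect (unramified vK lam).
    by apply: key; left; exact: (eps_unram S heps lam1 un).
  by apply: key; right; exact: (eps_ram S heps lam1 ram).
- move=> mu0 beta b0 nA.
  apply: (eps_of_nonvanishing S theta_neq0 dth heps b0 nA).
  have [//|lam1] := nonres; have [[_ [w [w0 w1]] _ _] _ _] := hFv.
  by have := mu_gt0 S lam1 w0 w1; rewrite -/mu mu0 ltxx.
move=> mu0 ram varpi v0 v1.
have lam1 z : z != 0 -> cong (lam z) 1.
  by move=> z0; apply: lt_le_trans mu0 _; apply: ereal_inf_lbound; exists z.
rewrite [lams _ + 1]addrC; split.
- exact: (eps_equal_case S theta_neq0 dth heps lam1 ram v0 v1).
- exact: (eps_greater_case S theta_neq0 dth heps lam1 ram v0 v1).
exact: (eps_less_case S theta_neq0 dth heps lam1 ram v0 v1).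
Qed.
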